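(* Let $T\subset V$ be a compact rooted tree with root vertex $v_T$, frontier $\mathcal{F}=\{f_0,\ldots,f_{n-1}\}$, and edge set $\mathcal{E}$. Let $\mathbf{d}_{\mathcal{F}}=(d_{f_0},\ldots,d_{f_{n-1}})\in(\mathbb{R}^+)^{\mathcal{F}}$ be such that $\overline{\mathrm{Ad}}(\mathbf{d}_{\mathcal{F}})\neq\emptyset$, and let $\mathbf{d}=(\mathbf{d}_{\mathcal{E}},\mathbf{d}_{\mathcal{F}})\in\overline{\mathrm{Ad}}(\mathbf{d}_{\mathcal{F}})$ be a local minimum of the map $\mathbf{d}\mapsto D_T(\mathbf{d}_{\mathcal{E}},\mathbf{d}_{\mathcal{F}})$ on $\overline{\mathrm{Ad}}(\mathbf{d}_{\mathcal{F}})$. Then either $P_v(\mathbf{d})\in\mathcal{BC}_{n_v}$ for each $v\in T^{(0)}-\{v_T\}$, or all of the following hold: - $P_{v_T}(\mathbf{d})\in\mathcal{BC}_{n_T}$, where $n_T$ is the valence of $v_T$ in $V$. - Let $T_0$ be the maximal subtree of $T$ containing $v_T$ with the property that $J(P_v(\mathbf{d}))=J(P_{v_T}(\mathbf{d}))$ for all $v\in T_0^{(0)}$. For the edge $e_T\in\mathcal{E}\cup\mathcal{F}$ containing $v_T$ such that $d_{e_T}$ is maximal among all such edges, either $e_T\in\mathcal{F}$, or $e_T$ is an edge of $T_0$ and its other endpoint $v_T'$ is on the boundary of $T_0$ (i.e. has valence one in $T_0$). - For every vertex $v$ of $T$ such that $P_v(\mathbf{d})\notin\mathcal{BC}_{n_v}$,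 the edge $e_v$ has its other endpoint in $T_0$. - If $e_T\in\mathcal{E}$, there is no $v\in v_T'-1$ with $P_v(\mathbf{d})\notin\mathcal{BC}_{n_v}$.
   Context: **Cyclic polygons.** A cyclic $n$-gon ($n\ge3$) is a convex polygon in $\mathbb{H}^2$ whose $n$ vertices lie on a hyperbolic circle (its circumcircle); its circumcircle center need not lie in the polygon. It is determined up to isometry by its cyclically ordered side lengths. $\mathcal{AC}_n\subset(\mathbb{R}^+)^n$ is the open set of side-length tuples of cyclic $n$-gons; explicitly $(d_0,\ldots,d_{n-1})\in\mathcal{AC}_n$ iff $\sinh(d_i/2)<\sum_{j\ne i}\sinh(d_j/2)$ for every $i$. Its subsets $\mathcal{C}_n$ and $\mathcal{BC}_n$ consist of the tuples of centered $n$-gons (circumcircle center in the interior) and semicyclic $n$-gons (circumcircle center in a side), respectively. $J:\mathcal{AC}_n\to\mathbb{R}^+$ is the circumcircle radius and $D_0:\mathcal{AC}_n\to\mathbb{R}$ the area of the corresponding cyclic $n$-gon. These sets and functions are invariant under permutation of entries. **Trees.** $T$ is a compact (finite) rooted tree with root vertex $v_T$, edge set $\mathcal{E}$ and vertex set $T^{(0)}$, a subgraph of an ambient graph $V$ in which each vertex $v$ of $T$ has valence $n_v\ge3$ ($n_T=n_{v_T}$). Its frontier $\mathcal{F}$ is the collection of edges of $V$ that intersect $T$ but do not lie in it; each frontier edge has exactly one vertex in $T$. For $v\in T^{(0)}-\{v_T\}$, $e_v$ is the initial edge of the arc of $T$ joining $v$ to $v_T$. For $v\in T^{(0)}$, $v-1$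 is the set of $w\in T^{(0)}-\{v_T,v\}$ such that $v\in e_w$. For $\mathbf{d}=(\mathbf{d}_{\mathcal{E}},\mathbf{d}_{\mathcal{F}})\in(\mathbb{R}^+)^{\mathcal{E}}\times(\mathbb{R}^+)^{\mathcal{F}}$ and a vertex $v$ of $T$, $P_v(\mathbf{d})$ is the $n_v$-tuple of entries $d_e$ over the edges $e\in\mathcal{E}\cup\mathcal{F}$ containing $v$. **Admissible space.** For $\mathbf{d}_{\mathcal{F}}\in(\mathbb{R}^+)^{\mathcal{F}}$, $\overline{\mathrm{Ad}}(\mathbf{d}_{\mathcal{F}})=\overline{\mathrm{Ad}}_T(\mathbf{d}_{\mathcal{F}})$ is the set of $\mathbf{d}=(\mathbf{d}_{\mathcal{E}},\mathbf{d}_{\mathcal{F}})$ with $\mathbf{d}_{\mathcal{E}}\in(\mathbb{R}^+)^{\mathcal{E}}$ such that: (1) for $v\in T^{(0)}-\{v_T\}$, $P_v(\mathbf{d})\in\mathcal{AC}_{n_v}-\mathcal{C}_{n_v}$ has largest entry $d_{e_v}$; (2) $P_{v_T}(\mathbf{d})\in\mathcal{C}_{n_T}\cup\mathcal{BC}_{n_T}$; (3) $J(P_v(\mathbf{d}))\ge J(P_w(\mathbf{d}))$ for each $v\in T^{(0)}$ and $w\in v-1$. (If $T=\{v_T\}$ then $\mathcal{E}=\emptyset$ and $\overline{\mathrm{Ad}}(\mathbf{d}_{\mathcal{F}})$ is $\{\mathbf{d}_{\mathcal{F}}\}$ or empty according to whether (2) holds.) The area function is $D_T(\mathbf{d})=\sum_{v\in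 T^{(0)}}D_0(P_v(\mathbf{d}))$. *)

(* Defs.v *)
From HB Require Import structures.
From mathcomp Require Import all_boot all_order all_algebra.
From mathcomp Require Import finmap.
From mathcomp Require Import all_classical all_reals all_analysis.

Set Implicit Arguments.
Unset Strict Implicit.
Unset Printing Implicit Defensive.

Import Order.TTheory GRing.Theory Num.Theory.
Import numFieldNormedType.Exports.

Local Open Scope classical_set_scope.
Local Open Scope fset_scope.
Local Open Scope ring_scope.

(* The hyperbolic plane is the Beltrami-Klein model: the open unit disk of
   R * R, in which hyperbolic geodesics are the Euclidean chords.  Hence
   hyperbolic segments, half-planes and convexity are the affine ones. *)
Section HyperbolicPlane.
Variable R : realType.
Implicit Types (p q a b c z : R * R).

Definition dotp p q : R := p.1 * q.1 + p.2 * q.2.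

Definition H2 : set (R * R) := [set z | dotp z z < 1].

Definition arcosh (x : R) : R := ln (x + Num.sqrt (x ^+ 2 - 1)).

Definition hdist p q : R :=
  arcosh ((1 - dotp p q) /
          (Num.sqrt (1 - dotp p p) * Num.sqrt (1 - dotp q q))).

(* The Riemannian area form of the Klein metric (of curvature -1) is
   (1 - x^2 - y^2)^(-3/2) dx dy. *)
Definition harea (A : set (R * R)) : R :=
  \int[(@lebesgue_measure R \x @lebesgue_measure R)%E]_(z in A)
    (Num.sqrt (1 - dotp z z) ^+ 3)^-1.

Definition hcircle c (r : R) : set (R * R) := [set z | H2 z /\ hdist c z = r].

Definition segment a b : set (R * R) :=
  [set z | exists t : R, [/\ 0 <= t, t <= 1,
    z.1 = (1 - t) * a.1 + t * b.1 & z.2 = (1 - t) * a.2 + t * b.2]].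

(* Positive (resp. nonnegative) iff z is strictly (resp. weakly) to the left of
   the geodesic directed from a to b. *)
Definition leftof a b z : R :=
  (b.1 - a.1) * (z.2 - a.2) - (b.2 - a.2) * (z.1 - a.1).

End HyperbolicPlane.

Arguments H2 {R}.

Section CyclicPolygons.
Variables (R : realType) (n : nat).
Implicit Types (P : 'I_n -> R * R) (d : n.-tuple R).

(* P lists the vertices of a convex n-gon in counterclockwise cyclic order; the
   orientation is no restriction, since reflections preserve side lengths. *)
Definition convex_ngon P : Prop :=
  [/\ (3 <= n)%N, forall i, H2 (P i) &
      forall i j, j != i -> j != ordS i -> 0 < leftof (P i) (P (ordS i)) (P j)].

(* The region bounded by the polygon: the intersection of the half-planes
   bounded by its sides. *)
Definition region P : set (R * R) :=
  [set z | forall i, 0 <= leftof (P i) (P (ordS i)) z].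

Definition side P (i : 'I_n) : set (R * R) := segment (P i) (P (ordS i)).

Definition side_lengths P : n.-tuple R :=
  [tuple hdist (P i) (P (ordS i)) | i < n].

Definition is_circumcircle (c : R * R) (r : R) P : Prop :=
  [/\ H2 c, 0 < r & forall i, hcircle c r (P i)].

Definition cyclic_ngon (c : R * R) (r : R) P d : Prop :=
  [/\ convex_ngon P, is_circumcircle c r P & side_lengths P = d].

Definition AC : set (n.-tuple R) :=
  [set d | exists c r P, cyclic_ngon c r P d].

Definition CC : set (n.-tuple R) :=
  [set d | exists c r P, cyclic_ngon c r P d /\ interior (region P) c].

Definition BC : set (n.-tuple R) :=
  [set d | exists c r P, cyclic_ngon c r P d /\ exists i, side P i c].

(* Circumradius and area of a cyclic n-gon with side lengths d, which is unique
   up to isometry; the value 0 outside AC is never used. *)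
Definition J d : R := xget 0 [set r | exists c P, cyclic_ngon c r P d].

Definition D0 d : R :=
  xget 0 [set a | exists c r P, cyclic_ngon c r P d /\ a = harea (region P)].

End CyclicPolygons.

Arguments AC {R n}.
Arguments CC {R n}.
Arguments BC {R n}.

(* Possibly infinite graphs, with parallel edges allowed but no loops. *)
Record graph := Graph {
  gvert : choiceType;
  gedge : choiceType;
  ends : gedge -> {fset gvert};
  card_ends : forall e, #|` ends e| = 2%N }.

Record subgraph (V : graph) := Subgraph {
  sv : {fset gvert V};
  se : {fset gedge V};
  se_ends : forall e, e \in se -> ends e `<=` sv }.

Section Trees.
Variable V : graph.
Implicit Types (G H T : subgraph V) (F : {fset gedge V}).
Implicit Types (u v w : gvert V) (e f : gedge V).

Definition subgraph_le G H : Prop := sv G `<=` sv H /\ se G `<=` se H.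

(* The pairs (e, u) of s list the successive edges, each followed by the vertex
   at which it arrives. *)
Fixpoint walk G v (s : seq (gedge V * gvert V)) w : Prop :=
  if s is (e, u) :: s' then
    [/\ e \in se G, ends e = [fset v; u] & walk G u s' w]
  else v = w.

Definition arc G v (s : seq (gedge V * gvert V)) w : Prop :=
  [/\ v \in sv G, walk G v s w & uniq (v :: map snd s)].

Definition is_tree G : Prop :=
  sv G != fset0 /\
  forall v w, v \in sv G -> w \in sv G -> exists! s, arc G v s w.

Definition valence_in G v : nat := #|` [fset e in se G | v \in ends e]|.

Definition other_end e v w : Prop := ends e = [fset v; w].

Definition frontier_edge T e : Prop :=
  e \notin se T /\ exists2 v, v \in sv T & v \in ends e.

Definition is_frontier T F : Prop :=
  (forall e, e \in F <-> frontier_edge T e) /\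
  (forall e, e \in F -> #|` ends e `&` sv T| = 1%N).

(* Every edge of V containing a vertex v of T is in T or in its frontier F, so
   that star T F v is the set of all edges of V containing v. *)
Definition star T F v : {fset gedge V} :=
  [fset e in se T `|` F | v \in ends e].

Notation valence T F v := (#|` star T F v|).

(* init_edge T vT v e means e = e_v. *)
Definition init_edge T (vT : gvert V) v e : Prop :=
  exists w s, arc T v ((e, w) :: s) vT.

(* w belongs to v - 1. *)
Definition child T (vT : gvert V) v w : Prop :=
  [/\ w \in sv T, w != vT, w != v &
      exists2 e, init_edge T vT w e & v \in ends e].

Section Admissible.
Variable R : realType.
Variables (T : subgraph V) (vT : gvert V) (F : {fset gedge V}).

(* A tuple of edge lengths (d_E, d_F) is the restriction to E and F of a
   function on all edges of V, whose other values are never used. *)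
Implicit Types (dF d : gedge V -> R).

Definition Pv d v : (valence T F v).-tuple R :=
  map_tuple d (in_tuple (enum_fset (star T F v))).

Definition Ad dF : set (gedge V -> R) := [set d |
  [/\ (forall e, e \in se T -> 0 < d e) /\ (forall f, f \in F -> d f = dF f),
      forall v, v \in sv T -> v != vT ->
        (AC (Pv d v) /\ ~ CC (Pv d v)) /\
        (forall e, init_edge T vT v e ->
           forall f, f \in star T F v -> d f <= d e),
      CC (Pv d vT) \/ BC (Pv d vT) &
      forall v w, v \in sv T -> child T vT v w -> J (Pv d w) <= J (Pv d v)]].

Definition DT d : R := \sum_(v <- sv T) D0 (Pv d v).

Definition is_local_min dF d : Prop :=
  Ad dF d /\
  exists2 eps : R, 0 < eps &
    forall d', Ad dF d' -> (forall e, e \in se T -> `|d' e - d e| < eps) ->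
      DT d <= DT d'.

Definition equiradial_subtree d G : Prop :=
  [/\ is_tree G, subgraph_le G T, vT \in sv G &
      forall v, v \in sv G -> J (Pv d v) = J (Pv d vT)].

Definition maximal_equiradial_subtree d G : Prop :=
  equiradial_subtree d G /\
  forall H, equiradial_subtree d H -> subgraph_le H G.

Definition is_longest_root_edge d e : Prop :=
  e \in star T F vT /\ forall f, f \in star T F vT -> d f <= d e.

End Admissible.
End Trees.

Notation valence T F v := (#|` star T F v|).

(* Main.v *)
(* Encode a length d by x = sinh(d/2) and a circumradius J by s = sinh J; the
   side then subtends the half-angle ang x s = arcsin(x/s) at the center.  A
   polygon is centered or semicyclic iff its half-angles add up to pi, and
   noncentered or semicyclic iff those of the shorter sides add up to that of
   the longest.  Its area is 2 sum psi - 2 pi, resp. 2 (sum psi - psi_longest),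
   and after adding a multiple of the angle sum, psi becomes a function gfun whose
   derivative in s is a positive multiple of ang.  Summed over the tree the area
   thus becomes a sum over edges, which is seen to decrease when edges are
   shortened and the radii truncated at a smaller root radius, strictly unless all
   new radii are truncations of the old ones.

   At a local minimum with a nonroot vertex that is not semicyclic, consider a
   maximal cluster of such vertices with the same radius c below a vertex w.
   Solving the angle equations from the leaves up at a radius t slightly below c
   shortens all edges of the cluster.  If the polygon at w can absorb
   the change by adjusting its own radius (w inner with radius below that of its
   parent; w a centered root; or w a semicyclic endpoint of the longest side of a
   semicyclic root), the result is admissible and has smaller area.  So no such
   cluster exists, and the claims follow by induction along the tree. *)

Require Import Defs.
From HB Require Import structures.
From mathcomp Require Import all_boot all_order all_algebra.
From mathcomp Require Import finmap.
From mathcomp Require Import all_classical all_reals all_analysis.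
From mathcomp Require Import measurable_realfun ring lra.

Import Order.TTheory GRing.Theory Num.Theory.
Import numFieldNormedType.Exports.

Local Open Scope classical_set_scope.
Local Open Scope ring_scope.

Set Implicit Arguments.
Unset Strict Implicit.
Unset Printing Implicit Defensive.

(** * Hyperbolic area in the Klein model *)

(** The angle equation holds at every nonroot vertex, so adding a multiple of the signed angle sum
    costs nothing there, and the multiple [kap s] is the one for which the derivative in s becomes
    proportional to that sum. By the sign of the sum, the true radius is the strict minimum of the
    vertex term over all radii: replacing the radii of a new configuration by trial radii only
    raises its value, and no circumradius is ever differentiated. At the root, where the angles must
    add up to pi, the true radius is a maximum instead. Lowering it is profitable, but it forces the
    larger radii below it to be truncated, and this trade-off is the delicate comparison.

    An edge counts with a minus sign at its lower end, where it is longest, and with a plus sign at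
    its upper end. Radii that do not decrease toward the root make this difference monotone in the
    edge length.

    The longest edge of a semicyclic vertex is a diameter, so its radius cannot drop unless that
    edge is shortened too. Hence clusters avoid such vertices, and the longest root edge needs a
    move of its own. *)

Section change_of_variable.
Context (R : realType).
Local Notation mu := (@lebesgue_measure R).
Local Notation T := (measurableTypeR R).
Variables (D : set T) (m : T -> T) (h : T -> R).
Hypotheses (mD : measurable D) (mm : measurable_fun setT m)
  (mh : measurable_fun setT h) (h0 : forall x, 0 <= h x).
Hypothesis muD : forall B : set T, measurable B ->
  mu (B `&` D) = (\int[mu]_(x in m @^-1` B) (h x)%:E)%E.

Import HBNNSimple.

Let change_indic (B : set T) : measurable B ->
  (\int[mu]_(x in D) (\1_B x)%:E = \int[mu]_x ((\1_B (m x))%:E * (h x)%:E))%E.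
Proof.
move=> mB; transitivity (mu (B `&` D)); first exact: integral_indic.
rewrite muD// integral_mkcond.
apply: eq_integral => x _; rewrite patchE indicE.
have -> : (x \in m @^-1` B) = (m x \in B) by apply/idP/idP; rewrite !inE.
by case: ifPn => _; rewrite ?mul1e ?mul0e.
Qed.

Let change_nnsfun (f : {nnsfun T >-> R}) :
  (\int[mu]_(x in D) (f x)%:E = \int[mu]_x ((f (m x))%:E * (h x)%:E))%E.
Proof.
under [LHS]eq_integral do rewrite fimfunE -fsumEFin//.
rewrite [LHS]ge0_integral_fsum//; last 2 first.
  - move=> r; apply: measurable_funTS; apply/measurable_EFinP.
    exact: measurableT_comp.
  - by move=> n x _; rewrite EFinM nnfun_muleindic_ge0.
under [RHS]eq_integral.
  move=> x xD; rewrite fimfunE -fsumEFin// ge0_mule_fsuml; last first.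
    by move=> r; rewrite EFinM nnfun_muleindic_ge0.
  over.
have mcomp r : measurable_fun setT (fun x : T => (\1_(f @^-1` [set r]) (m x))%:E : \bar R).
  by apply/measurable_EFinP; apply: measurableT_comp.
rewrite [RHS]ge0_integral_fsum//; last 2 first.
  - move=> r; apply: emeasurable_funM; last exact/measurable_EFinP.
    under eq_fun do rewrite EFinM.
    by apply: emeasurable_funM => //; exact: measurable_cst.
  - move=> n x _; rewrite EFinM mule_ge0//; last by rewrite lee_fin.
    by rewrite nnfun_muleindic_ge0.
apply: eq_fsbigr => r rf.
have r0 : 0 <= r by move: rf; rewrite inE => -[t _ <-].
under [LHS]eq_integral do rewrite EFinM.
under [RHS]eq_integral do rewrite EFinM -muleA.
rewrite ge0_integralZl//; last first.
  by apply: measurable_funTS; apply/measurable_EFinP.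
rewrite ge0_integralZl//; last 2 first.
  - by apply: emeasurable_funM => //; exact/measurable_EFinP.
  - by move=> x _; rewrite mule_ge0// lee_fin.
by rewrite change_indic.
Qed.

(** [muD] says that Lebesgue measure on [D] is the image under [m] of the measure with density [h].
    This is the formula for indicators; linearity gives simple functions, and monotone convergence
    the rest. *)
Lemma ge0_change_of_variable (f : T -> \bar R) :
  measurable_fun setT f -> (forall x, 0 <= f x)%E ->
  (\int[mu]_(x in D) f x = \int[mu]_x (f (m x) * (h x)%:E))%E.
Proof.
move=> mf f0; pose f_ := nnsfun_approx measurableT mf.
have nd x : {homo (fun n => f_ n x) : a b / (a <= b)%N >-> a <= b}.
  by move=> a b ab; exact/lefP/nd_nnsfun_approx.
transitivity (lim (\int[mu]_(x in D) (f_ n x)%:E @[n --> \oo])%E).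
  rewrite -monotone_convergence//=.
  - by apply: eq_integral => x _; apply/esym/cvg_lim => //; exact: cvg_nnsfun_approx.
  - by move=> n; exact/measurable_EFinP/measurable_funTS.
  - by move=> n x _; rewrite lee_fin.
  - by move=> x _ a b ab; rewrite lee_fin nd.
transitivity (lim (\int[mu]_x ((f_ n (m x))%:E * (h x)%:E) @[n --> \oo])%E).
  by apply: congr_lim; apply/funext => n; exact: change_nnsfun.
rewrite -monotone_convergence//=.
- apply: eq_integral => x _; apply/cvg_lim => //.
  apply: cvgeMr => //; exact: cvg_nnsfun_approx.
- move=> n; apply: emeasurable_funM; last exact/measurable_EFinP.
  by apply/measurable_EFinP; exact: measurableT_comp.
- by move=> n x _; rewrite mule_ge0// lee_fin.
- by move=> x _ a b ab; rewrite lee_wpmul2r// ?lee_fin// nd.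
Qed.

End change_of_variable.

(** * Affine substitutions on the line *)

Section affine_change.
Context (R : realType).
Local Notation T := (measurableTypeR R).
Local Notation mu := (@lebesgue_measure R).

Let affine (k b : R) (x : T) : T := k * x + b.

Let measurable_affine k b : measurable_fun setT (affine k b).
Proof.
apply: (@continuous_measurable_fun R).
by move=> x; apply: cvgD; [apply: cvgMr; exact: cvg_id|exact: cvg_cst].
Qed.

(** The right-hand side is a measure in [B] that agrees with Lebesgue measure on half-open
    intervals. *)
Lemma lebesgue_measure_affine (k b : R) (B : set T) : 0 < k -> measurable B ->
  mu B = (k%:E * mu ((fun x : T => k * x + b)%R @^-1` B))%E.
Proof.
move=> k0 mB.
pose nu0 := mscale (NngNum (ltW k0)) (pushforward mu (affine k b)).
pose nu := nu0 (@measurable_affine k b).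
transitivity (nu B) => //.
apply: lebesgue_measure_unique => // X [[a1 a2] _ <-] /=.
rewrite /nu /nu0 /mscale/= /pushforward.
have -> : affine k b @^-1` `]a1, a2]%classic = `](a1 - b) / k, (a2 - b) / k]%classic.
  apply/seteqP; split => x; rewrite /= /affine !in_itv/= ltr_pdivrMr// ler_pdivlMr//
    ltrBlDr lerBrDr mulrC //.
rewrite !lebesgue_measure_itv/= !lte_fin ltr_pM2r ?invr_gt0// ltrD2r.
case: ifPn => _; last by rewrite mule0.
by rewrite -!EFinD -EFinM; congr EFin; field; exact: lt0r_neq0.
Qed.

Lemma ge0_integral_affine (k b : R) (f : T -> \bar R) : 0 < k ->
  measurable_fun setT f -> (forall x, 0 <= f x)%E ->
  (\int[mu]_x f x = \int[mu]_x (f (k * x + b)%R * k%:E))%E.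
Proof.
move=> k0 mf f0.
apply: (@ge0_change_of_variable _ setT (affine k b) (cst k)) => //.
  by move=> x; exact: ltW.
move=> B mB; rewrite setIT (lebesgue_measure_affine b k0 mB).
symmetry; apply: (@integral_cst _ _ _ mu _ _ k%:E).
by rewrite -(setTI (_ @^-1` _)); exact: measurable_affine.
Qed.

End affine_change.

(** * Shears and rotations of the plane *)

Section planar_change.
Context (R : realType).
Local Notation T := (measurableTypeR R).
Local Notation mu := (@lebesgue_measure R).
Local Notation mu2 := (mu \x mu)%E.
Local Open Scope ereal_scope.
Implicit Types f : T * T -> \bar R.

Definition shearx (a : R) (z : T * T) : T * T := (z.1 + a * z.2, z.2)%R.
Definition sheary (a : R) (z : T * T) : T * T := (z.1, z.2 + a * z.1)%R.

Lemma measurable_shearx a : measurable_fun setT (shearx a).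
Proof.
apply/measurable_fun_pairP; split; last exact: measurable_snd.
apply: (@measurable_funD _ _ R); first exact: measurable_fst.
by apply: (@measurable_funM _ _ R) => //; exact: measurable_snd.
Qed.

Lemma measurable_sheary a : measurable_fun setT (sheary a).
Proof.
apply/measurable_fun_pairP; split; first exact: measurable_fst.
apply: (@measurable_funD _ _ R); first exact: measurable_snd.
by apply: (@measurable_funM _ _ R) => //; exact: measurable_fst.
Qed.

Lemma ge0_integral_translation (b : R) (f : T -> \bar R) :
  measurable_fun setT f -> (forall x, 0 <= f x) ->
  \int[mu]_x f (x + b)%R = \int[mu]_x f x.
Proof.
move=> mf f0; rewrite [RHS](@ge0_integral_affine _ 1 b)//.
by apply: eq_integral => x _; rewrite mule1 mul1r.
Qed.

Lemma ge0_integral_shearx a f : measurable_fun setT f -> (forall z, 0 <= f z) ->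
  \int[mu2]_z f (shearx a z) = \int[mu2]_z f z.
Proof.
move=> mf f0; rewrite (fubini_tonelli2 (f \o shearx a)); last 2 first.
  - by apply: measurableT_comp => //; exact: measurable_shearx.
  - by move=> z; exact: f0.
rewrite [RHS]fubini_tonelli2//; apply: eq_integral => y _.
rewrite /fubini_G /= /shearx /=.
rewrite (@ge0_integral_translation (a * y) (fun x => f (x, y)))//.
exact: measurable_fun_pair1.
Qed.

Lemma ge0_integral_sheary a f : measurable_fun setT f -> (forall z, 0 <= f z) ->
  \int[mu2]_z f (sheary a z) = \int[mu2]_z f z.
Proof.
move=> mf f0; rewrite (fubini_tonelli1 (f \o sheary a)); last 2 first.
  - by apply: measurableT_comp => //; exact: measurable_sheary.
  - by move=> z; exact: f0.
rewrite [RHS]fubini_tonelli1//; apply: eq_integral => x _.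
rewrite /fubini_F /= /sheary /=.
rewrite (@ge0_integral_translation (a * x) (fun y => f (x, y)))//.
exact: measurable_fun_pair2.
Qed.

Definition rot (p q : R) (z : T * T) : T * T :=
  (p * z.1 - q * z.2, q * z.1 + p * z.2)%R.

(** [q / (1 + p)] is the tangent of half the rotation angle. Each of the three shears preserves area
    by Tonelli and translation invariance on lines. *)
Lemma rot_shears p q z : (p ^+ 2 + q ^+ 2 = 1)%R -> (1 + p != 0)%R ->
  rot p q z = shearx (- (q / (1 + p)))%R (sheary q (shearx (- (q / (1 + p)))%R z)).
Proof.
move=> pq p1; case: z => x y; rewrite /rot /shearx /sheary /=.
have qq : (q ^+ 2 = (1 - p) * (1 + p))%R by have := pq; lra.
have e : (q * q / (1 + p) = 1 - p)%R.
  by rewrite -expr2 qq mulfK.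
congr (_, _); last first.
  by transitivity (q * x + (1 - q * q / (1 + p)) * y)%R; [rewrite e|]; ring.
transitivity (x - (q / (1 + p)) * y - (q / (1 + p)) * y - (q * q / (1 + p)) * x
  + (q * q / (1 + p)) * (q / (1 + p)) * y)%R; last by ring.
rewrite e; transitivity (p * x - ((1 + p) * (q / (1 + p))) * y)%R; last by ring.
by rewrite [((1 + p) * _)%R]mulrC mulfVK.
Qed.

Lemma ge0_integral_rot p q f : (p ^+ 2 + q ^+ 2 = 1)%R ->
  measurable_fun setT f -> (forall z, 0 <= f z) ->
  \int[mu2]_z f (rot p q z) = \int[mu2]_z f z.
Proof.
wlog p1 : p q f / (1 + p != 0)%R.
  move=> rotW pq mf f0; have [p1|] := eqVneq (1 + p)%R 0%R; last by move=> ?; exact: rotW.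
  have q0 : q = 0%R by apply/eqP; rewrite -sqrf_eq0; apply/eqP; move: pq p1; nra.
  have pE : p = (-1)%R by lra.
  (* The half turn, excluded from the factorization into shears, is the square of a quarter turn. *)
  have rotE z : rot p q z = rot 0 1 (rot 0 1 z).
    by rewrite /rot pE q0; congr (_, _) => /=; ring.
  under eq_integral do rewrite rotE.
  have n1 : (1 + 0 != 0 :> R)%R by rewrite addr0 oner_neq0.
  have n2 : (0 ^+ 2 + 1 ^+ 2 = 1 :> R)%R by ring.
  rewrite (rotW 0%R 1%R (fun z => f (rot 0 1 z)))//; first exact: rotW.
  apply: measurableT_comp => //; rewrite (funext (fun z => rot_shears z n2 n1)).
  apply: measurableT_comp; first exact: measurable_shearx.
  by apply: measurableT_comp; [exact: measurable_sheary|exact: measurable_shearx].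
move=> pq mf f0; under eq_integral do rewrite rot_shears//.
have mx a : measurable_fun setT (fun z => f (shearx a z)).
  by apply: measurableT_comp => //; exact: measurable_shearx.
have my a b : measurable_fun setT (fun z => f (shearx a (sheary b z))).
  by apply: (measurableT_comp (mx a)); exact: measurable_sheary.
rewrite (@ge0_integral_shearx _ (fun z => f (shearx (- (q / (1 + p)))%R (sheary q z))))//.
by rewrite (@ge0_integral_sheary _ (fun z => f (shearx (- (q / (1 + p)))%R z)))// ge0_integral_shearx.
Qed.

End planar_change.

(** * Hyperbolic translations of a diameter *)

Section boost_line.
Context (R : realType).
Local Notation T := (measurableTypeR R).
Local Notation mu := (@lebesgue_measure R).
Variable (b : R).
Hypothesis b1 : `|b| < 1.

(** Half-open because Lebesgue measure is determined by its values on intervals []a, b]]. [m] is the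
    hyperbolic translation of this diameter in the Klein model, [n] its inverse and [h] its
    derivative. *)
Let D : set T := `]-1, 1]%classic.
Let m (x : T) : T := (x + b) / (1 + b * x).
Let n (x : T) : T := (x - b) / (1 - b * x).
Let h (x : T) : R := (1 - b ^+ 2) / (1 + b * x) ^+ 2.

Let b_lt1 : -1 < b < 1. Proof. by rewrite -ltr_norml. Qed.

Let norm_lt1 (x : R) : -1 <= x <= 1 -> `|b * x| < 1.
Proof.
rewrite -ler_norml normrM => x1; rewrite (le_lt_trans _ b1)//.
by rewrite ler_piMr.
Qed.

Let den_gt0 (x : R) : -1 <= x <= 1 -> 0 < 1 + b * x.
Proof. by move=> /norm_lt1; rewrite ltr_norml => /andP[? _]; lra. Qed.

Let den'_gt0 (x : R) : -1 <= x <= 1 -> 0 < 1 - b * x.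
Proof. by move=> /norm_lt1; rewrite ltr_norml => /andP[_ ?]; lra. Qed.

Let h_ge0 x : 0 <= h x.
Proof.
by rewrite mulr_ge0 ?invr_ge0 ?sqr_ge0//; move: b_lt1 => /andP[? ?]; nra.
Qed.

Let derivem (x : R) : -1 <= x <= 1 -> is_derive x 1 m (h x).
Proof.
move=> /den_gt0 /lt0r_neq0 d0.
have dd : is_derive x 1 (fun y : R => 1 + b * y) b.
  by apply: is_derive_eq; rewrite /GRing.scale/=; ring.
have dv := @is_deriveV _ (fun y : R => 1 + b * y) x b 1 d0 dd.
have da : is_derive x 1 (fun y : R => y + b) 1.
  by apply: is_derive_eq; rewrite addr0.
apply: (@is_derive_eq _ _ _ _ _ _ _ _ (is_deriveM da dv)).
by rewrite /h /GRing.scale/=; field.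
Qed.

Let mn x : -1 <= x <= 1 -> m (n x) = x.
Proof.
move=> x1; rewrite /m /n; have d := lt0r_neq0 (den'_gt0 x1).
have : 1 - b ^+ 2 != 0 by apply: lt0r_neq0; move: b_lt1 => /andP[? ?]; nra.
move=> e; field; rewrite d/=.
rewrite (_ : _ + _ = (1 - b ^+ 2) )//; ring.
Qed.

Let m_lt x y : -1 <= x <= 1 -> -1 <= y <= 1 -> (m x < m y) = (x < y).
Proof.
move=> x1 y1; have dx := den_gt0 x1; have dy := den_gt0 y1.
rewrite /m ltr_pdivrMr// mulrAC ltr_pdivlMr//.
rewrite -subr_gt0 (_ : _ - _ = (y - x) * (1 - b ^+ 2)); last by ring.
rewrite pmulr_lgt0 ?subr_gt0//; move: b_lt1 => /andP[? ?]; nra.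
Qed.

Let n_bd x : -1 <= x <= 1 -> -1 <= n x <= 1.
Proof.
move=> x1; have d := den'_gt0 x1; rewrite /n ler_pdivlMr// ler_pdivrMr//.
by move: b_lt1 x1 => /andP[? ?] /andP[? ?]; apply/andP; split; nra.
Qed.

Let m_bd x : -1 < x <= 1 -> -1 < m x <= 1.
Proof.
move=> /andP[x0 x1]; have d : 0 < 1 + b * x by apply: den_gt0; rewrite (ltW x0).
rewrite /m ltr_pdivlMr// ler_pdivrMr//.
by move: b_lt1 => /andP[? ?]; apply/andP; split; nra.
Qed.

Let mD : measurable D. Proof. exact: measurable_itv. Qed.

Let contm (x : R) : -1 <= x <= 1 -> {for x, continuous m}.
Proof.
move=> x1; apply: differentiable_continuous; apply/derivable1_diffP.
by have [] := derivem x1.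
Qed.

Let conth (x : R) : -1 <= x <= 1 -> {for x, continuous h}.
Proof.
move=> /den_gt0 /lt0r_neq0 d0; apply: cvgM; first exact: cvg_cst.
apply: cvgV; first by rewrite expf_neq0.
rewrite /GRing.exp/=; apply: cvgM; apply: cvgD;
  [exact: cvg_cst|apply: cvgMr; exact: cvg_id|exact: cvg_cst|apply: cvgMr; exact: cvg_id].
Qed.

Let sub_cc (x y : R) : -1 <= x -> y <= 1 ->
  forall z, z \in `[x, y] -> -1 <= z <= 1.
Proof.
by move=> x0 y1 z; rewrite in_itv/= => /andP[? ?]; rewrite (le_trans x0)//= (le_trans _ y1).
Qed.

Let mm0 : measurable_fun setT (m \_ D).
Proof.
apply/(measurable_restrictT m mD).
apply: (@measurable_funS _ _ T R (`[-1, 1]%classic : set T)) => //.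
  by apply: subset_itvr; rewrite bnd_simp.
apply: subspace_continuous_measurable_fun => //.
by apply: continuous_in_subspaceT => x /[!inE]/= /itvP xx; apply: contm; rewrite !xx.
Qed.

Let mh0 : measurable_fun setT (h \_ D).
Proof.
apply/(measurable_restrictT h mD).
apply: (@measurable_funS _ _ T R (`[-1, 1]%classic : set T)) => //.
  by apply: subset_itvr; rewrite bnd_simp.
apply: subspace_continuous_measurable_fun => //.
by apply: continuous_in_subspaceT => x /[!inE]/= /itvP xx; apply: conth; rewrite !xx.
Qed.

Let h0_ge0 x : 0 <= (h \_ D) x.
Proof. by rewrite patchE; case: ifP. Qed.

Let dens (A : set T) : \bar R := (\int[mu]_(x in A) ((h \_ D) x)%:E)%E.

Let dens0 : dens set0 = 0%E. Proof. exact: integral_set0. Qed.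

Let dens_ge0 A : (0 <= dens A)%E.
Proof. by apply: integral_ge0 => x _; rewrite lee_fin. Qed.

Let dens_sigma_additive : semi_sigma_additive dens.
Proof.
move=> /= F mF tF mUF; rewrite /dens; apply: cvg_toP.
  apply: ereal_nondecreasing_is_cvgn => p q pq.
  apply: lee_sum_nneg_natr => // k _ _.
  exact: dens_ge0.
rewrite ge0_integral_bigcup//=.
- by apply: measurable_funTS; apply/measurable_EFinP.
- by move=> x _; rewrite lee_fin.
Qed.

HB.instance Definition _ := isMeasure.Build _ _ _ dens dens0 dens_ge0
  dens_sigma_additive.

Let dens_itv (A B : R) : -1 <= A -> A < B -> B <= 1 ->
  dens ((m \_ D) @^-1` `]A, B]%classic) = (B - A)%:E.
Proof.
move=> A1 AB B1.
have Aok : -1 <= A <= 1 by lra.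
have Bok : -1 <= B <= 1 by lra.
have /andP[nA1 nA2] := n_bd Aok; have /andP[nB1 nB2] := n_bd Bok.
have nAB : n A < n B by rewrite -m_lt ?n_bd// !mn.
have nAB' : -1 <= n A <= 1 /\ -1 <= n B <= 1 by rewrite !n_bd.
transitivity (\int[mu]_(x in `]n A, n B]) (h x)%:E)%E.
  rewrite /dens [LHS]integral_mkcond [RHS]integral_mkcond; apply: eq_integral => x _.
  rewrite !patchE.
  have [xD|xD] := boolP (x \in D); last first.
    rewrite !if_same; case: ifPn => // /[!inE]/= xn.
    exfalso; move/negP : xD; apply; rewrite inE /D/= in_itv/=.
    move: xn; rewrite in_itv/= => /andP[xn1 xn2].
    by rewrite (le_lt_trans _ xn1)//= (le_trans xn2).
  congr (if _ then _ else _).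
  have xx : -1 <= x <= 1 by move: xD; rewrite inE /D/= in_itv/= => /andP[/ltW -> ->].
  apply/idP/idP; rewrite !inE /= patchE xD !in_itv/= => /andP[h1 h2].
    by rewrite -m_lt ?mn ?h1 ?n_bd//= leNgt -m_lt ?mn ?n_bd// -leNgt.
  rewrite -[X in X < m x](mn Aok) m_lt ?n_bd// h1/=.
  by rewrite -[X in _ <= X](mn Bok) leNgt m_lt ?n_bd// -leNgt.
have hc : {within `[n A, n B], continuous h}.
  apply: continuous_in_subspaceT => x /[!inE] xx; apply: conth; exact: sub_cc xx.
rewrite integral_itv_obnd_cbnd; last first.
  apply: (@measurable_funS _ _ T (\bar R) (`[n A, n B]%classic : set T)) => //.
    by apply: subset_itvr; rewrite bnd_simp.
  apply/measurable_EFinP; exact: subspace_continuous_measurable_fun.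
rewrite (@continuous_FTC2 _ _ m)//.
- by rewrite !mn// EFinB.
- split.
  + move=> x xx; have [] // := @derivem x.
    by apply: (sub_cc _ _ (subset_itv_oo_cc xx)).
  + by apply: cvg_at_right_filter; apply: contm; case: nAB'.
  + by apply: cvg_at_left_filter; apply: contm; case: nAB'.
- move=> x xx; rewrite derive1E; have xx' : -1 <= x <= 1.
    by apply: (sub_cc _ _ (subset_itv_oo_cc xx)).
  by have [_ ->] := derivem xx'.
Qed.

Let m0D x : D x -> D ((m \_ D) x).
Proof. by move=> xD; rewrite patchE mem_set//; move: xD; rewrite /D/= !in_itv/=; exact: m_bd. Qed.

Let dens_D (A : set T) : measurable A -> dens A = dens (A `&` D).
Proof.
move=> mA; rewrite /dens [LHS]integral_mkcond [RHS]integral_mkcond.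
apply: eq_integral => x _; rewrite !patchE in_setI.
by case: (x \in A); case: (x \in D).
Qed.

Let m0_preimage (A : set T) : measurable A -> measurable ((m \_ D) @^-1` A).
Proof. by move=> mA; rewrite -(setTI (_ @^-1` _)); exact: mm0. Qed.

Let densE (X : set T) : measurable X ->
  dens ((m \_ D) @^-1` X) = dens ((m \_ D) @^-1` (X `&` D)).
Proof.
move=> mX; rewrite dens_D; last exact: m0_preimage.
rewrite [RHS]dens_D; last by apply: m0_preimage; exact: measurableI.
congr dens; apply/seteqP; split => x [] //= xX xD; last by case: xX.
by split => //; split => //; exact: m0D.
Qed.

Let boost_measure (B : set T) : measurable B ->
  mu (B `&` D) = (\int[mu]_(x in (m \_ D) @^-1` B) ((h \_ D) x)%:E)%E.
Proof.
move=> mB.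
(* The image of [dens] lives on [D]. Completed by Lebesgue measure off [D], it becomes a measure on
   the whole line, to which uniqueness of Lebesgue measure applies. *)
pose nu0 := measure_add (pushforward dens (m \_ D)) (mrestr mu (measurableC mD)).
pose nu := nu0 mm0.
have nuE X : nu X = (dens ((m \_ D) @^-1` X) + mu (X `&` ~` D))%E.
  by rewrite /nu /nu0 measure_addE.
have -> : mu (B `&` D)%classic = nu (B `&` D)%classic.
  apply: lebesgue_measure_unique; last exact: measurableI.
  move=> X [[a1 a2] _ <-] /=.
  have mX : measurable (`]a1, a2]%classic : set T) by exact: measurable_itv.
  rewrite [RHS]nuE (measureDI mu mX mD) addeC; congr (_ + _)%E.
  rewrite densE//.
  pose A := Num.max a1 (-1); pose C := Num.min a2 1.
  have -> : `]a1, a2]%classic `&` D = `]A, C]%classic.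
    apply/seteqP; split => x; rewrite /D /A /C /= !in_itv/= gt_max le_min.
      by move=> [/andP[-> ->] /andP[-> ->]].
    by move=> /andP[/andP[-> ->] /andP[-> ->]].
  transitivity (if (A%:E < C%:E)%E then (C%:E - A%:E)%E else 0%E).
    exact: (lebesgue_measure_itv `]A, C]).
  rewrite lte_fin; case: ifPn => AC.
    rewrite -EFinD dens_itv//; first by rewrite /A le_max lexx orbT.
    by rewrite /C ge_min lexx orbT.
  rewrite set_itv_ge ?preimage_set0 ?dens0//.
rewrite nuE (_ : (_ `&` ~` D = set0)%classic); last by apply/seteqP; split => x // [[]].
by rewrite measure0 adde0 -densE.
Qed.

Lemma ge0_integral_boost_line (f : T -> \bar R) :
  measurable_fun setT f -> (forall x, 0 <= f x)%E ->
  (\int[mu]_(x in `](-1)%R, 1%R]) f x =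
   \int[mu]_(x in `](-1)%R, 1%R])
     (f ((x + b) / (1 + b * x))%R * ((1 - b ^+ 2) / (1 + b * x) ^+ 2)%:E))%E.
Proof.
move=> mf f0.
rewrite (ge0_change_of_variable mD mm0 mh0 h0_ge0 boost_measure mf f0).
rewrite [RHS]integral_mkcond; apply: eq_integral => x _.
by rewrite !patchE; case: ifPn => // _; rewrite mule0.
Qed.

End boost_line.

(** * Invariance of hyperbolic area under rotations and boosts *)

Section hyperbolic_area.
Context (R : realType).
Local Notation T := (measurableTypeR R).
Local Notation mu := (@lebesgue_measure R).
Local Notation mu2 := (mu \x mu)%E.
Implicit Types (z : T * T) (A : set (T * T)).

Definition wgt z : R := (Num.sqrt (1 - dotp z z) ^+ 3)^-1.

(** The integral before [fine], so that additivity and invariance can be used before finiteness is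
    known. *)
Definition earea A : \bar R := (\int[mu2]_(z in A) (wgt z)%:E)%E.

Lemma hareaE A : harea A = fine (earea A).
Proof. by []. Qed.

Lemma wgt_ge0 z : 0 <= wgt z.
Proof. by rewrite invr_ge0 exprn_ge0// sqrtr_ge0. Qed.

(** The square root of a nonpositive number and the inverse of 0 are both 0 by convention, so
    integrals over the plane only see [H2]. *)
Lemma wgt_out z : ~ H2 z -> wgt z = 0.
Proof.
rewrite /H2/= => /negP; rewrite -leNgt => z1.
by rewrite /wgt (ler0_sqrtr) ?subr_le0// expr0n invr0.
Qed.

Lemma measurable_dotp : measurable_fun setT (fun z => dotp z z : R).
Proof.
by apply: (@measurable_funD _ _ R); apply: (@measurable_funM _ _ R) => //;
  (exact: measurable_fst || exact: measurable_snd).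
Qed.

Lemma measurable_wgt : measurable_fun setT wgt.
Proof.
apply: (@measurableT_comp _ _ _ _ _ _ (fun x : R => (Num.sqrt x ^+ 3)^-1)
   _ (fun z => 1 - dotp z z)); last first.
  by apply: (@measurable_funB _ _ R) => //; exact: measurable_dotp.
have -> : (fun x : R => (Num.sqrt x ^+ 3)^-1) =
    (fun x => (Num.sqrt x ^+ 3)^-1) \_ `]0, +oo[%classic.
  apply/funext => x; rewrite patchE; case: ifPn => //.
  rewrite notin_setE/= in_itv/= andbT => /negP; rewrite -leNgt => x0.
  by rewrite ler0_sqrtr// expr0n invr0.
have m0 : measurable (`]0, +oo[%classic : set R) by exact: measurable_itv.
apply/(measurable_restrictT (fun x : R => (Num.sqrt x ^+ 3)^-1) m0).
apply: open_continuous_measurable_fun; first exact: rray_open.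
move=> x; rewrite inE/= in_itv/= andbT => x0.
apply: cvgV; first by rewrite expf_neq0// sqrtr_eq0 -ltNge.
rewrite /GRing.exp/=; apply: cvgM; first exact: sqrt_continuous.
by apply: cvgM; exact: sqrt_continuous.
Qed.

Lemma measurable_wgt_restrict A : measurable A ->
  measurable_fun setT ((EFin \o wgt) \_ A).
Proof.
move=> mA; apply/(measurable_restrictT (EFin \o wgt) mA).
by apply: measurable_funTS; apply/measurable_EFinP; exact: measurable_wgt.
Qed.

Lemma wgt_restrict_ge0 A z : (0 <= ((EFin \o wgt) \_ A) z)%E.
Proof. by rewrite patchE; case: ifP => // _; rewrite lee_fin wgt_ge0. Qed.

Lemma eareaE A : earea A = (\int[mu2]_z ((EFin \o wgt) \_ A) z)%E.
Proof. by rewrite /earea integral_mkcond. Qed.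

Lemma eq_earea A A' : (forall z, H2 z -> (A z <-> A' z)) -> earea A = earea A'.
Proof.
move=> AA'; rewrite !eareaE; apply: eq_integral => z _; rewrite !patchE.
have [zH|zH] := pselect (H2 z); last by rewrite /= wgt_out// !if_same.
rewrite (_ : (z \in A) = (z \in A'))//.
by apply/idP/idP; rewrite !inE => /(AA' _ zH).
Qed.

Lemma earea_rot p q A A' : p ^+ 2 + q ^+ 2 = 1 -> measurable A ->
  (forall z, A' z <-> A (rot p q z)) -> earea A' = earea A.
Proof.
move=> pq mA AA'; rewrite !eareaE.
rewrite -(ge0_integral_rot pq (measurable_wgt_restrict mA)); last first.
  exact: wgt_restrict_ge0.
apply: eq_integral => z _; rewrite !patchE /=.
rewrite (_ : (z \in A') = (rot p q z \in A)); last by apply/idP/idP; rewrite !inE => /AA'.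
case: ifP => // _; rewrite /wgt /dotp /rot/=; congr (((Num.sqrt _) ^+ 3)^-1)%:E.
transitivity (1 - (p ^+ 2 + q ^+ 2) * (z.1 * z.1 + z.2 * z.2)); last by ring.
by rewrite pq mul1r.
Qed.

(** The hyperbolic translation along the first axis that takes the origin to (b, 0): a Lorentz boost
    read in the Klein model. *)
Definition boost (b : R) (z : T * T) : T * T :=
  ((z.1 + b) / (1 + b * z.1), Num.sqrt (1 - b ^+ 2) / (1 + b * z.1) * z.2).

Lemma onesub_sqr_gt0 (b : R) : `|b| < 1 -> 0 < 1 - b ^+ 2.
Proof. by move=> b1; rewrite subr_gt0 -real_normK ?num_real// expr_lt1. Qed.

Lemma boost_den_gt0 (b x : R) : `|b| < 1 -> `|x| <= 1 -> 0 < 1 + b * x.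
Proof.
move=> b1 x1; have : `|b * x| < 1.
  by rewrite normrM (le_lt_trans _ b1)// ler_piMr.
by rewrite ltr_norml => /andP[? _]; lra.
Qed.

Lemma H2_fst z : H2 z -> `|z.1| < 1.
Proof.
rewrite /H2/= /dotp => z1; rewrite -(@expr_lt1 _ 2)// real_normK ?num_real//.
by rewrite (le_lt_trans _ z1)// expr2 lerDl -expr2 sqr_ge0.
Qed.

(** [1 - dotp p q] is the Lorentz product of the lifts (1, p) and (1, q). The boost preserves it, up
    to rescaling the images to first coordinate 1. *)
Lemma boost_dotp b p q : `|b| < 1 -> `|p.1| <= 1 -> `|q.1| <= 1 ->
  1 - dotp (boost b p) (boost b q) =
  (1 - b ^+ 2) * (1 - dotp p q) / ((1 + b * p.1) * (1 + b * q.1)).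
Proof.
move=> b1 p1 q1; rewrite /dotp /boost/=.
have /lt0r_neq0 dp := boost_den_gt0 b1 p1; have /lt0r_neq0 dq := boost_den_gt0 b1 q1.
have sE : Num.sqrt (1 - b ^+ 2) * Num.sqrt (1 - b ^+ 2) = 1 - b ^+ 2.
  by rewrite -expr2 sqr_sqrtr// ltW// onesub_sqr_gt0.
set s := Num.sqrt _ in sE *.
transitivity (1 - ((p.1 + b) * (q.1 + b) + (s * s) * (p.2 * q.2)) /
   ((1 + b * p.1) * (1 + b * q.1))); first by field; rewrite dp dq.
by rewrite sE; field; rewrite dp dq.
Qed.

(** The Jacobian matrix of the boost is triangular; the two factors are its diagonal entries, for
    the second and for the first coordinate. *)
Lemma wgt_boost b z : `|b| < 1 -> `|z.1| <= 1 ->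
  wgt (boost b z) * (Num.sqrt (1 - b ^+ 2) / (1 + b * z.1)) *
    ((1 - b ^+ 2) / (1 + b * z.1) ^+ 2) = wgt z.
Proof.
move=> b1 z1; rewrite /wgt boost_dotp//.
have d0 := boost_den_gt0 b1 z1; have bb := onesub_sqr_gt0 b1.
have sE : Num.sqrt (1 - b ^+ 2) ^+ 2 = 1 - b ^+ 2 by rewrite sqr_sqrtr// ltW.
have s0 : 0 < Num.sqrt (1 - b ^+ 2) by rewrite sqrtr_gt0.
have -> : (1 - b ^+ 2) * (1 - dotp z z) / ((1 + b * z.1) * (1 + b * z.1)) =
   (Num.sqrt (1 - b ^+ 2) / (1 + b * z.1)) ^+ 2 * (1 - dotp z z).
  by rewrite exprMn sE exprVn expr2; field; exact: lt0r_neq0.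
rewrite sqrtrM ?sqr_ge0// sqrtr_sqr ger0_norm; last by rewrite ltW// divr_gt0.
rewrite -[X in X / (1 + b * z.1) ^+ 2]sE.
set s := Num.sqrt (1 - b ^+ 2) in s0 *.
have [->|w0] := eqVneq (Num.sqrt (1 - dotp z z)) 0.
  by rewrite mulr0 !expr0n/= invr0 !mul0r.
by field; rewrite w0 (lt0r_neq0 s0) (lt0r_neq0 d0).
Qed.

(** The first coordinate of a boost depends on the first coordinate only. By Tonelli the change of
    variable is a scaling on each vertical line followed by the boost of the diameter. *)
Lemma earea_boost b A A' : `|b| < 1 -> measurable A -> measurable A' ->
  (forall z, H2 z -> (A' z <-> A (boost b z))) -> earea A' = earea A.
Proof.
move=> b1 mA mA' AA'; rewrite !eareaE.
pose f := (EFin \o wgt) \_ A.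
have mf := measurable_wgt_restrict mA; have f0 := wgt_restrict_ge0 A.
pose D := `]-1, 1]%classic : set T.
have slice (F : T * T -> \bar R) x : ~ D x -> (forall z, ~ H2 z -> F z = 0%E) ->
    (\int[mu]_y F (x, y) = 0)%E.
  move=> xD F0; rewrite integral0_eq// => y _; apply: F0 => /H2_fst /=.
  by rewrite ltr_norml => /andP[x1 x2]; apply: xD; rewrite /D/= in_itv/= x1 ltW.
have out B z : ~ H2 z -> ((EFin \o wgt) \_ B) z = 0%E.
  by move=> zH; rewrite patchE /= wgt_out// if_same.
have toD (B : set (T * T)) : measurable B ->
    (\int[mu2]_z ((EFin \o wgt) \_ B) z =
     \int[mu]_(x in D) \int[mu]_y ((EFin \o wgt) \_ B) (x, y))%E.
  move=> mB; rewrite fubini_tonelli1; last 2 first.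
  - exact: measurable_wgt_restrict.
  - exact: wgt_restrict_ge0.
  rewrite [RHS]integral_mkcond; apply: eq_integral => x _; rewrite patchE.
  case: ifPn => //; rewrite notin_setE => xD; apply: slice => // z; exact: out.
rewrite !toD// [RHS](ge0_integral_boost_line b1); last 2 first.
- exact: (measurable_fun_fubini_tonelli_F f mf f0).
- by move=> x; apply: integral_ge0 => y _; exact: f0.
apply: eq_integral => x; rewrite inE /D/= in_itv/= => /andP[x0 x1].
have xn : `|x| <= 1 by rewrite ler_norml (ltW x0).
have d0 := boost_den_gt0 b1 xn.
have k0 : 0 < Num.sqrt (1 - b ^+ 2) / (1 + b * x).
  by rewrite divr_gt0// sqrtr_gt0 onesub_sqr_gt0.
have mfx : measurable_fun setT (fun y : T => f ((x + b) / (1 + b * x), y)).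
  exact: measurable_fun_pair2.
rewrite (@ge0_integral_affine _ _ 0 _ k0 mfx)// -ge0_integralZr//; last 3 first.
- apply: emeasurable_funM => //; apply: (measurableT_comp mfx).
  by apply: (@measurable_funD _ _ R) => //; apply: (@measurable_funM _ _ R).
- by move=> y _; rewrite mule_ge0// lee_fin ltW.
- by rewrite lee_fin divr_ge0 ?sqr_ge0// ltW// onesub_sqr_gt0.
apply: eq_integral => y _; rewrite addr0 /f !patchE.
have [zH|zH] := pselect (H2 (x, y)); last first.
  rewrite /= (wgt_out zH) if_same; case: ifP => _; last by rewrite !mul0e.
  have := @wgt_boost b (x, y) b1 xn; rewrite (wgt_out zH) => h.
  by rewrite -!EFinM; congr EFin; rewrite -[LHS]h.
rewrite (_ : ((x, y) \in A') = (boost b (x, y) \in A)); last first.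
  by apply/idP/idP; rewrite !inE => /(AA' _ zH).
rewrite {1}/boost/=; case: ifP => _; last by rewrite !mul0e.
by rewrite -!EFinM; congr EFin; rewrite -(@wgt_boost b (x, y) b1 xn).
Qed.

End hyperbolic_area.

Section derivative_rules.
Context (R : realType).
Implicit Types (f g : R -> R) (x a b c : R).

Lemma derive_comp f g x a b c : is_derive x 1 g b -> is_derive (g x) 1 f a ->
  a * b = c -> is_derive x 1 (fun y => f (g y)) c.
Proof. by move=> dg df <-; exact: (is_derive1_comp df dg). Qed.

Lemma derive_mul f g x a b c : is_derive x 1 f a -> is_derive x 1 g b ->
  f x * b + g x * a = c -> is_derive x 1 (fun y => f y * g y) c.
Proof. by move=> df dg <-; exact: (is_deriveM df dg). Qed.

Lemma derive_inv f x a c : is_derive x 1 f a -> f x != 0 ->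
  - (a / f x ^+ 2) = c -> is_derive x 1 (fun y => (f y)^-1) c.
Proof.
move=> df f0 <-; have := is_deriveV f0 df.
by rewrite /GRing.scale/= mulNr mulrC.
Qed.

Lemma is_derive_continuous f x a : is_derive x 1 f a -> {for x, continuous f}.
Proof.
by move=> [df _]; apply: differentiable_continuous; apply/derivable1_diffP.
Qed.

End derivative_rules.

(** * Arcsine extended to the line *)

Section clamped_arcsine.
Context (R : realType).
Implicit Types x y a : R.

(* Clamping the argument to [-1, 1] makes the arcsine continuous and
   nondecreasing on the whole line. *)
Definition clamp x : R := Num.max (-1) (Num.min x 1).

Definition asc x : R := asin (clamp x).

Lemma clamp_bound x : -1 <= clamp x <= 1.
Proof. by rewrite /clamp le_max lexx/= ge_max ge_min lexx orbT andbT; lra. Qed.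

Lemma clamp_id x : -1 <= x <= 1 -> clamp x = x.
Proof. by move=> /andP[x0 x1]; rewrite /clamp min_l// max_r. Qed.

Lemma clamp_le x y : x <= y -> clamp x <= clamp y.
Proof. by move=> xy; rewrite /clamp ge_max !le_max lexx/= le_min !ge_min xy lexx !orbT. Qed.

Lemma continuous_clamp : continuous clamp.
Proof.
move=> x; apply: (@continuous_max _ _ (fun=> -1) (fun y => Num.min y 1)).
  exact: cvg_cst.
by apply: (@continuous_min _ _ id (fun=> 1)); [exact: cvg_id|exact: cvg_cst].
Qed.

Lemma asc_asin x : -1 <= x <= 1 -> asc x = asin x.
Proof. by move=> x1; rewrite /asc clamp_id. Qed.

Lemma asc_bound x : - (pi / 2) <= asc x <= pi / 2.
Proof. by have [] := asin_def (clamp_bound x). Qed.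

Lemma sin_asc x : -1 <= x <= 1 -> sin (asc x) = x.
Proof. by move=> x1; rewrite asc_asin//; have [] := asin_def x1. Qed.

Lemma ascK a : - (pi / 2) <= a <= pi / 2 -> asc (sin a) = a.
Proof. by move=> a1; rewrite asc_asin ?sinK ?in_itv// sin_geN1 sin_le1. Qed.

Lemma asc_lt x y : -1 <= x <= 1 -> -1 <= y <= 1 -> (asc x < asc y) = (x < y).
Proof.
move=> x1 y1; rewrite -ltr_sin ?in_itv ?asc_bound//.
by rewrite !sin_asc.
Qed.

Lemma asc_le x y : x <= y -> asc x <= asc y.
Proof.
move=> /clamp_le xy; rewrite /asc -!asc_asin ?clamp_bound//.
by rewrite leNgt asc_lt ?clamp_bound// -leNgt.
Qed.

Lemma asc0 : asc 0 = 0.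
Proof. by rewrite -[X in asc X]sin0 ascK// oppr_le0 divr_ge0 ?pi_ge0. Qed.

Lemma asc1 : asc 1 = pi / 2.
Proof.
have p : (0 : R) <= pi / 2 by rewrite divr_ge0 ?pi_ge0.
by rewrite -[X in asc X](@sin_pihalf R) ascK// lexx andbT; lra.
Qed.

Lemma ascN x : asc (- x) = - asc x.
Proof.
have -> : asc (- x) = asc (- clamp x).
  rewrite /asc; congr asin; rewrite [RHS]clamp_id; last first.
    by have /andP[? ?] := clamp_bound x; apply/andP; split; lra.
  rewrite /clamp; case: (leP x 1) => x1; case: (leP (- x) 1) => x2.
  - by rewrite (max_r (y := x)) ?(max_r (y := - x)); lra.
  - by rewrite max_r ?(max_l (y := x)); lra.
  - by rewrite (max_l (y := - x)) ?max_r; lra.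
  - by lra.
rewrite -[X in asc (- X)]sin_asc ?clamp_bound//.
rewrite -sinN ascK; first by rewrite /asc clamp_id ?clamp_bound.
by have := asc_bound (clamp x); lra.
Qed.

Lemma cos_asc x : -1 <= x <= 1 -> cos (asc x) = Num.sqrt (1 - x ^+ 2).
Proof. by move=> x1; rewrite asc_asin// cos_asin. Qed.

(** An increasing map of a segment onto a segment is continuous. *)
Lemma asin_within_continuous : {within `[-1, 1], continuous (@asin R)}.
Proof.
apply: segment_inc_surj_continuous.
  move=> x y; rewrite !in_itv/= => x1 y1; rewrite -!asc_asin//.
  by rewrite !leNgt asc_lt.
rewrite -!asc_asin ?lexx ?lerN10//=; try lra.
rewrite ascN asc1 => a /=; rewrite in_itv/= => a1; exists (sin a) => /=.
  by rewrite in_itv/= sin_geN1 sin_le1.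
by rewrite sinK.
Qed.

Lemma continuous_asc : continuous asc.
Proof.
move=> x; have /subspace_continuousP := asin_within_continuous.
move=> /(_ (clamp x)); rewrite /= in_itv/= => /(_ (clamp_bound x)) h.
apply: (@cvg_comp _ _ _ clamp (@asin R) (nbhs x) (within `[-1, 1]%classic (nbhs (clamp x)))) => //.
move=> A /= [e /= e0 eA].
have := @continuous_clamp x; move=> /cvgrPdist_lt /(_ e e0); apply: filterS => y ye.
apply: eA => //; rewrite /= in_itv/=; exact: clamp_bound.
Qed.

Lemma is_derive_asc x : -1 < x < 1 -> is_derive x 1 asc (Num.sqrt (1 - x ^+ 2))^-1.
Proof.
move=> x1; have xo : x \in `]-1, 1[ by rewrite in_itv.
have e : \forall y \near x, asin y = asc y.
  near=> y; rewrite asc_asin//.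
  have : y \in `]-1, 1[ by near: y; exact: near_in_itvoo.
  by rewrite in_itv/= => /andP[/ltW -> /ltW ->].
by apply: (near_eq_is_derive e); exact: is_derive1_asin.
Unshelve. all: by end_near. Qed.

End clamped_arcsine.

(** * Area of a circular cap *)

Section cap_area.
Context (R : realType).
Local Notation T := (measurableTypeR R).
Local Notation mu := (@lebesgue_measure R).
Variable (rho : R).
Hypothesis rho01 : 0 < rho < 1.

Let rho0 : 0 < rho. Proof. by case/andP: rho01. Qed.

Let rho1 : 0 < 1 - rho ^+ 2.
Proof. by case/andP: rho01 => ? ?; nra. Qed.

Let s := Num.sqrt (1 - rho ^+ 2).

Let s0 : 0 < s. Proof. by rewrite sqrtr_gt0. Qed.

Let sE : s ^+ 2 = 1 - rho ^+ 2. Proof. by rewrite sqr_sqrtr// ltW. Qed.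

(** Sector minus triangle: with rho = tanh r and h = rho cos a, this is 2 (a cosh r - (pi/2 -
    beta)), where beta is the base angle of the isosceles triangle over the chord. *)
Definition cap_value (h : R) : R :=
  2 * ((Num.sqrt (1 - rho ^+ 2))^-1 * (pi / 2 - asc (h / rho)) - 
  (pi / 2 - asc (h * Num.sqrt (1 - rho ^+ 2) / (rho * Num.sqrt (1 - h ^+ 2))))).

Let wE (x y : R) : wgt (x, y) = (Num.sqrt (1 - x ^+ 2 - y ^+ 2) ^+ 3)^-1.
Proof. by rewrite /wgt /dotp /= -!expr2 opprD addrA. Qed.

Let is_derive_sqrt_sub (a y : R) : 0 < a - y ^+ 2 ->
  is_derive y 1 (fun y : R => Num.sqrt (a - y ^+ 2)) (- (y / Num.sqrt (a - y ^+ 2))).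
Proof.
move=> ay; have ds := is_derive1_sqrt ay.
have dg : is_derive y 1 (fun y : R => a - y ^+ 2) (- (2 * y)).
  by apply: is_derive_eq; rewrite /GRing.scale/=; ring.
apply: (derive_comp dg ds).
by field; rewrite lt0r_neq0// sqrtr_gt0.
Qed.

Let slice (x Y : R) : 0 <= Y -> 0 < 1 - x ^+ 2 - Y ^+ 2 ->
  (\int[mu]_(y in `[(- Y)%R, Y]) (wgt (x, y))%:E)%E =
  (2 * Y / ((1 - x ^+ 2) * Num.sqrt (1 - x ^+ 2 - Y ^+ 2)))%:E.
Proof.
rewrite le_eqVlt => /predU1P[<- _|Y0 xY].
  by rewrite oppr0 set_itv1 integral_set1 mulr0 mul0r.
have pos y : - Y <= y <= Y -> 0 < 1 - x ^+ 2 - y ^+ 2 by move=> /andP[? ?]; nra.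
pose F (y : R) := y / ((1 - x ^+ 2) * Num.sqrt (1 - x ^+ 2 - y ^+ 2)).
have x0 : 0 < 1 - x ^+ 2 by have := pos 0; rewrite expr0n/= subr0; apply; lra.
have dF y : - Y <= y <= Y -> is_derive y 1 F (wgt (x, y)).
  move=> /pos xy; have d1 := is_derive_sqrt_sub xy.
  have q0 : Num.sqrt (1 - x ^+ 2 - y ^+ 2) != 0 by rewrite lt0r_neq0// sqrtr_gt0.
  have d2 : is_derive y 1 (fun y : R => (1 - x ^+ 2) * Num.sqrt (1 - x ^+ 2 - y ^+ 2))
      (- ((1 - x ^+ 2) * y / Num.sqrt (1 - x ^+ 2 - y ^+ 2))).
    by apply: is_derive_eq; rewrite /GRing.scale/=; ring.
  have d3 := derive_inv d2 (mulf_neq0 (lt0r_neq0 x0) q0) erefl.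
  apply: (derive_mul (is_derive_id y 1) d3); rewrite wE.
  have qE : Num.sqrt (1 - x ^+ 2 - y ^+ 2) ^+ 2 = 1 - x ^+ 2 - y ^+ 2 by rewrite sqr_sqrtr// ltW.
  set q := Num.sqrt _ in q0 qE *.
  have -> : 1 - x ^+ 2 = q ^+ 2 + y ^+ 2 by rewrite qE; ring.
  field; rewrite q0/=; rewrite qE; apply: lt0r_neq0; lra.
have dFo y : y \in `]- Y, Y[ -> is_derive y 1 F (wgt (x, y)).
  by rewrite in_itv/= => /andP[/ltW ? /ltW ?]; apply: dF; apply/andP.
have cF y : - Y <= y <= Y -> {for y, continuous F}.
  by move=> /dF; exact: is_derive_continuous.
have cw : {within `[- Y, Y], continuous (fun y => wgt (x, y))}.
  apply: continuous_in_subspaceT => y; rewrite inE/= in_itv/= => /pos xy.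
  under eq_fun do rewrite wE.
  have cs : {for y, continuous (fun y : R => Num.sqrt (1 - x ^+ 2 - y ^+ 2))}.
    exact: is_derive_continuous (is_derive_sqrt_sub xy).
  apply: cvgV; first by rewrite expf_neq0// lt0r_neq0// sqrtr_gt0.
  by rewrite /GRing.exp/=; apply: cvgM => //; apply: cvgM.
rewrite (@continuous_FTC2 _ _ F)//.
- by rewrite -EFinD /F sqrrN; congr EFin; rewrite mulNr opprK -mulrDl -mulr2n mulr_natl.
- lra.
- split.
  + by move=> y /dFo [].
  + by apply: cvg_at_right_filter; apply: cF; lra.
  + by apply: cvg_at_left_filter; apply: cF; lra.
- by move=> y /dFo [_ <-]; rewrite derive1E.
Qed.

(** [g x] below is the weight integrated over the vertical chord at x, and [G] is its
    antiderivative. *)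
Let G (x : R) : R := 2 * (s^-1 * asc (x / rho) - asc (x * s / (rho * Num.sqrt (1 - x ^+ 2)))).

Let g (x : R) : R := 2 * Num.sqrt (rho ^+ 2 - x ^+ 2) / ((1 - x ^+ 2) * s).

Let x_sq (x : R) : - rho <= x <= rho -> x ^+ 2 <= rho ^+ 2.
Proof. by move=> /andP[? ?]; nra. Qed.

Let is_derive_G (x : R) : - rho < x < rho -> is_derive x 1 G (g x).
Proof.
move=> xr; have x2 : 0 < rho ^+ 2 - x ^+ 2 by move: xr => /andP[? ?]; nra.
have x1 : 0 < 1 - x ^+ 2 by have := rho1; lra.
have q0 : Num.sqrt (1 - x ^+ 2) != 0 by rewrite lt0r_neq0// sqrtr_gt0.
have p0 : Num.sqrt (rho ^+ 2 - x ^+ 2) != 0 by rewrite lt0r_neq0// sqrtr_gt0.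
have qE : Num.sqrt (1 - x ^+ 2) ^+ 2 = 1 - x ^+ 2 by rewrite sqr_sqrtr// ltW.
have pE : Num.sqrt (rho ^+ 2 - x ^+ 2) ^+ 2 = rho ^+ 2 - x ^+ 2 by rewrite sqr_sqrtr// ltW.
have dq := is_derive_sqrt_sub x1.
have r0 := lt0r_neq0 rho0; have ss0 := lt0r_neq0 s0.
have da : is_derive x 1 (fun x : R => asc (x / rho)) ((Num.sqrt (rho ^+ 2 - x ^+ 2))^-1).
  have xr1 : -1 < x / rho < 1 by rewrite ltr_pdivrMr// ltr_pdivlMr//; lra.
  have d1 : is_derive x 1 (fun x : R => x / rho) (rho^-1).
    by apply: is_derive_eq; rewrite /GRing.scale/=; ring.
  apply: (derive_comp d1 (is_derive_asc xr1)).
  have -> : 1 - (x / rho) ^+ 2 = (rho ^+ 2 - x ^+ 2) * (rho^-1) ^+ 2 by field.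
  rewrite sqrtrM ?(ltW x2)// sqrtr_sqr ger0_norm ?invr_ge0 ?(ltW rho0)//.
  by field; rewrite r0 p0.
have dw : is_derive x 1 (fun x : R => asc (x * s / (rho * Num.sqrt (1 - x ^+ 2))))
    (s / ((1 - x ^+ 2) * Num.sqrt (rho ^+ 2 - x ^+ 2))).
  have d2 : is_derive x 1 (fun x : R => rho * Num.sqrt (1 - x ^+ 2))
      (- (rho * x / Num.sqrt (1 - x ^+ 2))).
    by apply: is_derive_eq; rewrite /GRing.scale/=; ring.
  have d3 := derive_inv d2 (mulf_neq0 r0 q0) erefl.
  have d4 : is_derive x 1 (fun x : R => x * s) s.
    by apply: is_derive_eq; rewrite /GRing.scale/=; ring.
  have d5 := derive_mul d4 d3 erefl.
  have wE2 : 1 - (x * s / (rho * Num.sqrt (1 - x ^+ 2))) ^+ 2 =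
      (rho ^+ 2 - x ^+ 2) * ((rho * Num.sqrt (1 - x ^+ 2))^-1) ^+ 2.
    rewrite !exprMn !exprVn !exprMn sE qE; field; rewrite r0/= lt0r_neq0//.
  have w2 : 0 < 1 - (x * s / (rho * Num.sqrt (1 - x ^+ 2))) ^+ 2.
    by rewrite wE2 mulr_gt0// exprn_gt0// invr_gt0 mulr_gt0// sqrtr_gt0.
  have w1 : -1 < x * s / (rho * Num.sqrt (1 - x ^+ 2)) < 1.
    by move: w2; set w := _ / _ => w2; apply/andP; split; nra.
  apply: (derive_comp d5 (is_derive_asc w1)).
  rewrite wE2 sqrtrM ?(ltW x2)// sqrtr_sqr ger0_norm; last first.
    by rewrite invr_ge0 mulr_ge0 ?(ltW rho0)// sqrtr_ge0.
  set q := Num.sqrt (1 - x ^+ 2) in q0 qE *; set p := Num.sqrt (rho ^+ 2 - _) in p0 pE *.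
  rewrite -[X in _ = s / (X * p)]qE.
  transitivity (s * (q ^+ 2 + x ^+ 2) / (q ^+ 2 * p)); first by field; rewrite r0 q0 p0.
  by rewrite qE subrK mulr1.
have dG : is_derive x 1 G (2 * (s^-1 * (Num.sqrt (rho ^+ 2 - x ^+ 2))^-1 -
    s / ((1 - x ^+ 2) * Num.sqrt (rho ^+ 2 - x ^+ 2)))).
  by apply: is_derive_eq; rewrite /GRing.scale/=; ring.
apply: (is_derive_eq dG); rewrite /g.
set p := Num.sqrt (rho ^+ 2 - _) in p0 pE *.
transitivity (- (2 * ((s ^+ 2 - (1 - x ^+ 2)) / (s * (1 - x ^+ 2) * p)))).
  by field; rewrite ss0 p0 lt0r_neq0.
rewrite (_ : s ^+ 2 - _ = - p ^+ 2); last by rewrite sE pE; ring.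
by field; rewrite ss0 p0 lt0r_neq0.
Qed.

Let sub1 (x : R) : - rho <= x <= rho -> 0 < 1 - x ^+ 2.
Proof. by move=> /x_sq; have := rho1; lra. Qed.

Let G_cont (x : R) : - rho <= x <= rho -> {for x, continuous G}.
Proof.
move=> xr; have x1 := sub1 xr.
have q0 : rho * Num.sqrt (1 - x ^+ 2) != 0.
  by rewrite lt0r_neq0// mulr_gt0// sqrtr_gt0.
have c1 : {for x, continuous (fun x : R => asc (x / rho))}.
  apply: (@continuous_comp _ _ _ (fun x : R => x / rho) (@asc R)); last exact: continuous_asc.
  by apply: cvgMl; exact: cvg_id.
have c2 : {for x, continuous (fun x : R => asc (x * s / (rho * Num.sqrt (1 - x ^+ 2))))}.
  apply: (@continuous_comp _ _ _ (fun x : R => x * s / (rho * Num.sqrt (1 - x ^+ 2))) (@asc R));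
    last exact: continuous_asc.
  apply: cvgM; first by apply: cvgMl; exact: cvg_id.
  apply: cvgV => //; apply: cvgMr.
  exact: is_derive_continuous (is_derive_sqrt_sub x1).
by apply: cvgMr; apply: cvgB => //; apply: cvgMr.
Qed.

Let g_cont (x : R) : - rho <= x <= rho -> {for x, continuous g}.
Proof.
move=> xr; have x1 := sub1 xr.
apply: cvgM.
  apply: cvgMr.
  apply: (@continuous_comp _ _ _ (fun x : R => rho ^+ 2 - x ^+ 2) (@Num.sqrt R)); last exact: sqrt_continuous.
  by apply: cvgB; [exact: cvg_cst|rewrite /GRing.exp/=; apply: cvgM; exact: cvg_id].
apply: cvgV; first by rewrite mulf_neq0 ?lt0r_neq0.
apply: cvgMl; apply: cvgB; first exact: cvg_cst.
by rewrite /GRing.exp/=; apply: cvgM; exact: cvg_id.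
Qed.

(** [b] decides whether the chord belongs to the cap: [true] includes it and yields the whole disk
    for h = - rho, [false] gives the complement of a closed half-plane. *)
Definition cap (b : bool) (h : R) : set (T * T) :=
  [set z | z.1 \in Interval (BSide b h) (BRight rho) /\ dotp z z <= rho ^+ 2].

Lemma measurable_disk (r : R) : measurable [set z : T * T | dotp z z <= r].
Proof.
rewrite (_ : [set z | _] = (fun z : T * T => dotp z z) @^-1` `]-oo, r]).
  by rewrite -[X in measurable X]setTI; apply: measurable_dotp.
by apply/seteqP; split => z /=; rewrite in_itv.
Qed.

Lemma measurable_cap b h : measurable (cap b h).
Proof.
apply: measurableI; last exact: measurable_disk.
rewrite -[X in measurable X]setTI.
exact: (@measurable_fst _ _ T T measurableT [set` Interval (BSide b h) (BRight rho)]).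
Qed.

Lemma earea_cap b h : - rho <= h -> h < rho -> earea (cap b h) = (cap_value h)%:E.
Proof.
move=> h0 h1; rewrite eareaE fubini_tonelli1; last 2 first.
- exact: measurable_wgt_restrict (measurable_cap b h).
- exact: wgt_restrict_ge0.
transitivity (\int[mu]_(x in [set` Interval (BSide b h) (BRight rho)]) (g x)%:E)%E.
  rewrite [RHS]integral_mkcond; apply: eq_integral => x _.
  rewrite /fubini_F patchE; case: ifPn => xI; last first.
    rewrite integral0_eq// => y _; rewrite patchE ifF//; apply/negbTE.
    apply: contra xI; rewrite !inE => -[+ _] /=; exact.
  move: xI; rewrite inE/= => xI.
  have xr : - rho <= x <= rho.
    move: xI; rewrite in_itv/= => /andP[hx ->]; rewrite andbT.
    by rewrite (le_trans h0)//; case: b hx => //= /ltW.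
  have x1 := sub1 xr; have x2 := x_sq xr.
  pose Y := Num.sqrt (rho ^+ 2 - x ^+ 2).
  have Y2 : Y ^+ 2 = rho ^+ 2 - x ^+ 2 by rewrite sqr_sqrtr// subr_ge0.
  have Y0 : 0 <= Y by exact: sqrtr_ge0.
  transitivity (\int[mu]_(y in `[(- Y)%R, Y]) (wgt (x, y))%:E)%E.
    rewrite [RHS]integral_mkcond; apply: eq_integral => y _; rewrite !patchE.
    congr (if _ then _ else _); apply/idP/idP; rewrite !inE /cap /dotp /=.
      move=> [_ yy]; have {}yy : y ^+ 2 <= Y ^+ 2 by rewrite Y2 !expr2; lra.
      by rewrite in_itv/=; apply/andP; split; rewrite leNgt; apply/negP => ?; nra.
    rewrite in_itv/= => /andP[y1 y2]; have yy : y ^+ 2 <= Y ^+ 2 by nra.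
    by split => //; move: yy; rewrite Y2 !expr2; lra.
  rewrite slice//; last by rewrite Y2; have := rho1; lra.
  rewrite Y2 (_ : 1 - x ^+ 2 - _ = 1 - rho ^+ 2)//; ring.
have gc : {within `[h, rho], continuous g}.
  apply: continuous_in_subspaceT => x; rewrite inE/= in_itv/= => /andP[hx xr].
  by apply: g_cont; rewrite xr (le_trans h0).
have mg : measurable_fun `[h, rho] (EFin \o g).
  by apply/measurable_EFinP; exact: subspace_continuous_measurable_fun.
have -> : (\int[mu]_(x in [set` Interval (BSide b h) (BRight rho)]) (g x)%:E =
    \int[mu]_(x in `[h, rho]) (g x)%:E)%E.
  case: b => //; rewrite integral_itv_obnd_cbnd//.
  by apply: measurable_funS mg => //; apply: subset_itvr; rewrite bnd_simp.
have hr x : x \in `]h, rho[ -> - rho < x < rho.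
  by rewrite in_itv/= => /andP[hx ->]; rewrite (le_lt_trans h0).
rewrite (@continuous_FTC2 _ _ G)//.
- rewrite -EFinD /G /cap_value; congr EFin.
  rewrite divff ?lt0r_neq0// -/s (mulrC rho) divff; last by rewrite mulf_neq0 ?lt0r_neq0.
  by rewrite asc1; ring.
- split.
  + by move=> x /hr /is_derive_G [].
  + by apply: cvg_at_right_filter; apply: G_cont; rewrite h0 ltW.
  + by apply: cvg_at_left_filter; apply: G_cont; rewrite lexx andbT; have := rho0; lra.
- by move=> x /hr /is_derive_G [_ <-]; rewrite derive1E.
Qed.

End cap_area.

(** * Hyperbolic functions and their inverses *)

Section hyperbolic_functions.
Context (R : realType).
Implicit Types x y : R.

Definition ch x : R := (expR x + expR (- x)) / 2.
Definition sh x : R := (expR x - expR (- x)) / 2.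
Definition arsh x : R := ln (x + Num.sqrt (1 + x ^+ 2)).

Lemma ch2_sh2 x : ch x ^+ 2 = 1 + sh x ^+ 2.
Proof.
have e : expR x * expR (- x) = 1 by rewrite -expRD subrr expR0.
transitivity (expR x * expR (- x) + sh x ^+ 2); last by rewrite e.
by rewrite /ch /sh; field.
Qed.

Lemma ch_half x : ch x = 1 + 2 * sh (x / 2) ^+ 2.
Proof.
have e : expR (x / 2) * expR (- (x / 2)) = 1 by rewrite -expRD subrr expR0.
transitivity (expR (x / 2) * expR (- (x / 2)) + 2 * sh (x / 2) ^+ 2); last by rewrite e.
rewrite /ch /sh (_ : expR x = expR (x / 2) ^+ 2); last first.
  by rewrite expr2 -expRD; congr expR; field.
rewrite (_ : expR (- x) = expR (- (x / 2)) ^+ 2); last first.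
  by rewrite expr2 -expRD; congr expR; field.
by field.
Qed.

Lemma ch_gt0 x : 0 < ch x.
Proof. by rewrite /ch divr_gt0// addr_gt0// expR_gt0. Qed.

Lemma sh_lt x y : (sh x < sh y) = (x < y).
Proof.
have H a b : a < b -> sh a < sh b.
  move=> ab; rewrite /sh ltr_pM2r ?invr_gt0//.
  by have := ltr_expR a b; have := ltr_expR (- b) (- a); rewrite ltrN2 ab; lra.
case: (ltgtP x y) => [/H //|/H|->]; last by rewrite ltxx.
by move=> ?; apply/negbTE; rewrite -leNgt ltW.
Qed.

Lemma sh_le x y : (sh x <= sh y) = (x <= y).
Proof. by rewrite !leNgt sh_lt. Qed.

Lemma sh_inj : injective sh.
Proof. by move=> x y e; apply/eqP; rewrite eq_le -(sh_le x) -(sh_le y) e lexx. Qed.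

Lemma sh0 : sh 0 = 0.
Proof. by rewrite /sh oppr0 subrr mul0r. Qed.

Lemma sh_gt0 x : (0 < sh x) = (0 < x).
Proof. by rewrite -[X in X < _]sh0 sh_lt. Qed.

Lemma chE x : ch x = Num.sqrt (1 + sh x ^+ 2).
Proof. by rewrite -ch2_sh2 sqrtr_sqr ger0_norm// ltW// ch_gt0. Qed.

Let arg_gt0 x : 0 < x + Num.sqrt (1 + x ^+ 2).
Proof.
have [x0|x0] := lerP 0 x; first by rewrite ltr_wpDl// sqrtr_gt0; nra.
have q : Num.sqrt (1 + x ^+ 2) ^+ 2 = 1 + x ^+ 2 by rewrite sqr_sqrtr//; nra.
have q0 := sqrtr_ge0 (1 + x ^+ 2); set s := Num.sqrt _ in q q0 *.
by rewrite ltNge; apply/negP => ?; nra.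
Qed.

Lemma arshK : cancel arsh sh.
Proof.
move=> x; rewrite /sh /arsh expRN lnK ?posrE//.
have q : Num.sqrt (1 + x ^+ 2) ^+ 2 = 1 + x ^+ 2 by rewrite sqr_sqrtr//; nra.
have := lt0r_neq0 (arg_gt0 x); set s := Num.sqrt _ in q * => n0.
transitivity ((x ^+ 2 + 2 * x * s + s ^+ 2 - 1) / (2 * (x + s))); first by field.
by rewrite q; field.
Qed.

Lemma shK : cancel sh arsh.
Proof. by move=> x; apply: sh_inj; rewrite arshK. Qed.

Lemma continuous_arsh : continuous arsh.
Proof.
move=> x; apply: (@continuous_comp _ _ _ (fun x => x + Num.sqrt (1 + x ^+ 2)) (@ln R)).
  apply: cvgD; first exact: cvg_id.
  apply: (@continuous_comp _ _ _ (fun x : R => 1 + x ^+ 2) (@Num.sqrt R)); last exact: sqrt_continuous.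
  by apply: cvgD; [exact: cvg_cst|rewrite /GRing.exp/=; apply: cvgM; exact: cvg_id].
exact: continuous_ln.
Qed.

Lemma arcoshK x : 1 <= x -> ch (arcosh x) = x.
Proof.
move=> x1; rewrite /ch /arcosh.
have q : Num.sqrt (x ^+ 2 - 1) ^+ 2 = x ^+ 2 - 1 by rewrite sqr_sqrtr//; nra.
have a0 : 0 < x + Num.sqrt (x ^+ 2 - 1) by rewrite ltr_wpDr ?sqrtr_ge0//; lra.
rewrite expRN lnK ?posrE//; have n0 := lt0r_neq0 a0.
set s := Num.sqrt _ in q n0 *.
transitivity ((x ^+ 2 + 2 * x * s + s ^+ 2 + 1) / (2 * (x + s))); first by field.
by rewrite q; field.
Qed.

Lemma chK x : 0 <= x -> arcosh (ch x) = x.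
Proof.
move=> x0; rewrite /arcosh ch2_sh2 [1 + _]addrC addrK sqrtr_sqr ger0_norm.
  have -> : ch x + sh x = expR x by rewrite /ch /sh; field.
  exact: expRK.
by rewrite -sh0 sh_le.
Qed.

Lemma arcosh_ge0 x : 1 <= x -> 0 <= arcosh x.
Proof.
move=> x1; rewrite /arcosh ln_ge0// (le_trans x1)// lerDl sqrtr_ge0 //.
Qed.

End hyperbolic_functions.

(** * Polygons inscribed in a circle *)

Section inscribed_polygons.
Context (R : realType).
Implicit Types (p q : R * R) (t x y : R).

Definition pt (rho t : R) : R * R := (rho * cos t, rho * sin t).

Lemma dotp_pt rho x y : dotp (pt rho x) (pt rho y) = rho ^+ 2 * cos (x - y).
Proof. by rewrite /dotp /= cosB; ring. Qed.

Lemma dotp_ptxx rho x : dotp (pt rho x) (pt rho x) = rho ^+ 2.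
Proof. by rewrite dotp_pt subrr cos0 mulr1. Qed.

Lemma leftof_pt rho x y (z : R) : leftof (pt rho x) (pt rho y) (pt rho z) =
  4 * rho ^+ 2 * (sin ((y - x) / 2) * sin ((z - y) / 2) * sin ((z - x) / 2)).
Proof.
pose u := (y - x) / 2; pose w := (z - x) / 2.
have -> : (z - y) / 2 = (x + w) - (x + u) by rewrite /u /w; field.
rewrite -/u -/w /leftof /=.
have yE : y = (x + u) + u by rewrite /u; field.
have zE : z = (x + w) + w by rewrite /w; field.
have xuE : x = (x + u) - u by ring.
have xwE : x = (x + w) - w by ring.
have e1 : rho * cos y - rho * cos x = - (2 * rho * (sin (x + u) * sin u)).
  by rewrite [in cos y]yE [in cos x]xuE cosD cosB; ring.
have e2 : rho * sin z - rho * sin x = 2 * rho * (cos (x + w) * sin w).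
  by rewrite [in sin z]zE [in sin x]xwE sinD sinB; ring.
have e3 : rho * sin y - rho * sin x = 2 * rho * (cos (x + u) * sin u).
  by rewrite [in sin y]yE [in sin x]xuE sinD sinB; ring.
have e4 : rho * cos z - rho * cos x = - (2 * rho * (sin (x + w) * sin w)).
  by rewrite [in cos z]zE [in cos x]xwE cosD cosB; ring.
by rewrite e1 e2 e3 e4 sinB; ring.
Qed.

(* The half-plane of a chord, in terms of the direction [x + a] of its
   midpoint. *)
Lemma leftof_chord rho x a (z : R * R) : leftof (pt rho x) (pt rho (x + 2 * a)) z =
  2 * rho * sin a * (rho * cos a - (cos (x + a) * z.1 + sin (x + a) * z.2)).
Proof.
rewrite /leftof /=.
have yE : x + 2 * a = (x + a) + a by ring.
have xE : x = (x + a) - a by ring.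
have e1 : cos (x + 2 * a) - cos x = - (2 * (sin (x + a) * sin a)).
  by rewrite yE cosD [in cos x]xE cosB; ring.
have e2 : sin (x + 2 * a) - sin x = 2 * (cos (x + a) * sin a).
  by rewrite yE sinD [in sin x]xE sinB; ring.
have e3 : cos a = cos (x + a) * cos x + sin (x + a) * sin x.
  by rewrite -cosB; congr cos; ring.
rewrite -!mulrBr e1 e2 [X in rho * X - _]e3; ring.
Qed.

Lemma leftof_affine p q (w1 w2 : R) (z1 z2 : R * R) : w1 + w2 = 1 ->
  leftof p q (w1 * z1.1 + w2 * z2.1, w1 * z1.2 + w2 * z2.2) =
  w1 * leftof p q z1 + w2 * leftof p q z2.
Proof. by move=> /(canRL (addrK _)) ->; rewrite /leftof/=; ring. Qed.

Lemma leftofC p q (z : R * R) : leftof p q z = leftof q z p.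
Proof. by rewrite /leftof; ring. Qed.

Lemma leftof_opp p q (z : R * R) : leftof q p z = - leftof p q z.
Proof. by rewrite /leftof; ring. Qed.

(** The three values of [leftof] at z are its barycentric coordinates. So |z|^2 is the weighted mean
    of the products z.p_i, each at most (|z|^2 + r) / 2. *)
Lemma disk_triangle (p1 p2 p3 z : R * R) (r : R) :
  0 < leftof p1 p2 p3 -> 0 <= leftof p1 p2 z -> 0 <= leftof p2 p3 z ->
  0 <= leftof p3 p1 z -> dotp p1 p1 <= r -> dotp p2 p2 <= r -> dotp p3 p3 <= r ->
  dotp z z <= r.
Proof.
move=> D0 l3 l1 l2 h1 h2 h3; set D := leftof p1 p2 p3 in D0.
have DE : D = leftof p2 p3 z + leftof p3 p1 z + leftof p1 p2 z.
  by rewrite /D /leftof; ring.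
have zE : D * dotp z z = leftof p2 p3 z * dotp z p1 + leftof p3 p1 z * dotp z p2
    + leftof p1 p2 z * dotp z p3.
  by rewrite /D /leftof /dotp; ring.
have cs p : dotp p p <= r -> dotp z p <= (dotp z z + r) / 2.
  move=> pr; have : 0 <= (z.1 - p.1) ^+ 2 + (z.2 - p.2) ^+ 2.
    by rewrite addr_ge0 ?sqr_ge0.
  by move: pr; rewrite /dotp !expr2; lra.
move: (cs _ h1) (cs _ h2) (cs _ h3) => c1 c2 c3.
have k1 := ler_wpM2l l1 c1; have k2 := ler_wpM2l l2 c2; have k3 := ler_wpM2l l3 c3.
have : D * dotp z z <= D * ((dotp z z + r) / 2) by rewrite zE [in leRHS]DE; lra.
by rewrite ler_pM2l//; lra.
Qed.

(** A point of the region lies in one triangle of the fan of diagonals from vertex 0, and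
    [disk_triangle] applies there. *)
Lemma region_disk n (P : 'I_n -> R * R) (r : R) : convex_ngon P ->
  (forall i, dotp (P i) (P i) <= r) ->
  forall z, region P z -> dotp z z <= r.
Proof.
case: n P => [|[|[|n]]] P [] // _ _ Pc Pr z Pz.
pose f (k : nat) : R := leftof (P ord0) (P (inord k)) z.
have f1 : 0 <= f 1%N.
  have := Pz ord0; rewrite /f (_ : ordS ord0 = inord 1)//.
  by apply: val_inj; rewrite /= inordK.
have fn : f n.+2 <= 0.
  have := Pz ord_max; rewrite (_ : ordS ord_max = ord0); last first.
    by apply: val_inj; rewrite /= modnn.
  rewrite /f (_ : inord n.+2 = ord_max); last by apply: val_inj; rewrite /= inordK.
  by rewrite leftof_opp; lra.
have [k [k1 kn fk fk1]] : exists k : nat, [/\ (1 <= k)%N, (k < n.+2)%N, 0 <= f k & f k.+1 <= 0].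
  have [fk|/existsNP[k]] := pselect (forall k, (k < n.+2)%N -> (1 <= k)%N -> 0 <= f k -> 0 <= f k.+1).
    have g k : (k < n.+2)%N -> 0 <= f k.+1.
      elim: k => // k IH kn; apply: fk => //; apply: IH; exact: ltnW.
    exists n.+1; split => //; exact: g.
  move=> /not_implyP[kn /not_implyP[k1 /not_implyP[fk /negP]]].
  by rewrite -ltNge => /ltW ?; exists k.
have ok : (inord k : 'I_n.+3) = k :> nat by rewrite inordK// ltnS ltnW.
have ok1 : (inord k.+1 : 'I_n.+3) = k.+1 :> nat by rewrite inordK.
have Sk : ordS (inord k : 'I_n.+3) = inord k.+1.
  by apply: val_inj; rewrite /= ok ok1 modn_small.
apply: (@disk_triangle (P ord0) (P (inord k)) (P (inord k.+1))) => //.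
- rewrite leftofC -Sk; apply: Pc.
    by apply/eqP => /(congr1 val)/=; rewrite ok => e; rewrite -e in k1.
  by rewrite Sk; apply/eqP => /(congr1 val)/=; rewrite ok1.
- by have := Pz (inord k); rewrite Sk.
- by rewrite leftof_opp oppr_ge0.
Qed.

Section angular.
Variables (n : nat) (a : 'I_n -> R) (t0 rho : R).
Hypotheses (a0 : forall i, 0 < a i < pi) (a_sum : \sum_i a i = pi).
Hypothesis rho0 : 0 < rho.

Definition partial_angle (k : nat) : R := \sum_(j < n | (j < k)%N) a j.

(** [a i] is half the central angle of side i, which explains the factor 2 and the total pi. *)
Let tau k := t0 + 2 * partial_angle k.
Definition inscribed (i : 'I_n) : R * R := pt rho (tau i).

Lemma partial_angleS (i : 'I_n) : partial_angle i.+1 = partial_angle i + a i.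
Proof.
rewrite /partial_angle (bigD1 i) ?ltnS//= addrC; congr (_ + _).
by apply: eq_bigl => j; rewrite ltnS ltn_neqAle andbC.
Qed.

Lemma partial_angle_full : partial_angle n = pi.
Proof. by rewrite -a_sum; apply: eq_bigl => j; rewrite ltn_ord. Qed.

Lemma partial_angle_le k l : (k <= l)%N -> partial_angle k <= partial_angle l.
Proof.
move=> kl; rewrite /partial_angle [leRHS](bigID (fun j : 'I_n => (j < k)%N))/=.
have -> : \sum_(j < n | (j < l)%N && (j < k)%N) a j = \sum_(j < n | (j < k)%N) a j.
  apply: eq_bigl => j; case: (ltnP j k) => jk; rewrite ?andbF// andbT.
  by rewrite (leq_trans jk).
by rewrite lerDl sumr_ge0// => j _; case/andP: (a0 j) => /ltW.
Qed.

Lemma partial_angle_lt (i : 'I_n) l : (i < l)%N -> partial_angle i < partial_angle l.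
Proof.
move=> il; apply: lt_le_trans (partial_angle_le il).
by rewrite partial_angleS ltrDl; case/andP: (a0 i).
Qed.

Lemma partial_angle0 : partial_angle 0 = 0.
Proof. by rewrite /partial_angle big1. Qed.

Lemma partial_angle_bound k : (k <= n)%N -> 0 <= partial_angle k <= pi.
Proof.
move=> kn; rewrite -{1}partial_angle0 -partial_angle_full.
by rewrite !partial_angle_le.
Qed.

Lemma pt_period x : pt rho (x + 2 * pi) = pt rho x.
Proof. by rewrite /pt mulr_natl cosD2pi sinD2pi. Qed.

Lemma inscribedS (i : 'I_n) : inscribed (ordS i) = pt rho (tau i + 2 * a i).
Proof.
have -> : tau i + 2 * a i = tau i.+1 by rewrite /tau partial_angleS; ring.
rewrite /inscribed /=; have := ltn_ord i; rewrite leq_eqVlt => /predU1P[e|il].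
  by rewrite e modnn /tau partial_angle0 mulr0 addr0 partial_angle_full pt_period.
by rewrite modn_small.
Qed.

Lemma leftof_inscribed_pt (i : 'I_n) x : leftof (inscribed i) (inscribed (ordS i)) (pt rho x) =
  4 * rho ^+ 2 * (sin (a i) * sin ((x - tau i) / 2 - a i) * sin ((x - tau i) / 2)).
Proof.
rewrite inscribedS leftof_pt; congr (_ * (sin _ * sin _ * sin _)); by field.
Qed.

Let sina_gt0 i : 0 < sin (a i). Proof. by apply: sin_gt0_pi; exact: a0. Qed.

(** By [leftof_inscribed_pt] the sign is that of a product of two sines. Their arguments both lie in
    ]0, pi[ if vertex j comes after side i, and both in ]-pi, 0[ if it comes before. *)
Lemma convex_inscribed : (3 <= n)%N -> rho < 1 -> convex_ngon inscribed.
Proof.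
move=> n3 rho1; split => //.
  by move=> i; rewrite /H2/= /inscribed dotp_ptxx expr_lt1// ltW.
move=> i j ji jSi; rewrite [X in leftof _ _ X]/inscribed leftof_inscribed_pt.
rewrite pmulr_rgt0; last by rewrite mulr_gt0 ?exprn_gt0.
rewrite -mulrA pmulr_rgt0//.
have e1 : (tau j - tau i) / 2 = partial_angle j - partial_angle i by rewrite /tau; field.
rewrite e1; have /andP[pj0 pj1] := partial_angle_bound (ltnW (ltn_ord j)).
have /andP[pi0 pi1] := partial_angle_bound (ltnW (ltn_ord i)).
have pjn : partial_angle j < pi by rewrite -partial_angle_full partial_angle_lt.
have pin : partial_angle i < pi by rewrite -partial_angle_full partial_angle_lt.
case: (ltngtP i j) => ij; last by rewrite (val_inj ij) eqxx in ji.
  have ij1 : (i.+1 < j)%N.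
    rewrite ltn_neqAle ij andbT; apply: contra jSi => /eqP e.
    by apply/eqP/val_inj; rewrite /= e modn_small.
  have i1n : (i.+1 < n)%N by apply: ltn_trans (ltn_ord j).
  have := @partial_angle_lt (Ordinal i1n) j ij1; rewrite /= partial_angleS => lt1.
  by rewrite mulr_gt0// sin_gt0_pi; have := a0 i; lra.
have lt1 := @partial_angle_lt j i ij.
have lt2 : partial_angle i + a i - partial_angle j < pi.
  rewrite -partial_angleS.
  have [ein|ein] := eqVneq i.+1 n.
    have j0 : (0 < j)%N.
      rewrite lt0n; apply: contra jSi => /eqP e.
      by apply/eqP/val_inj; rewrite /= ein modnn.
    have n0 : (0 < n)%N by apply: leq_trans n3.
    have := @partial_angle_lt (Ordinal n0) j j0; rewrite /= partial_angle0 ein partial_angle_full.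
    lra.
  have i1n : (i.+1 < n)%N by rewrite ltn_neqAle ein ltn_ord.
  have := @partial_angle_lt (Ordinal i1n) n i1n; rewrite /= partial_angle_full; lra.
rewrite -mulrNN -!sinN mulr_gt0// sin_gt0_pi; have := a0 i; lra.
Qed.

End angular.

End inscribed_polygons.

(** * Half-angles of a convex polygon inscribed in a circle *)

Section polygon_angles.
Context (R : realType).

Lemma polar_form (rho : R) (z : R * R) : 0 < rho -> dotp z z = rho ^+ 2 ->
  exists2 t, - pi < t <= pi & z = pt rho t.
Proof.
case: z => x y r0; rewrite /dotp /= => e.
have rn := lt0r_neq0 r0.
have cs : (x / rho) ^+ 2 + (y / rho) ^+ 2 = 1.
  by rewrite !exprMn -mulrDl !exprVn -[in X in X + _]expr2 in e * => //;
     rewrite -?expr2 in e; rewrite e divff// expf_neq0.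
have xb : -1 <= x / rho <= 1 by apply/andP; split; nra.
have [y0|y0] := lerP 0 y.
  exists (acos (x / rho)); first by have := acos_ge0 xb; have := acos_lepi xb; have := pi_gt0 R; lra.
  rewrite /pt acosK ?in_itv// sin_acos// (_ : 1 - _ = (y / rho) ^+ 2); last by lra.
  by rewrite sqrtr_sqr ger0_norm ?divr_ge0 ?(ltW r0)//; congr (_, _); field.
have xb' : -1 < x / rho < 1.
  have yr : y / rho < 0 by rewrite pmulr_llt0 ?invr_gt0.
  by apply/andP; split; nra.
exists (- acos (x / rho)).
  have xl : -1 < x / rho <= 1 by lra.
  by have := acos_ge0 xb; have := acos_ltpi xl; have := pi_gt0 R; lra.
rewrite /pt cosN sinN acosK ?in_itv// sin_acos// (_ : 1 - _ = (y / rho) ^+ 2); last by lra.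
rewrite sqrtr_sqr normrM normfV (ltr0_norm y0) (gtr0_norm r0).
by congr (_, _); field.
Qed.

(** With polar angles chosen in one turn starting at vertex 0, convexity tested on vertex 0 forces
    them to increase, and half their increments are the required half-angles. *)
Lemma polygon_angles n (P : 'I_n -> R * R) (rho : R) : 0 < rho -> convex_ngon P ->
  (forall i, dotp (P i) (P i) = rho ^+ 2) ->
  exists t0, exists a : 'I_n -> R,
    [/\ forall i, 0 < a i < pi, \sum_i a i = pi & forall i, P i = inscribed a t0 rho i].
Proof.
move=> r0; case: n P => [|[|[|n]]] P [] // _ PH Pc Pr.
have [t0 t0b P0] := polar_form r0 (Pr ord0).
have /choice[t tP] : forall i, exists t, (t0 <= t < t0 + 2 * pi) /\ P i = pt rho t.
  move=> i.
  have [t tb Pi] := polar_form r0 (Pr i); have p0 := pi_gt0 R.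
  have [tt|tt] := lerP t0 t; first by exists t; split => //; lra.
  by exists (t + 2 * pi); split; [lra|rewrite pt_period].
have t0E : t ord0 = t0.
  have [tb e] := tP ord0; have p0 := pi_gt0 R.
  have [//|tn] := eqVneq (t ord0) t0.
  have tl : t0 < t ord0 by rewrite lt_neqAle eq_sym tn; case/andP: tb.
  have : dotp (pt rho (t ord0)) (pt rho t0) = rho ^+ 2 by rewrite -e -P0 Pr.
  rewrite dotp_pt => /(congr1 (fun u => u / rho ^+ 2)).
  rewrite mulrAC divff ?mul1r ?expf_neq0 ?lt0r_neq0//.
  rewrite (_ : t ord0 - t0 = 2 * ((t ord0 - t0) / 2)); last by field.
  rewrite mulr_natl cos_mulr2n => ec.
  have : sin ((t ord0 - t0) / 2) ^+ 2 = 0 by rewrite sin2cos2; lra.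
  move/eqP; rewrite sqrf_eq0 => /eqP s0.
  by have := @sin_gt0_pi R ((t ord0 - t0) / 2); rewrite s0 ltxx => /(_ _)/negP; lra.
pose T k := t (inord k).
have Tb k : t0 <= T k < t0 + 2 * pi by have [] := tP (inord k).
have T0 : T 0%N = t0 by rewrite /T -t0E; congr t; apply: val_inj; rewrite /= inordK.
have PT (i : 'I_n.+3) : P i = pt rho (T i).
  by have [_ ->] := tP i; rewrite /T; congr (pt rho (t _)); apply: val_inj; rewrite /= inordK.
have S k : (k < n.+2)%N -> ordS (inord k : 'I_n.+3) = inord k.+1.
  move=> kn; apply: val_inj; rewrite /= !inordK//; last exact: ltnW.
  by rewrite modn_small.
have Tgt k : (0 < k < n.+3)%N -> t0 < T k.
  move=> /andP[k0 kn]; have /andP[] := Tb k; rewrite le_eqVlt => /predU1P[e _|//].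
  have Pk : P (inord k) = P ord0 by rewrite !PT inordK// -e /= T0.
  (* If vertex k coincided with vertex 0, vertex j would have determinant 0 with side 0: for k = 1
     the side itself is degenerate and j = 2 serves, otherwise j = k. *)
  pose j : 'I_n.+3 := if k == 1%N then inord 2 else inord k.
  have jE : j = (if k == 1%N then 2 else k) :> nat.
    by rewrite /j; case: ifP => _; rewrite inordK.
  have jn : j != ord0 by apply/eqP => /(congr1 val); rewrite /= jE; case: ifP => // _ e0; rewrite e0 in k0.
  have jS : j != ordS ord0.
    by apply/eqP => /(congr1 val); rewrite /= jE modn_small//; case: ifP => // /eqP.
  have := Pc ord0 j jn jS; rewrite /j; case: ifP => [/eqP k1|_].
    rewrite (_ : ordS ord0 = inord k); last by apply: val_inj; rewrite /= k1 inordK.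
    by rewrite Pk /leftof !subrr !mul0r subrr ltxx.
  by rewrite Pk /leftof !subrr !mulr0 subrr ltxx.
have Tlt k : (k < n.+2)%N -> T k < T k.+1.
  case: k => [_|k kn]; first by rewrite T0 Tgt.
  have kb : (0 < k.+1 < n.+3)%N by rewrite /= ltnW.
  have kb1 : (0 < k.+2 < n.+3)%N by [].
  have n1 : ord0 != inord k.+1 :> 'I_n.+3.
    by apply/eqP => /(congr1 val); rewrite /= inordK.
  have n2 : ord0 != ordS (inord k.+1) :> 'I_n.+3.
    by rewrite S//; apply/eqP => /(congr1 val); rewrite /= inordK.
  (* The determinant of vertices 0, k + 1, k + 2 is a product of three sines. Two are positive by
     the choice of the turn, so the third, of half the increment, is positive. *)
  have := Pc _ _ n1 n2; rewrite S// leftofC leftofC !PT /= !inordK//.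
  rewrite T0 leftof_pt pmulr_rgt0; last by rewrite mulr_gt0// exprn_gt0.
  have := Tgt _ kb; have := Tgt _ kb1; have := Tb k.+1; have := Tb k.+2 => b2 b1 g2 g1.
  have s1 : 0 < sin ((T k.+1 - t0) / 2) by apply: sin_gt0_pi; lra.
  have s2 : 0 < sin ((T k.+2 - t0) / 2) by apply: sin_gt0_pi; lra.
  rewrite pmulr_lgt0// pmulr_rgt0// ltNge => sg; apply/negP => le.
  have : 0 <= sin (- ((T k.+2 - T k.+1) / 2)) by apply: sin_ge0_pi; lra.
  by rewrite sinN; lra.
(* The last side closes up at [t0 + 2 * pi], the angle of vertex 0 after a full turn. *)
pose a (i : 'I_n.+3) := ((if (i.+1 < n.+3)%N then T i.+1 else t0 + 2 * pi) - T i) / 2.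
have pa k : (k < n.+3)%N -> partial_angle a k = (T k - t0) / 2.
  elim: k => [_|k IH kn]; first by rewrite partial_angle0 T0 subrr mul0r.
  have kn' := ltnW kn; have := partial_angleS a (Ordinal kn') => /= ->.
  by rewrite IH// /a /= kn; field.
exists t0, a; split.
- move=> i; rewrite /a; have := Tb i => bi; case: ltnP => [ii|ii].
    have := Tlt i ii; have := Tb i.+1 => ? ?.
    by lra.
  have ik : (0 < i < n.+3)%N by rewrite ltn_ord andbT lt0n; apply/negP => /eqP e; move: ii; rewrite e.
  by have := Tgt _ ik; lra.
- have := partial_angleS a ord_max; rewrite (pa n.+2 (ltnSn _)) [a ord_max]/a /= ltnn => e.
  transitivity (partial_angle a n.+3); last by rewrite e; field.
  by apply: eq_bigl => j; rewrite ltn_ord.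
- by move=> i; rewrite PT /inscribed pa//; congr pt; field.
Qed.

End polygon_angles.

(** * Area of an inscribed polygon *)

Section inscribed_area.
Context (R : realType).
Local Notation T := (measurableTypeR R).
Local Notation mu := (@lebesgue_measure R).
Local Notation mu2 := (mu \x mu)%E.

Lemma measurable_leftof (p q : R * R) : measurable_fun setT (fun z : T * T => leftof p q z : R).
Proof.
apply: (@measurable_funB _ _ R); apply: (@measurable_funM _ _ R) => //;
  apply: (@measurable_funB _ _ R) => //; (exact: measurable_fst || exact: measurable_snd).
Qed.

Lemma measurable_region n (P : 'I_n -> R * R) : measurable (region P : set (T * T)).
Proof.
rewrite (_ : region P = \bigcap_(i in [set: 'I_n])
   ((fun z : T * T => leftof (P i) (P (ordS i)) z) @^-1` `[0, +oo[%classic)); last first.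
  apply/seteqP; split => z /= H i; first by move=> _; rewrite /= in_itv/= andbT; exact: H.
  by have := H i I; rewrite /= in_itv/= andbT.
apply: fin_bigcap_measurable => // i _.
by rewrite -[X in measurable X]setTI; apply: measurable_leftof.
Qed.

(** The complement of the base angle of the isosceles triangle over a chord of half-angle a. The
    [asc] term is the base angle, negative when a exceeds pi/2, so that the triangle is then counted
    with a sign. *)
Definition half_apex (rho a : R) : R :=
  pi / 2 - asc (rho * cos a * Num.sqrt (1 - rho ^+ 2) /
    (rho * Num.sqrt (1 - (rho * cos a) ^+ 2))).

Lemma cap_value_half_apex (rho a : R) : 0 < rho -> 0 <= a <= pi ->
  cap_value rho (rho * cos a) =
  2 * ((Num.sqrt (1 - rho ^+ 2))^-1 * a - half_apex rho a).
Proof.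
move=> r0 a0; rewrite /cap_value /half_apex.
rewrite [rho * cos a / rho]mulrAC divff ?lt0r_neq0// mul1r.
have -> : asc (cos a) = pi / 2 - a; last by ring.
have -> : cos a = sin (pi / 2 - a) by rewrite -[X in sin X]opprB sinN sinBpihalf opprK.
by rewrite ascK//; lra.
Qed.

Section inscribed_area_formula.
Variables (n : nat) (a : 'I_n -> R) (t0 rho : R).
Hypotheses (n3 : (3 <= n)%N) (a0 : forall i, 0 < a i < pi) (a_sum : \sum_i a i = pi).
Hypothesis (rho01 : 0 < rho < 1).

Let P := inscribed a t0 rho.
Let rho0 : 0 < rho. Proof. by case/andP: rho01. Qed.

Let capi (i : 'I_n) : set (T * T) :=
  [set z | leftof (P i) (P (ordS i)) z < 0 /\ dotp z z <= rho ^+ 2].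
Let disk : set (T * T) := [set z | dotp z z <= rho ^+ 2].

Let tau (i : 'I_n) := t0 + 2 * partial_angle a i.

Let sina_gt0 i : 0 < sin (a i). Proof. by apply: sin_gt0_pi; exact: a0. Qed.

Let leftofE i z : leftof (P i) (P (ordS i)) z = 2 * rho * sin (a i) *
  (rho * cos (a i) - (cos (tau i + a i) * z.1 + sin (tau i + a i) * z.2)).
Proof. by rewrite /P inscribedS// leftof_chord. Qed.

Let leftof_lt0 i z : (leftof (P i) (P (ordS i)) z < 0) =
  (rho * cos (a i) < cos (tau i + a i) * z.1 + sin (tau i + a i) * z.2).
Proof.
by rewrite leftofE pmulr_rlt0 ?subr_lt0// mulr_gt0// mulr_gt0.
Qed.

Let capiE i z : capi i z <->
  cap rho false (rho * cos (a i)) (rot (cos (tau i + a i)) (- sin (tau i + a i)) z).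
Proof.
rewrite /capi /cap /rot /= leftof_lt0 in_itv/= mulNr opprK.
set m := tau i + a i.
have -> : dotp (cos m * z.1 + sin m * z.2, - sin m * z.1 + cos m * z.2)
    (cos m * z.1 + sin m * z.2, - sin m * z.1 + cos m * z.2) = dotp z z.
  rewrite /dotp/= -[in RHS](mul1r (_ + _)) -(cos2Dsin2 m); ring.
split => [[-> zr]|[/andP[-> _] ->]]//; split => //=.
have : (cos m * z.1 + sin m * z.2) ^+ 2 <= rho ^+ 2.
  have h := sqr_ge0 (- sin m * z.1 + cos m * z.2).
  apply: le_trans zr; rewrite /dotp -[leRHS](mul1r (_ + _)) -(cos2Dsin2 m); nra.
by have := rho0; move=> ? ?; rewrite leNgt; apply/negP => ?; nra.
Qed.

Let measurable_capi i : measurable (capi i).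
Proof.
have -> : capi i = ((fun z : T * T => leftof (P i) (P (ordS i)) z) @^-1` `]-oo, 0[%classic)
    `&` [set z : T * T | dotp z z <= rho ^+ 2].
  by apply/seteqP; split => z /= []; rewrite in_itv.
apply: measurableI; last exact: measurable_disk.
by rewrite -[X in measurable X]setTI; apply: measurable_leftof.
Qed.

Let cos_bound i : - rho <= rho * cos (a i) < rho.
Proof.
apply/andP; split; first by have := cos_geN1 (a i); have := rho0; nra.
rewrite gtr_pMr// -[ltRHS](@cos0 R) ltr_cos ?in_itv/= ?lexx ?pi_ge0//.
  by case/andP: (a0 i).
by case/andP: (a0 i) => /ltW -> /ltW ->.
Qed.

Let earea_capi i : earea (capi i) = (2 * ((Num.sqrt (1 - rho ^+ 2))^-1 * a i - half_apex rho (a i)))%:E.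
Proof.
have /andP[ai0 ai1] := a0 i; have /andP[cb1 cb2] := cos_bound i.
rewrite -cap_value_half_apex ?(ltW ai0) ?(ltW ai1)//.
rewrite -(@earea_cap _ rho rho01 false)//.
apply: (@earea_rot _ (cos (tau i + a i)) (- sin (tau i + a i))) => //.
- by rewrite sqrrN cos2Dsin2.
- by apply: measurable_cap.
Qed.

Let earea_disk : earea disk = (2 * ((Num.sqrt (1 - rho ^+ 2))^-1 * pi - pi))%:E.
Proof.
have e : rho * cos pi = - rho by rewrite cospi mulrN1.
have -> : earea disk = earea (cap rho true (- rho)).
  apply: eq_earea => z _; rewrite /disk /cap /=; split => [zr|[]//]; split => //.
  have := rho0; move: zr; rewrite /dotp in_itv/= => ? ?.
  by apply/andP; split; rewrite leNgt; apply/negP => ?; nra.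
rewrite earea_cap ?lexx//; last by have := rho0; lra.
rewrite -e cap_value_half_apex ?lexx ?pi_ge0// /half_apex e.
rewrite sqrrN [rho * Num.sqrt _]mulrC mulNr mulNr -[Num.sqrt _ * rho]mulrC divff; last first.
  rewrite mulf_neq0 ?lt0r_neq0// sqrtr_gt0.
  by case/andP: rho01 => ? ?; nra.
by rewrite ascN asc1; congr (2 * (_ - _))%:E; field.
Qed.

(** The chord through z parallel to side j ends at two points of the arc cut off by side j, at
    directions m + g and m - g with g < a j. Both are weakly left of side i, hence so is z. *)
Let caps_disjoint i j z : capi i z -> capi j z -> i = j.
Proof.
wlog : i j / exists k : 'I_n, k = i => [H|_] zi zj; first by apply: (H i j) => //; exists i.
have [//|/eqP nij] := pselect (i = j); exfalso.
have [z1 z2] := zj; have [+ _] := zi; rewrite ltNge => /negP; apply.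
pose m := tau j + a j; pose x := cos m * z.1 + sin m * z.2.
pose y := - sin m * z.1 + cos m * z.2.
have xy : x ^+ 2 + y ^+ 2 = dotp z z.
  by rewrite /dotp -[RHS](mul1r (_ + _)) -(cos2Dsin2 m) /x /y; ring.
have xl : rho * cos (a j) < x by rewrite -leftof_lt0.
have x2 : x ^+ 2 <= rho ^+ 2 by have := sqr_ge0 y; move: z2; rewrite -xy; lra.
have xr : - rho <= x <= rho.
  by have := rho0; move=> ?; apply/andP; split; rewrite leNgt; apply/negP => ?; nra.
have xr1 : -1 <= x / rho <= 1 by rewrite ler_pdivlMr// ler_pdivrMr// mulN1r mul1r.
pose g := acos (x / rho).
have gE : rho * cos g = x by rewrite /g acosK ?in_itv//; field; rewrite lt0r_neq0.
have g0 : 0 <= g by exact: acos_ge0.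
have gp : g <= pi by exact: acos_lepi.
have /andP[aj0 aj1] := a0 j; have /andP[ai0 ai1] := a0 i.
have gj : g < a j.
  rewrite -ltr_cos ?in_itv/= ?g0 ?gp ?(ltW aj0) ?(ltW aj1)//.
  by rewrite -(ltr_pM2l rho0) gE.
have sg0 : 0 <= rho * sin g by rewrite mulr_ge0 ?(ltW rho0)// sin_ge0_pi// g0.
have sgE : (rho * sin g) ^+ 2 = rho ^+ 2 - x ^+ 2.
  by rewrite -gE !exprMn sin2cos2; ring.
have yb : - (rho * sin g) <= y <= rho * sin g.
  have : y ^+ 2 <= (rho * sin g) ^+ 2 by rewrite sgE -xy in z2 *; lra.
  by move=> ?; apply/andP; split; rewrite leNgt; apply/negP => ?; nra.
have side_ge0 (u : R) : - g <= u <= g -> 0 <= leftof (P i) (P (ordS i)) (pt rho (m + u)).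
  move=> ug; rewrite /P leftof_inscribed_pt// pmulr_rge0; last by rewrite mulr_gt0 ?exprn_gt0.
  rewrite -mulrA pmulr_rge0//.
  have e : (m + u - (t0 + 2 * partial_angle a i)) / 2 =
    partial_angle a j - partial_angle a i + (a j + u) / 2 by rewrite /m /tau; field.
  rewrite e.
  have /andP[pj0 pj1] := partial_angle_bound a0 a_sum (ltnW (ltn_ord j)).
  have /andP[pi0 pi1] := partial_angle_bound a0 a_sum (ltnW (ltn_ord i)).
  have := partial_angle_bound a0 a_sum (ltn_ord j); rewrite partial_angleS => /andP[_ pj2].
  have := partial_angle_bound a0 a_sum (ltn_ord i); rewrite partial_angleS => /andP[_ pi2].
  case: (ltngtP i j) => ij; last by move: nij; rewrite (val_inj ij) eqxx.
    have := partial_angle_le a0 ij; rewrite partial_angleS => le.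
    by rewrite mulr_ge0// sin_ge0_pi//; lra.
  have := partial_angle_le a0 ij; rewrite partial_angleS => le.
  by rewrite -mulrNN -!sinN mulr_ge0// sin_ge0_pi//; lra.
have h1 := side_ge0 g; have h2 := side_ge0 (- g).
have zE w : (w * (rho * sin g) * 2 = y + rho * sin g) ->
   z = (w * (pt rho (m + g)).1 + (1 - w) * (pt rho (m - g)).1,
        w * (pt rho (m + g)).2 + (1 - w) * (pt rho (m - g)).2).
  move=> wE; have z1E : z.1 = cos m * x - sin m * y.
    by rewrite -[LHS]mul1r -(cos2Dsin2 m) /x /y; ring.
  have z2E : z.2 = sin m * x + cos m * y.
    by rewrite -[LHS]mul1r -(cos2Dsin2 m) /x /y; ring.
  have yE : y = w * (rho * sin g) * 2 - rho * sin g by rewrite wE; ring.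
  rewrite [LHS]surjective_pairing z1E z2E /pt /= cosD cosB sinD sinB -gE yE.
  by congr (_, _); ring.
(* When g = 0 the chord through z degenerates to a point and the weight 1 is chosen. *)
have [s0|s0] := eqVneq (rho * sin g) 0.
  have y0 : y = 0 by move: yb; rewrite s0; lra.
  by rewrite (zE 1) ?s0 ?y0; [rewrite leftof_affine; [rewrite subrr mul0r addr0 mul1r; apply: h1; lra|ring]|ring].
pose w := (y + rho * sin g) / (2 * (rho * sin g)).
have sp : 0 < rho * sin g by rewrite lt_neqAle eq_sym s0.
have d0 : 0 < 2 * (rho * sin g) by lra.
have w01 : 0 <= w <= 1.
  by apply/andP; split; [apply: divr_ge0; lra|rewrite /w (ler_pdivrMr _ _ d0); lra].
rewrite (zE w); last by rewrite /w; move: s0; set S := rho * sin g => s0; field.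
rewrite leftof_affine; last by ring.
by rewrite addr_ge0// mulr_ge0//; [lra|apply: h1; lra|lra|apply: h2; lra].
Qed.

Let indicE z : ((EFin \o @wgt R) \_ disk) z =
  (((EFin \o @wgt R) \_ (region P)) z + \sum_(i < n) ((EFin \o @wgt R) \_ (capi i)) z)%E.
Proof.
have Pconvex : convex_ngon P by apply: convex_inscribed => //; case/andP: rho01.
have Pdisk z' : region P z' -> disk z'.
  by apply: region_disk => // i; rewrite /P /inscribed dotp_ptxx.
rewrite !patchE; have [zR|zR] := pselect (region P z).
  rewrite (mem_set zR) (mem_set (Pdisk _ zR)) big1 ?adde0// => i _; rewrite patchE ifF//.
  by apply/negbTE; rewrite notin_setE => -[+ _]; rewrite ltNge => /negP; apply; exact: zR.
rewrite (memNset zR) add0e.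
have /existsNP[i /negP] := zR; rewrite -ltNge => zi.
rewrite (bigD1 i)//= big1 ?adde0; last first.
  move=> j ji; rewrite patchE ifF//; apply/negbTE; rewrite notin_setE => zj.
  have zi' : capi i z by split => //; case: zj.
  by rewrite (caps_disjoint zi' zj) eqxx in ji.
rewrite patchE; congr (if _ then _ else _); apply/idP/idP => [/set_mem zd|/set_mem[_ zd]]; exact/mem_set.
Qed.

(** The disk is the disjoint union of the region and the caps cut off by the sides. The terms with
    the factor cosh r cancel because the half-angles add up to pi. *)
Lemma earea_inscribed :
  earea (region P) = (2 * (\sum_i half_apex rho (a i)) - 2 * pi)%:E.
Proof.
pose s := (Num.sqrt (1 - rho ^+ 2))^-1.
have E : earea disk = (earea (region P) + \sum_(i < n) earea (capi i))%E.
  rewrite !eareaE (eq_integral _ _ (fun z _ => indicE z)) ge0_integralD//.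
  - rewrite ge0_integral_sum//.
    + by congr (_ + _)%E; apply: eq_bigr => i _; rewrite eareaE.
    + by move=> i; apply: measurable_wgt_restrict; exact: measurable_capi.
    + by move=> i z _; exact: wgt_restrict_ge0.
  - by move=> z _; exact: wgt_restrict_ge0.
  - by apply: measurable_wgt_restrict; exact: measurable_region.
  - by move=> z _; apply: sume_ge0 => i _; exact: wgt_restrict_ge0.
  - apply: emeasurable_sum => i; apply: measurable_wgt_restrict; exact: measurable_capi.
move: E; rewrite earea_disk (eq_bigr _ (fun i _ => earea_capi i)) sumEFin.
rewrite -mulr_sumr sumrB -mulr_sumr a_sum -/s.
case: (earea (region P)) => [r||] //= [e]; congr EFin; lra.
Qed.

End inscribed_area_formula.
End inscribed_area.

(** * Isometries moving the circumcenter to the origin *)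

Section moving_the_center.
Context (R : realType).
Implicit Types (p q c : R * R) (b r : R).

Lemma H2_dotp_lt1 p q : H2 p -> H2 q -> 0 < 1 - dotp p q.
Proof.
rewrite /H2/= => hp hq; have : 0 <= (p.1 - q.1) ^+ 2 + (p.2 - q.2) ^+ 2.
  by rewrite addr_ge0 ?sqr_ge0.
by move: hp hq; rewrite /dotp !expr2; lra.
Qed.

Lemma boost_H2 b p : `|b| < 1 -> H2 p -> H2 (boost b p).
Proof.
move=> b1 hp; have p1 := ltW (H2_fst hp); rewrite /H2/= -subr_gt0 boost_dotp//.
have d0 := boost_den_gt0 b1 p1.
by rewrite divr_gt0 ?mulr_gt0// ?onesub_sqr_gt0// H2_dotp_lt1.
Qed.

Lemma boost_hdist b p q : `|b| < 1 -> H2 p -> H2 q ->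
  hdist (boost b p) (boost b q) = hdist p q.
Proof.
move=> b1 hp hq; have p1 := ltW (H2_fst hp); have q1 := ltW (H2_fst hq).
have dp := boost_den_gt0 b1 p1; have dq := boost_den_gt0 b1 q1.
have bb := onesub_sqr_gt0 b1.
have H z : H2 z -> Num.sqrt (1 - dotp (boost b z) (boost b z)) =
    Num.sqrt (1 - b ^+ 2) * Num.sqrt (1 - dotp z z) / (1 + b * z.1).
  move=> hz; have z1 := ltW (H2_fst hz); have dz := boost_den_gt0 b1 z1.
  rewrite boost_dotp// -expr2 -exprVn sqrtrM; last by rewrite mulr_ge0 ?ltW ?H2_dotp_lt1.
  by rewrite sqrtrM ?(ltW bb)// sqrtr_sqr ger0_norm// ltW// invr_gt0.
rewrite /hdist !H// boost_dotp//; congr arcosh.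
have sE : Num.sqrt (1 - b ^+ 2) ^+ 2 = 1 - b ^+ 2 by rewrite sqr_sqrtr// ltW.
have s0 : Num.sqrt (1 - b ^+ 2) != 0 by rewrite lt0r_neq0// sqrtr_gt0.
have sp : Num.sqrt (1 - dotp p p) != 0 by rewrite lt0r_neq0// sqrtr_gt0 H2_dotp_lt1.
have sq : Num.sqrt (1 - dotp q q) != 0 by rewrite lt0r_neq0// sqrtr_gt0 H2_dotp_lt1.
set s := Num.sqrt (1 - b ^+ 2) in sE s0 *; rewrite -sE.
by field; rewrite s0 sp sq !lt0r_neq0.
Qed.

(** The boost is a projective map, so determinants of triples change by a positive factor only, and
    half-planes and convexity are preserved. *)
Lemma boost_leftof b p q (z : R * R) : `|b| < 1 -> H2 p -> H2 q -> H2 z ->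
  exists2 k, 0 < k & leftof (boost b p) (boost b q) (boost b z) = k * leftof p q z.
Proof.
move=> b1 hp hq hz.
have dp := boost_den_gt0 b1 (ltW (H2_fst hp)); have dq := boost_den_gt0 b1 (ltW (H2_fst hq)).
have dz := boost_den_gt0 b1 (ltW (H2_fst hz)); have bb := onesub_sqr_gt0 b1.
exists (Num.sqrt (1 - b ^+ 2) * (1 - b ^+ 2) /
   ((1 + b * p.1) * (1 + b * q.1) * (1 + b * z.1))).
  by rewrite divr_gt0 ?mulr_gt0// sqrtr_gt0.
by rewrite /leftof /boost/=; field; rewrite !lt0r_neq0.
Qed.

Lemma rot_dotp (x y : R) p q : x ^+ 2 + y ^+ 2 = 1 ->
  dotp (rot x y p) (rot x y q) = dotp p q.
Proof.
move=> xy; rewrite /dotp /rot/= -[RHS]mul1r -xy; ring.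
Qed.

Lemma rot_leftof (x y : R) p q (z : R * R) : x ^+ 2 + y ^+ 2 = 1 ->
  leftof (rot x y p) (rot x y q) (rot x y z) = leftof p q z.
Proof.
move=> xy; rewrite /leftof /rot/= -[RHS]mul1r -xy; ring.
Qed.

Lemma rot_hdist (x y : R) p q : x ^+ 2 + y ^+ 2 = 1 ->
  hdist (rot x y p) (rot x y q) = hdist p q.
Proof. by move=> xy; rewrite /hdist !rot_dotp. Qed.

Lemma rot_to_axis c : exists x y b, [/\ x ^+ 2 + y ^+ 2 = 1, dotp c c = b ^+ 2 &
  rot x y c = (b, 0)].
Proof.
case: c => c1 c2; have [c0|c0] := eqVneq (dotp (c1, c2) (c1, c2)) 0.
  exists 1, 0, 0; have : c1 * c1 + c2 * c2 = 0 by [].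
  rewrite /rot/= => e; have h1 := sqr_ge0 c1; have h2 := sqr_ge0 c2.
  have -> : c1 = 0 by apply/eqP; rewrite -sqrf_eq0; apply/eqP; rewrite !expr2 in h1 h2 *; lra.
  have -> : c2 = 0 by apply/eqP; rewrite -sqrf_eq0; apply/eqP; rewrite !expr2 in h1 h2 *; lra.
  by split; [ring|rewrite /dotp/=; ring|congr (_, _); ring].
have cc : 0 < dotp (c1, c2) (c1, c2).
  by rewrite lt_neqAle eq_sym c0 /dotp/= addr_ge0// -expr2 sqr_ge0.
pose b := Num.sqrt (dotp (c1, c2) (c1, c2)).
have bE : b ^+ 2 = c1 ^+ 2 + c2 ^+ 2 by rewrite sqr_sqrtr ?(ltW cc)// /dotp !expr2.
have b0 : b != 0 by rewrite lt0r_neq0// sqrtr_gt0.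
exists (c1 / b), (- c2 / b), b; split.
- by rewrite !exprMn sqrrN -mulrDl -bE exprVn divff// expf_neq0.
- by rewrite bE /dotp !expr2.
- rewrite /rot/=; congr (_, _); last by field.
  by transitivity ((c1 ^+ 2 + c2 ^+ 2) / b); [field|rewrite -bE; field].
Qed.

(** tanh r, the Euclidean radius of the Klein disk of hyperbolic radius r about the origin. *)
Definition radius_klein r : R := sh r / ch r.

Lemma radius_klein_sq r : 1 - radius_klein r ^+ 2 = (ch r ^+ 2)^-1.
Proof.
have c0 := lt0r_neq0 (ch_gt0 r); rewrite /radius_klein expr_div_n.
have := ch2_sh2 r => e; rewrite -[1](@divff _ (ch r ^+ 2)) ?expf_neq0// -mulrBl e.
by rewrite addrK mul1r.
Qed.

Lemma radius_klein_bound r : 0 < r -> 0 < radius_klein r < 1.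
Proof.
move=> r0; have c0 := ch_gt0 r; have s0 : 0 < sh r by rewrite sh_gt0.
rewrite divr_gt0//= ltr_pdivrMr// mul1r -(@ltr_pXn2r _ 2) ?nnegrE ?ltW//.
by rewrite ch2_sh2 ltrDr.
Qed.

Lemma sqrt_radius_klein r : Num.sqrt (1 - radius_klein r ^+ 2) = (ch r)^-1.
Proof. by rewrite radius_klein_sq -exprVn sqrtr_sqr ger0_norm// invr_ge0 ltW// ch_gt0. Qed.

Lemma hcircle0 r (z : R * R) : 0 < r ->
  hcircle (0, 0) r z <-> dotp z z = radius_klein r ^+ 2.
Proof.
move=> r0; have /andP[k0 k1] := radius_klein_bound r0.
have hE : hdist (0, 0) z = arcosh ((Num.sqrt (1 - dotp z z))^-1).
  by rewrite /hdist /dotp/= !mul0r !addr0 subr0 sqrtr1 !mul1r.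
split => [[zH]|zz].
  rewrite hE => /(congr1 (@ch R)).
  have z1 : 0 < 1 - dotp z z by exact: H2_dotp_lt1.
  rewrite arcoshK; last first.
    rewrite invf_ge1 ?sqrtr_gt0// -[leRHS]sqrtr1 ler_sqrt// gerBl /dotp.
    by rewrite addr_ge0// -expr2 sqr_ge0.
  move=> e; have := radius_klein_sq r; rewrite -e exprVn invrK sqr_sqrtr ?(ltW z1)//; lra.
have zH : H2 z by rewrite /H2/= zz expr_lt1// ltW.
by split => //; rewrite hE zz sqrt_radius_klein invrK chK// ltW.
Qed.

Lemma hdist_pt r x y : 0 < r -> ch (hdist (pt (radius_klein r) x) (pt (radius_klein r) y)) =
  1 + 2 * (sh r * sin ((x - y) / 2)) ^+ 2 /\ 0 <= hdist (pt (radius_klein r) x) (pt (radius_klein r) y).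
Proof.
move=> r0; rewrite /hdist !dotp_ptxx dotp_pt sqrt_radius_klein.
have c0 := lt0r_neq0 (ch_gt0 r).
have -> : (1 - radius_klein r ^+ 2 * cos (x - y)) / ((ch r)^-1 * (ch r)^-1) =
   1 + 2 * (sh r * sin ((x - y) / 2)) ^+ 2.
  rewrite {1}(_ : x - y = (x - y) / 2 *+ 2); last by rewrite -mulr_natr; field.
  rewrite cos_mulr2n cos2sin2 /radius_klein; set s := sin _.
  transitivity (ch r ^+ 2 - sh r ^+ 2 * (1 - 2 * s ^+ 2)); first by rewrite -mulr_natl; field.
  by rewrite ch2_sh2; ring.
have h : 1 <= 1 + 2 * (sh r * sin ((x - y) / 2)) ^+ 2 by rewrite lerDl mulr_ge0// sqr_ge0.
by split; [exact: arcoshK|exact: arcosh_ge0].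
Qed.

Lemma cos_gt0_lt_pihalf (x : R) : 0 < x < pi -> (0 < cos x) = (x < pi / 2).
Proof.
move=> /andP[x0 x1]; have p0 := pi_gt0 R.
by rewrite -(@cos_pihalf R) ltr_cos// in_itv/=; apply/andP; split; lra.
Qed.

Lemma cos_eq0_pihalf (x : R) : 0 < x < pi -> (cos x == 0) = (x == pi / 2).
Proof.
move=> /andP[x0 x1]; have p0 := pi_gt0 R.
apply/eqP/eqP => [|->]; last exact: cos_pihalf.
rewrite -[X in _ = X -> _](@cos_pihalf R); apply: cos_inj; rewrite in_itv/=; apply/andP; split; lra.
Qed.

Lemma sh_side (r x y u : R) : 0 < r -> 0 <= y -> 0 < x < pi -> u ^+ 2 = sin x ^+ 2 ->
  ch y = 1 + 2 * (sh r * u) ^+ 2 -> sh (y / 2) = sh r * sin x.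
Proof.
move=> r0 y0 x0 ux; rewrite ch_half => e.
have {}e : sh (y / 2) ^+ 2 = (sh r * sin x) ^+ 2 by rewrite [RHS]exprMn -ux -exprMn; lra.
have s0 : 0 <= sh (y / 2) by rewrite -(sh0 R) sh_le divr_ge0.
have t0 : 0 <= sh r * sin x by rewrite mulr_ge0 ?(ltW (sin_gt0_pi x0))// ltW// sh_gt0.
by apply/eqP; rewrite -(@eqrXn2 _ 2)// e.
Qed.

(** A rotation followed by a boost takes the center to the origin and keeps distances, sides of
    lines and area, so the half-angles of [polygon_angles] apply. The position of the center
    relative to side i is the sign of cos (a i). *)
Lemma cyclic_angles n (P : 'I_n -> R * R) c r (d : n.-tuple R) :
  cyclic_ngon c r P d ->
  exists a : 'I_n -> R, [/\ forall i, 0 < a i < pi, \sum_i a i = pi,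
    forall i, sh (tnth d i / 2) = sh r * sin (a i),
    forall i, (0 < leftof (P i) (P (ordS i)) c) = (a i < pi / 2) /\
      (leftof (P i) (P (ordS i)) c == 0) = (a i == pi / 2) &
    harea (region P) = 2 * (\sum_i half_apex (radius_klein r) (a i)) - 2 * pi].
Proof.
move=> [[n3 PH Pc] [cH r0 Pcirc] dE].
have [x [y [b [xy cb rc]]]] := rot_to_axis c.
have b1 : `|- b| < 1.
  by rewrite normrN -(@expr_lt1 _ 2)// real_normK ?num_real// -cb.
have rH p : H2 p -> H2 (rot x y p) by rewrite /H2/= rot_dotp.
pose M p := boost (- b) (rot x y p).
have MH p : H2 p -> H2 (M p) by move=> ?; apply: boost_H2 => //; exact: rH.
have Mc : M c = (0, 0).
  by rewrite /M rc /boost/= subrr mul0r mulr0.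
have Mdist p q : H2 p -> H2 q -> hdist (M p) (M q) = hdist p q.
  by move=> hp hq; rewrite boost_hdist ?rot_hdist//; exact: rH.
have Mleft p q z : H2 p -> H2 q -> H2 z ->
    exists2 k, 0 < k & leftof (M p) (M q) (M z) = k * leftof p q z.
  move=> hp hq hz; have [k k0 e] := boost_leftof b1 (rH _ hp) (rH _ hq) (rH _ hz).
  by exists k => //; rewrite e rot_leftof.
pose Q i := M (P i).
have Qc : convex_ngon Q.
  split => // [i|i j ji jS]; first exact: MH.
  have [k k0 ->] := Mleft _ _ _ (PH i) (PH (ordS i)) (PH j).
  by rewrite mulr_gt0// Pc.
have rk := radius_klein_bound r0; have /andP[rk0 rk1] := rk.
have Qr i : dotp (Q i) (Q i) = radius_klein r ^+ 2.
  apply/(hcircle0 _ r0); split; first exact: MH.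
  by rewrite -Mc Mdist//; case: (Pcirc i).
have [t0 [a [a0 a_sum Qa]]] := polygon_angles rk0 Qc Qr.
exists a; split => //.
- move=> i; rewrite -dE tnth_mktuple -(Mdist _ _ (PH i) (PH _)) -/(Q _) -/(Q _) !Qa inscribedS//.
  have [h1 h2] := hdist_pt (t0 + 2 * partial_angle a i) (t0 + 2 * partial_angle a i + 2 * a i) r0.
  apply: (sh_side r0 h2 (a0 i) _ h1).
  by rewrite -sqrrN -sinN; congr (sin _ ^+ 2); field.
- move=> i; have [k k0 e] := Mleft _ _ _ (PH i) (PH (ordS i)) cH.
  have e' : leftof (M (P i)) (M (P (ordS i))) (M c) =
      2 * radius_klein r * sin (a i) * radius_klein r * cos (a i).
    by rewrite Mc -/(Q _) -/(Q _) !Qa inscribedS// leftof_chord /=; ring.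
  have kk : 0 < 2 * radius_klein r * sin (a i) * radius_klein r.
    have sa := sin_gt0_pi (a0 i); rewrite mulr_gt0// mulr_gt0// mulr_gt0//.
  rewrite -cos_gt0_lt_pihalf// -cos_eq0_pihalf//; split.
    by rewrite -[RHS](pmulr_rgt0 _ kk) -e' e pmulr_rgt0.
  apply/eqP/eqP => [l0|c0].
    by apply: (mulfI (lt0r_neq0 kk)); rewrite mulr0 -e' e l0 mulr0.
  by apply: (mulfI (lt0r_neq0 k0)); rewrite mulr0 -e e' c0 mulr0.
- rewrite hareaE.
  have -> : earea (region P) = earea (region Q); last first.
    have -> : region Q = region (inscribed a t0 (radius_klein r)).
      by apply/seteqP; split => z H i; have := H i; rewrite ?Qa// -?Qa.
    by rewrite earea_inscribed.
  pose P' i := rot x y (P i).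
  transitivity (earea (region P')).
    apply: (earea_rot xy); first exact: measurable_region.
    by move=> z; split => H i; have := H i; rewrite /P' rot_leftof.
  apply: (earea_boost b1); [exact: measurable_region|exact: measurable_region|].
  move=> z zH; have H i : (0 <= leftof (Q i) (Q (ordS i)) (boost (- b) z)) =
      (0 <= leftof (P' i) (P' (ordS i)) z).
    have [k k0 ->] := boost_leftof b1 (rH _ (PH i)) (rH _ (PH (ordS i))) zH.
    by rewrite pmulr_rge0.
  by split => + i => /(_ i); rewrite H.
Qed.

Lemma inscribed_cyclic n (a : 'I_n -> R) (r : R) (d : n.-tuple R) :
  (3 <= n)%N -> 0 < r -> (forall i, 0 < a i < pi) -> \sum_i a i = pi ->
  (forall i, 0 <= tnth d i) -> (forall i, sh (tnth d i / 2) = sh r * sin (a i)) ->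
  cyclic_ngon (0, 0) r (inscribed a 0 (radius_klein r)) d.
Proof.
move=> n3 r0 a0 a_sum d0 da.
have rk := radius_klein_bound r0; have /andP[rk0 rk1] := rk.
split; first exact: convex_inscribed.
- split => //; first by rewrite /H2/= /dotp/= !mul0r addr0.
  by move=> i; apply/(hcircle0 _ r0); rewrite /inscribed dotp_ptxx.
- apply: eq_from_tnth => i; rewrite tnth_mktuple inscribedS//.
  have [h1 h2] := hdist_pt (0 + 2 * partial_angle a i) (0 + 2 * partial_angle a i + 2 * a i) r0.
  rewrite /inscribed -[LHS]chK// h1 -[RHS]chK// ch_half da; congr (arcosh (1 + 2 * _)).
  by rewrite !exprMn; congr (_ * _); rewrite -sqrrN -sinN; congr (sin _ ^+ 2); field.
Qed.

End moving_the_center.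

(** * Angles and areas as functions of the radius *)

Section chord_angles.
Context (R : realType).
Implicit Types (x s mu : R).

(* Half the angle subtended at the center by a chord of half-length arsh x in a
   circle of radius arsh s. *)
Definition ang x s : R := asc (x / s).

Lemma pi2_gt0 : 0 < pi / 2 :> R.
Proof. by rewrite divr_gt0// pi_gt0. Qed.

Lemma ang_ge0 x s : 0 <= x -> 0 < s -> 0 <= ang x s.
Proof. by move=> x0 s0; rewrite -[X in X <= _](@asc0 R) asc_le// divr_ge0// ltW. Qed.

Lemma ang_le x y s : 0 < s -> x <= y -> ang x s <= ang y s.
Proof. by move=> s0 xy; rewrite asc_le// ler_pM2r// invr_gt0. Qed.

Lemma ang_le_pihalf x s : ang x s <= pi / 2.
Proof. by have /andP[] := asc_bound (x / s). Qed.

Lemma ang_anti x s s' : 0 <= x -> 0 < s -> s <= s' -> ang x s' <= ang x s.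
Proof.
move=> x0 s0 ss; apply/asc_le/ler_wpM2l => //.
by rewrite lef_pV2 ?posrE// (lt_le_trans s0).
Qed.

Let ratio_bound x s : 0 <= x -> 0 < s -> x <= s -> -1 <= x / s <= 1.
Proof.
move=> x0 s0 xs; rewrite ler_pdivrMr// mul1r xs andbT.
by rewrite (@le_trans _ _ 0)// ?lerN10// divr_ge0// ltW.
Qed.

Lemma sin_ang x s : 0 < s -> 0 <= x <= s -> s * sin (ang x s) = x.
Proof.
move=> s0 /andP[x0 xs]; rewrite sin_asc ?ratio_bound//.
by rewrite mulrCA divff ?mulr1// lt0r_neq0.
Qed.

Lemma angK s f : 0 < s -> 0 <= f <= pi / 2 -> ang (s * sin f) s = f.
Proof.
move=> s0 f0; rewrite /ang mulrAC divff ?lt0r_neq0// mul1r ascK//.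
by have := pi2_gt0; lra.
Qed.

Lemma ang_lt x y s : 0 < s -> 0 <= x <= s -> 0 <= y <= s -> (ang x s < ang y s) = (x < y).
Proof.
move=> s0 /andP[x0 xs] /andP[y0 ys]; rewrite asc_lt ?ratio_bound//.
by rewrite ltr_pM2r// invr_gt0.
Qed.

Lemma ang_gt0 x s : 0 < x -> 0 < s -> 0 < ang x s.
Proof.
move=> x0 s0; have [xs|xs] := lerP x s.
  rewrite -[X in X < _](@asc0 R) -[X in asc X < _](mul0r s^-1) ang_lt ?lexx ?(ltW s0)//.
  by rewrite (ltW x0).
apply: (@lt_le_trans _ _ (asc 1)); first by rewrite asc1 pi2_gt0.
by apply: asc_le; rewrite ler_pdivlMr// mul1r ltW.
Qed.

Lemma ang_anti_lt x s s' : 0 < x -> x <= s -> s < s' -> ang x s' < ang x s.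
Proof.
move=> x0 xs ss; have s0 : 0 < s := lt_le_trans x0 xs.
have s'0 := lt_trans s0 ss.
rewrite asc_lt ?ratio_bound ?(ltW x0) ?(le_trans xs) ?(ltW ss)//.
by rewrite ltr_pM2l// ltf_pV2 ?posrE.
Qed.

Lemma angxx x : 0 < x -> ang x x = pi / 2.
Proof. by move=> x0; rewrite /ang divff ?asc1// lt0r_neq0. Qed.

Lemma ang_eq_pihalf x s : 0 <= x <= s -> 0 < s -> ang x s = pi / 2 -> x = s.
Proof. by move=> xs s0 e; rewrite -(sin_ang s0 xs) e sin_pihalf mulr1. Qed.

Lemma continuous_ang x s : 0 < s -> {for s, continuous (ang x)}.
Proof.
move=> s0; apply: (@continuous_comp _ _ _ (fun s : R => x / s) (@asc R)); last exact: continuous_asc.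
by apply: cvgMr; apply: cvgV; [exact: lt0r_neq0|exact: cvg_id].
Qed.

(* The angle at another radius; [rescale mu f] is subadditive for mu < 1. *)
Let rescale mu f : R := asc (mu * sin f).

Let mu_bound mu f : 0 < mu <= 1 -> 0 <= f <= pi / 2 -> 0 <= mu * sin f <= 1.
Proof.
move=> /andP[m0 m1] f0; have sf : 0 <= sin f <= 1.
  by rewrite sin_le1 andbT sin_ge0_pi//; have := pi2_gt0; lra.
by apply/andP; split; nra.
Qed.

Let rescale_bound mu f : 0 < mu <= 1 -> 0 <= f <= pi / 2 -> 0 <= rescale mu f <= f.
Proof.
move=> m f0; have /andP[b0 b1] := mu_bound m f0; have p0 := pi2_gt0.
have sf : 0 <= sin f by rewrite sin_ge0_pi//; lra.
rewrite -[X in X <= _](@asc0 R) asc_le//=.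
rewrite -[leRHS](@ascK R f); last lra.
by apply: asc_le; case/andP: m => ? ?; nra.
Qed.

Let rescale_le mu f f' : 0 < mu <= 1 -> 0 <= f -> f <= f' -> f' <= pi / 2 ->
  rescale mu f <= rescale mu f'.
Proof.
move=> m f0 ff f1; apply: asc_le; rewrite ler_pM2l; last by case/andP: m.
have p0 := pi2_gt0.
by rewrite leNgt ltr_sin -?leNgt// in_itv/=; apply/andP; split; lra.
Qed.

(** Rescaling shrinks angles, hence increases their cosines. So the addition formula for the
    rescaled angles dominates [mu * sin (f + f')] term by term. *)
Let rescaleD mu f f' : 0 < mu < 1 -> 0 <= f -> 0 <= f' -> f + f' <= pi / 2 ->
  rescale mu (f + f') <= rescale mu f + rescale mu f' /\
  (0 < f -> 0 < f' -> rescale mu (f + f') < rescale mu f + rescale mu f').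
Proof.
move=> m f0 f'0 ff; have p0 := pi2_gt0.
have m' : 0 < mu <= 1 by lra.
have fb : 0 <= f <= pi / 2 by lra.
have fb' : 0 <= f' <= pi / 2 by lra.
have /andP[b0 b1] := mu_bound m' fb; have /andP[b0' b1'] := mu_bound m' fb'.
have /andP[r0 r1] := rescale_bound m' fb; have /andP[r0' r1'] := rescale_bound m' fb'.
have s1 : sin (rescale mu f) = mu * sin f by rewrite sin_asc//; lra.
have s2 : sin (rescale mu f') = mu * sin f' by rewrite sin_asc//; lra.
have sf : 0 <= sin f by rewrite sin_ge0_pi//; lra.
have sf' : 0 <= sin f' by rewrite sin_ge0_pi//; lra.
have c1 : cos f <= cos (rescale mu f).
  by rewrite leNgt ltr_cos -?leNgt// in_itv/=; apply/andP; split; lra.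
have c2 : cos f' <= cos (rescale mu f').
  by rewrite leNgt ltr_cos -?leNgt// in_itv/=; apply/andP; split; lra.
have ab : - (pi / 2) <= rescale mu f + rescale mu f' <= pi / 2 by lra.
case/andP: (m) => m0 m1.
have h2 : mu * (cos f * sin f') <= cos (rescale mu f) * (mu * sin f').
  by rewrite mulrCA; apply: ler_wpM2r => //; rewrite mulr_ge0// ltW.
have key : mu * sin (f + f') <= sin (rescale mu f + rescale mu f').
  have h1 : mu * sin f * cos f' <= mu * sin f * cos (rescale mu f').
    by apply: ler_wpM2l => //; apply: mulr_ge0 => //; exact: ltW.
  by rewrite !sinD s1 s2 mulrDr [X in X + _ <= _]mulrA lerD.
split; first by rewrite -[leRHS](ascK ab) asc_le.
move=> f00 f00'.
have c2' : cos f' < cos (rescale mu f').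
  rewrite ltr_cos ?in_itv/=; [|lra|lra].
  rewrite lt_neqAle r1' andbT; apply/eqP => e.
  have := s2; rewrite e => /eqP; rewrite -[X in X == _]mul1r -subr_eq0 -mulrBl mulf_eq0.
  have : 0 < sin f' by rewrite sin_gt0_pi//; lra.
  by move=> /lt0r_neq0/negbTE ->; rewrite orbF subr_eq0 => /eqP; lra.
rewrite -[ltRHS](ascK ab) asc_lt; last 2 first.
- have ffb : 0 <= f + f' <= pi / 2 by lra.
  by have /andP[? ?] := mu_bound m' ffb; lra.
- by rewrite sin_le1 andbT sin_geN1.
have sfp : 0 < sin f by rewrite sin_gt0_pi//; lra.
have h1 : mu * sin f * cos f' < mu * sin f * cos (rescale mu f').
  by rewrite ltr_pM2l// mulr_gt0.
by rewrite !sinD s1 s2 mulrDr [X in X + _ < _]mulrA ltr_leD.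
Qed.

Let rescale_sum mu (I : Type) (r : seq I) (P : pred I) (f : I -> R) : 0 < mu < 1 ->
  (forall i, P i -> 0 <= f i) -> \sum_(i <- r | P i) f i <= pi / 2 ->
  rescale mu (\sum_(i <- r | P i) f i) <= \sum_(i <- r | P i) rescale mu (f i).
Proof.
move=> m f0; have s0 q : 0 <= \sum_(i <- q | P i) f i by rewrite sumr_ge0.
elim: r => [|i r IH]; first by rewrite !big_nil /rescale sin0 mulr0 asc0.
rewrite !big_cons; case: ifP => // Pi le.
have [+ _] := rescaleD m (f0 _ Pi) (s0 r) le; move=> /le_trans; apply.
by rewrite lerD2l IH//; have := f0 _ Pi; have := s0 r; lra.
Qed.

(** Going from radius s1 to s2 multiplies the sine of every half-angle by s1 / s2 < 1, a strictly
    subadditive operation on angles. Hence the excess of the other angles over the longest one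
    changes sign at most once, from negative to positive. This one fact gives uniqueness of radii,
    minimality of true radii and the direction of the deformation. *)
Lemma ang_cross (I : eqType) (r : seq I) (P : pred I) (x : I -> R) x0 s1 s2 :
  0 < x0 -> x0 <= s1 -> s1 < s2 -> (forall i, P i -> 0 <= x i < x0) ->
  ang x0 s1 <= \sum_(i <- r | P i) ang (x i) s1 ->
  ang x0 s2 < \sum_(i <- r | P i) ang (x i) s2.
Proof.
move=> x00 xs1 s12 xP le; have s10 := lt_le_trans x00 xs1; have s20 := lt_trans s10 s12.
pose mu := s1 / s2.
have m : 0 < mu < 1 by rewrite divr_gt0//= ltr_pdivrMr// mul1r.
have m' : 0 < mu <= 1 by lra.
have xs i : P i -> 0 <= x i <= s1 by move=> /xP; lra.
have kE y : 0 <= y <= s1 -> ang y s2 = rescale mu (ang y s1).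
  move=> ys; rewrite /rescale -[in LHS](sin_ang s10 ys) /ang /mu.
  by congr asc; rewrite mulrAC.
pose S := \sum_(i <- r | P i) ang (x i) s1.
have b00 : 0 < ang x0 s1 by exact: ang_gt0.
have S0 : 0 < S := lt_le_trans b00 le.
(* Shrinking the angles by the factor [th] makes them add up to exactly [ang x0 s1], which is at
   most pi/2 as subadditivity requires. *)
pose th := ang x0 s1 / S.
have th0 : 0 < th by rewrite divr_gt0.
have th1 : th <= 1 by rewrite ler_pdivrMr// mul1r.
pose t i := th * ang (x i) s1.
have tS : \sum_(i <- r | P i) t i = ang x0 s1 by rewrite -mulr_sumr -/S /th divfK// lt0r_neq0.
have a0 i : P i -> 0 <= ang (x i) s1 by move=> /xs /andP[? _]; exact: ang_ge0.
have t0 i : P i -> 0 <= t i by move=> Pi; rewrite mulr_ge0 ?(ltW th0)// a0.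
have tk i : P i -> rescale mu (t i) <= ang (x i) s2.
  move=> Pi; rewrite kE ?xs//; apply: rescale_le => //; first exact: t0.
    by rewrite /t ler_piMl// a0.
  exact: ang_le_pihalf.
have tlt i : P i -> t i < ang x0 s1.
  move=> Pi; apply: (@le_lt_trans _ _ (ang (x i) s1)); first by rewrite /t ler_piMl// a0.
  by rewrite ang_lt ?xs ?(ltW x00)//; case/andP: (xP _ Pi).
(* Strictness requires two positive summands: one is [t i], and the rest is positive because no
   single [t i] reaches the total. *)
have [i /andP[ir Pi] ti] : exists2 i, (i \in r) && P i & 0 < t i.
  apply: contrapT => H; move: b00; rewrite -tS big_seq_cond big1 ?ltxx// => i iP.
  apply/eqP; rewrite eq_le t0 ?andbT; last by case/andP: iP.
  by rewrite leNgt; apply/negP => ti; apply: H; exists i.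
rewrite kE ?(ltW x00)// -tS (big_rem i)//= Pi.
rewrite [ltRHS](big_rem i)//= Pi.
have rest0 : 0 < \sum_(y <- rem i r | P y) t y.
  by move: tS (tlt _ Pi); rewrite (big_rem i)//= Pi; lra.
have rle : t i + \sum_(y <- rem i r | P y) t y <= pi / 2.
  by have := ang_le_pihalf x0 s1; rewrite -tS (big_rem i)//= Pi.
have [_ /(_ ti rest0)] := rescaleD m (ltW ti) (ltW rest0) rle.
move=> /lt_le_trans; apply; apply: lerD; first exact: tk.
apply: le_trans (ler_sum _ (fun j Pj => tk j Pj)).
by apply: rescale_sum => //; lra.
Qed.

End chord_angles.

(** * The corrected area and its monotonicity in the radius *)

Section area_function.
Context (R : realType).
Implicit Types (x s : R).

(* The complement of the base angle of the isosceles triangle with half-apex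
   ang x s, whose area is therefore 2 (psi x s - ang x s). *)
Definition psi x s : R := asc (x * Num.sqrt (1 + s ^+ 2) / (s * Num.sqrt (1 + x ^+ 2))).
Definition kap s : R := (Num.sqrt (1 + s ^+ 2))^-1.

(* Legendre-type correction of the triangle area by the apex angle, chosen so
   that its derivative in s is a multiple of the angle itself. *)
Definition gfun x s : R := psi x s - kap s * ang x s.

Let q1 (x : R) : 0 < 1 + x ^+ 2. Proof. by have := sqr_ge0 x; lra. Qed.

Let sq1 (x : R) : Num.sqrt (1 + x ^+ 2) != 0.
Proof. by rewrite lt0r_neq0// sqrtr_gt0. Qed.

Let sqE (x : R) : Num.sqrt (1 + x ^+ 2) ^+ 2 = 1 + x ^+ 2.
Proof. by rewrite sqr_sqrtr// ltW. Qed.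

Let is_derive_sqrt1 s : is_derive s 1 (fun s : R => Num.sqrt (1 + s ^+ 2)) (s / Num.sqrt (1 + s ^+ 2)).
Proof.
have dg : is_derive s 1 (fun y : R => 1 + y ^+ 2) (2 * s).
  by apply: is_derive_eq; rewrite /GRing.scale/=; ring.
by apply: (derive_comp dg (is_derive1_sqrt (q1 s))); field.
Qed.

Lemma is_derive_kap s : is_derive s 1 kap (- (s / Num.sqrt (1 + s ^+ 2) ^+ 3)).
Proof. by apply: (derive_inv (is_derive_sqrt1 s) (sq1 s)); field. Qed.

(** For a fixed chord the derivative of [psi] is [kap] times that of [ang]. These terms cancel and
    only - kap' times [ang] remains. *)
Lemma is_derive_gfun x s : 0 <= x < s ->
  is_derive s 1 (gfun x) (s / Num.sqrt (1 + s ^+ 2) ^+ 3 * ang x s).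
Proof.
move=> /andP[x0 xs]; have s0 : 0 < s := le_lt_trans x0 xs; have sn := lt0r_neq0 s0.
have p0 : 0 < s ^+ 2 - x ^+ 2 by nra.
have pn : Num.sqrt (s ^+ 2 - x ^+ 2) != 0 by rewrite lt0r_neq0// sqrtr_gt0.
have d1 : is_derive s 1 (fun s : R => x / s) (- (x / s ^+ 2)).
  by apply: (derive_mul (is_derive_cst x s 1) (derive_inv (is_derive_id s 1) sn erefl)); rewrite /=; field.
have b1 : -1 < x / s < 1.
  by rewrite ltr_pdivrMr// mul1r xs andbT (@lt_le_trans _ _ 0)// ?ltrN10// divr_ge0// ltW.
have dang : is_derive s 1 (ang x) (- (x / (s * Num.sqrt (s ^+ 2 - x ^+ 2)))).
  apply: (derive_comp d1 (is_derive_asc b1)).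
  have -> : 1 - (x / s) ^+ 2 = (s ^+ 2 - x ^+ 2) * (s^-1) ^+ 2 by field.
  rewrite sqrtrM ?(ltW p0)// sqrtr_sqr ger0_norm ?invr_ge0 ?(ltW s0)//.
  by field; rewrite sn pn.
set c := Num.sqrt (1 + s ^+ 2); set e := Num.sqrt (1 + x ^+ 2).
set p := Num.sqrt (s ^+ 2 - x ^+ 2).
have cn : c != 0 := sq1 s; have en : e != 0 := sq1 x.
have cE : c ^+ 2 = 1 + s ^+ 2 := sqE s; have eE : e ^+ 2 = 1 + x ^+ 2 := sqE x.
have d3 : is_derive s 1 (fun s : R => x * Num.sqrt (1 + s ^+ 2)) (x * s / c).
  by apply: (derive_mul (is_derive_cst x s 1) (is_derive_sqrt1 s)); rewrite /= /c; field.
have d4 : is_derive s 1 (fun s : R => s * Num.sqrt (1 + x ^+ 2)) e.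
  by apply: (derive_mul (is_derive_id s 1) (is_derive_cst e s 1)); rewrite /=; ring.
have d5 : is_derive s 1 (fun s : R => x * Num.sqrt (1 + s ^+ 2) / (s * Num.sqrt (1 + x ^+ 2)))
    (- (x / (s ^+ 2 * c * e))).
  apply: (derive_mul d3 (derive_inv d4 (mulf_neq0 sn en) erefl)); rewrite /= -/c -/e.
  transitivity (- (x * (c ^+ 2 - s ^+ 2) / (s ^+ 2 * c * e))); first by field; rewrite cn en sn.
  by rewrite cE addrK mulr1.
have wE : 1 - (x * c / (s * e)) ^+ 2 = (s ^+ 2 - x ^+ 2) * ((s * e)^-1) ^+ 2.
  by rewrite !exprMn exprVn !exprMn cE eE; field; rewrite sn/= lt0r_neq0.
have w0 : 0 < 1 - (x * c / (s * e)) ^+ 2.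
  by rewrite wE mulr_gt0// exprn_gt0// invr_gt0 mulr_gt0// sqrtr_gt0.
have w1 : -1 < x * c / (s * e) < 1.
  by move: w0; set w := _ / _ => w0; apply/andP; split; nra.
have dpsi : is_derive s 1 (psi x) (- (x / (s * c * p))).
  apply: (derive_comp d5 (is_derive_asc w1)).
  rewrite wE sqrtrM ?(ltW p0)// sqrtr_sqr ger0_norm; last first.
    by rewrite invr_ge0 mulr_ge0 ?(ltW s0)// sqrtr_ge0.
  by rewrite -/p; field; rewrite sn cn en pn.
have dka := derive_mul (is_derive_kap s) dang erefl.
have := is_deriveB dpsi dka; move=> H; apply: is_derive_eq; rewrite -/c -/p /kap -/c.
by field; rewrite cn sn pn.
Qed.

Lemma continuous_gfun x s : 0 < s -> {for s, continuous (gfun x)}.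
Proof.
move=> s0; have sn := lt0r_neq0 s0.
have cc : {for s, continuous (fun s : R => Num.sqrt (1 + s ^+ 2))}.
  exact: is_derive_continuous (is_derive_sqrt1 s).
apply: cvgB.
  apply: (@continuous_comp _ _ _ (fun s : R => x * Num.sqrt (1 + s ^+ 2) / (s * Num.sqrt (1 + x ^+ 2)))
    (@asc R)); last exact: continuous_asc.
  apply: cvgM; first exact: cvgMr.
  by apply: cvgV; [exact: mulf_neq0|apply: cvgMl; exact: cvg_id].
by apply: cvgM; [exact: cvgV|exact: continuous_ang].
Qed.

Section combination.
Variables (I : Type) (r : seq I) (P : pred I) (e x : I -> R) (C : R).

(** The derivative [D] is a positive multiple of the angle defect, so monotonicity of [F] is read
    off the angles alone. The constant [C] allows comparison with a prescribed angle. *)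
Let F (s : R) : R := \sum_(i <- r | P i) e i * gfun (x i) s + C * kap s.
Let D (s : R) : R := s / Num.sqrt (1 + s ^+ 2) ^+ 3 * (\sum_(i <- r | P i) e i * ang (x i) s - C).

Let F_derive s : (forall i, P i -> 0 <= x i < s) -> is_derive s 1 F (D s).
Proof.
move=> xs.
have dS q : is_derive s 1 (fun s => \sum_(i <- q | P i) e i * gfun (x i) s)
    (s / Num.sqrt (1 + s ^+ 2) ^+ 3 * \sum_(i <- q | P i) e i * ang (x i) s).
  elim: q => [|i q IH].
    rewrite big_nil mulr0 (_ : (fun _ => _) = cst 0); first exact: is_derive_cst.
    by apply/funext => u; rewrite big_nil.
  have [Pi|Pi] := boolP (P i); last first.
    rewrite big_cons (negbTE Pi) (_ : (fun _ => _) = (fun s => \sum_(i <- q | P i) e i * gfun (x i) s))//.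
    by apply/funext => u; rewrite big_cons (negbTE Pi).
  rewrite big_cons Pi (_ : (fun _ => _) = (fun s => e i * gfun (x i) s) \+
      (fun s => \sum_(i <- q | P i) e i * gfun (x i) s)); last first.
    by apply/funext => u; rewrite big_cons Pi.
  have d1 := derive_mul (is_derive_cst (e i) s 1) (is_derive_gfun (xs _ Pi)) erefl.
  by have H := is_deriveD d1 IH; apply: is_derive_eq; rewrite /=; ring.
have dk := derive_mul (is_derive_cst C s 1) (is_derive_kap s) erefl.
by have H := is_deriveD (dS r) dk; apply: is_derive_eq; rewrite /D/=; ring.
Qed.

Let F_continuous s : 0 < s -> {for s, continuous F}.
Proof.
move=> s0; apply: cvgD; last first.
  by apply: cvgMr; exact: is_derive_continuous (is_derive_kap s).
elim: r => [|i q IH].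
  rewrite big_nil (_ : (fun _ => _) = cst 0); first exact: cvg_cst.
  by apply/funext => u; rewrite big_nil.
have [Pi|Pi] := boolP (P i); last first.
  rewrite big_cons (negbTE Pi) (_ : (fun _ => _) = (fun s => \sum_(i <- q | P i) e i * gfun (x i) s))//.
  by apply/funext => u; rewrite big_cons (negbTE Pi).
rewrite big_cons Pi (_ : (fun _ => _) = (fun s => e i * gfun (x i) s) \+
    (fun s => \sum_(i <- q | P i) e i * gfun (x i) s)); last first.
  by apply/funext => u; rewrite big_cons Pi.
by apply: cvgD => //; apply: cvgMr; exact: continuous_gfun.
Qed.

Variables (s1 s2 : R).
Hypotheses (s10 : 0 < s1) (s12 : s1 < s2) (xs1 : forall i, P i -> 0 <= x i <= s1).

Let xin s i : s \in `]s1, s2[ -> P i -> 0 <= x i < s.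
Proof. by rewrite in_itv/= => ss /xs1; lra. Qed.

Let within_F : {within `[s1, s2], continuous F}.
Proof.
apply: continuous_in_subspaceT => s; rewrite inE/= in_itv/= => /andP[ss _].
exact: F_continuous (lt_le_trans s10 ss).
Qed.

Let derivable_F s : s \in `]s1, s2[ -> derivable F s 1.
Proof. by move=> ss; have [] := F_derive (fun i => xin ss (i := i)). Qed.

Let derive_F s : s \in `]s1, s2[ -> derive1 F s = D s.
Proof. by move=> ss; rewrite derive1E; have [_ ->] := F_derive (fun i => xin ss (i := i)). Qed.

Let coef_gt0 s : s \in `]s1, s2[ -> 0 < s / Num.sqrt (1 + s ^+ 2) ^+ 3.
Proof.
rewrite in_itv/= => /andP[ss _]; apply: divr_gt0; first exact: lt_trans ss.
by rewrite exprn_gt0// sqrtr_gt0.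
Qed.

Lemma gfun_sum_le :
  (forall s, s1 < s < s2 -> C <= \sum_(i <- r | P i) e i * ang (x i) s) -> F s1 <= F s2.
Proof.
move=> H; apply: (@ger0_derive1_ndecr _ F s1 s2) => //; rewrite ?lexx ?(ltW s12)//.
move=> s ss; rewrite derive_F// mulr_ge0 ?(ltW (coef_gt0 ss))// subr_ge0 H//.
Qed.

Lemma gfun_sum_lt :
  (forall s, s1 < s < s2 -> C < \sum_(i <- r | P i) e i * ang (x i) s) -> F s1 < F s2.
Proof.
move=> H; apply: (@gtr0_derive1_incr _ F s1 s2) => //; rewrite ?lexx//.
move=> s ss; rewrite derive_F// mulr_gt0 ?coef_gt0// subr_gt0 H//.
Qed.

End combination.

(** Regarded as a function of - kap, [gfun x] has slope [ang x], which decreases with the radius. So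
    the increment is at least the final slope times the increment of - kap. *)
Lemma gfun_chord (x s1 s2 : R) : 0 <= x <= s1 -> 0 < s1 -> s1 <= s2 ->
  ang x s2 * (kap s1 - kap s2) <= gfun x s2 - gfun x s1.
Proof.
move=> xs s10; rewrite le_eqVlt => /predU1P[<-|s12]; first by rewrite !subrr mulr0.
have := @gfun_sum_le unit [:: tt] xpredT (fun=> 1) (fun=> x) (ang x s2) s1 s2 s10 s12 (fun _ _ => xs).
rewrite !big_seq1 !mul1r => H.
suff : gfun x s1 + ang x s2 * kap s1 <= gfun x s2 + ang x s2 * kap s2 by lra.
apply: H => s ss; rewrite big_seq1 mul1r; apply: ang_anti; lra.
Qed.

(** The derivative of the difference is a positive multiple of [ang x s - ang x' s]. With s1 and s2
    the radii at the two ends of an edge, this is monotonicity of its contribution in the edge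
    length. *)
Lemma gfun_diff_le (x x' s1 s2 : R) : 0 <= x' -> x' <= x -> x <= s1 -> 0 < s1 -> s1 <= s2 ->
  gfun x s1 - gfun x' s1 <= gfun x s2 - gfun x' s2.
Proof.
move=> x'0 xx xs s10; rewrite le_eqVlt => /predU1P[<-//|s12].
have bP (b : bool) : true -> 0 <= (if b then x else x') <= s1 by case: b => _; lra.
have := @gfun_sum_le bool [:: true; false] xpredT (fun b => if b then 1 else -1)
  (fun b => if b then x else x') 0 s1 s2 s10 s12 bP.
rewrite !big_cons !big_nil !mul1r !mulN1r !addr0 !mul0r !addr0; apply=> s ss.
rewrite !big_cons !big_nil mul1r mulN1r addr0 subr_ge0; apply: ang_le => //; lra.
Qed.

(** By [ang_cross] the signed angle sum is negative at radii below s and positive above, so s is the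
    strict minimum. *)
Lemma gfun_noncentered (I : eqType) (r : seq I) (P : pred I) (x : I -> R) (x0 s s' : R) :
  0 < x0 -> x0 <= s -> x0 <= s' -> s != s' -> (forall i, P i -> 0 <= x i < x0) ->
  \sum_(i <- r | P i) ang (x i) s = ang x0 s ->
  \sum_(i <- r | P i) gfun (x i) s - gfun x0 s < \sum_(i <- r | P i) gfun (x i) s' - gfun x0 s'.
Proof.
move=> x00 xs xs' ss xP e.
(* [None] stands for the longest side, adjoined with the opposite sign so that the signed
   combination is a single sum. *)
pose y (i : option I) := if i is Some i then x i else x0.
pose Q (i : option I) := if i is Some i then P i else true.
have E (f : R -> R) : \sum_(i <- r | P i) f (x i) - f x0 =
    \sum_(i <- None :: map Some r | Q i) (if i then 1 else -1) * f (y i).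
  rewrite big_cons /= mulN1r big_map addrC; congr (_ + _).
  by apply: eq_bigr => i _; rewrite mul1r.
have E' (f : R -> R) : \sum_(i <- r | P i) f (x i) - f x0 =
    - \sum_(i <- None :: map Some r | Q i) (if i then -1 else 1) * f (y i).
  rewrite E -sumrN; apply: eq_bigr => -[i|] _ /=; ring.
have yP t : x0 <= t -> forall i, Q i -> 0 <= y i <= t by move=> xt [i /xP|] /=; lra.
have s0 : 0 < s by lra.
have s'0 : 0 < s' by lra.
case: (ltgtP s s') ss => // [lt _|lt _].
  rewrite (E (gfun^~ s)) (E (gfun^~ s')).
  have := @gfun_sum_lt _ (None :: map Some r) Q (fun i => if i then 1 else -1) y 0 s s' s0 lt (yP _ xs).
  rewrite !mul0r !addr0; apply=> t tt; rewrite -(E (fun u => ang u t)) subr_gt0.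
  by apply: (@ang_cross _ _ r P x x0 s t) => //; [lra|rewrite e].
rewrite (E' (gfun^~ s)) (E' (gfun^~ s')) ltrN2.
have := @gfun_sum_lt _ (None :: map Some r) Q (fun i => if i then -1 else 1) y 0 s' s s'0 lt (yP _ xs').
rewrite !mul0r !addr0; apply=> t tt.
rewrite -oppr_lt0 -(E' (fun u => ang u t)) subr_lt0 ltNge; apply/negP => le.
have xt : x0 <= t by lra.
have ts : t < s by lra.
by have := ang_cross x00 xt ts xP le; rewrite e ltxx.
Qed.

End area_function.

(** * Radius and area from the side lengths *)

Section characterization.
Context (R : realType) (n : nat).
Implicit Types (d : n.-tuple R) (i j : 'I_n) (s : R).

Definition half_side d i : R := sh (tnth d i / 2).

Definition half_angles d s (a : 'I_n -> R) :=
  [/\ forall i, 0 < a i < pi, \sum_i a i = pi & forall i, half_side d i = s * sin (a i)].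

(** Weak inequality: the semicyclic case, where some half-side equals s, is included. *)
Definition centered d s :=
  [/\ 0 < s, forall i, half_side d i <= s & \sum_i ang (half_side d i) s = pi].

(** The semicyclic case is included here too, as [half_side d i0 = s]; it is the overlap with
    [centered]. *)
Definition noncentered d i0 s :=
  [/\ 0 < half_side d i0, half_side d i0 <= s,
      forall i, i != i0 -> half_side d i < half_side d i0 &
      \sum_(i | i != i0) ang (half_side d i) s = ang (half_side d i0) s].

Lemma sum_ang_anti_lt (P : pred 'I_n) d s s' : (exists i, P i) -> s < s' ->
  (forall i, P i -> 0 < half_side d i <= s) ->
  \sum_(i | P i) ang (half_side d i) s' < \sum_(i | P i) ang (half_side d i) s.
Proof.
move=> [i Pi] ss H; rewrite (bigD1 i)//= [ltRHS](bigD1 i)//= ltr_leD//.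
  by have /andP[? ?] := H _ Pi; exact: ang_anti_lt.
apply: ler_sum => j /andP[/H /andP[h0 h1] _]; apply: ang_anti => //; [exact: ltW|lra|exact: ltW].
Qed.

Section given_sides.
Variable d : n.-tuple R.
Hypotheses (n3 : (3 <= n)%N) (d0 : forall i, 0 < half_side d i).
Let x i := half_side d i.

Let other_indices i : exists j k, [/\ j != i, k != i & j != k].
Proof.
pose o (k : nat) (kn : (k < 3)%N) : 'I_n := Ordinal (leq_trans kn n3).
pose o0 := o 0%N isT; pose o1 := o 1%N isT; pose o2 := o 2%N isT.
have [->|i0] := eqVneq i o0; first by exists o1, o2.
have [->|i1] := eqVneq i o1; first by exists o0, o2.
by exists o0, o1; rewrite eq_sym i0 eq_sym i1.
Qed.

Let x_lt0 i s : 0 < s -> 0 < ang (x i) s. Proof. by move=> ?; apply: ang_gt0 => //; exact: d0. Qed.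

Let ang_pi x' s : 0 < x' -> 0 < s -> 0 < ang x' s < pi.
Proof.
by move=> x0 s0; rewrite ang_gt0//=; have := ang_le_pihalf x' s; have := pi2_gt0 R; lra.
Qed.

(** The half-angles add up to pi, so at most one exceeds pi/2, and the arcsine recovers all the
    others from the sides. An exceptional one is pi minus its arcsine. *)
Lemma half_angles_cases s a : 0 < s -> half_angles d s a ->
  ([/\ centered d s, forall i, a i <= pi / 2 & forall i, a i = ang (x i) s]) \/
  exists i0, [/\ noncentered d i0 s, x i0 < s, pi / 2 < a i0, a i0 = pi - ang (x i0) s &
    forall i, i != i0 -> a i = ang (x i) s /\ a i <= pi / 2].
Proof.
move=> s0 [a0 a_sum xa]; have p0 := pi2_gt0 R.
have small i : a i <= pi / 2 -> a i = ang (x i) s.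
  by move=> ai; rewrite /x xa angK//; have := a0 i; lra.
have [all|/existsNP[i0 /negP]] := pselect (forall i, a i <= pi / 2).
  left; split => // [|i]; last exact: small.
  split => // [i|]; last by rewrite -a_sum; apply: eq_bigr => i _; rewrite -small.
  by rewrite xa ler_piMr ?(ltW s0)// sin_le1.
rewrite -ltNge => ai0; right; exists i0.
have others i : i != i0 -> a i < pi / 2.
  move=> ii0; have := a_sum; rewrite (bigD1 i0)//= (bigD1 i)//=.
  have : 0 <= \sum_(j | (j != i0) && (j != i)) a j.
    by apply: sumr_ge0 => j _; case/andP: (a0 j) => /ltW.
  lra.
have big : a i0 = pi - ang (x i0) s.
  have -> : x i0 = s * sin (pi - a i0).
    rewrite /x xa; congr (_ * _).
    by rewrite sinB sinpi cospi mul0r sub0r mulN1r opprK.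
  by rewrite angK; [ring|done|have := a0 i0; lra].
have xs : x i0 < s.
  rewrite /x xa gtr_pMr// -sin_pihalf.
  have -> : sin (a i0) = sin (pi - a i0) by rewrite sinB sinpi cospi mul0r sub0r mulN1r opprK.
  by have /andP[? ?] := a0 i0; rewrite ltr_sin ?in_itv/=; [lra|apply/andP; split; lra|apply/andP; split; lra].
have sumE : \sum_(i | i != i0) ang (x i) s = ang (x i0) s.
  have <- : \sum_(i | i != i0) a i = \sum_(i | i != i0) ang (x i) s.
    by apply: eq_bigr => i ii0; apply: small; exact: ltW (others _ ii0).
  by have := a_sum; rewrite (bigD1 i0)//=; lra.
split => //; last by move=> i ii0; have := others _ ii0 => /ltW ?; split => //; exact: small.
split => // [|i ii0]; first exact: ltW.
(* A third side, available since n is at least 3, makes the angle of the longest side strictly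
   larger than that of side i. *)
have [j [k [ji ki jk]]] := other_indices i0.
have [l [li0 lNi]] : exists l, l != i0 /\ l != i.
  have [e|ji'] := eqVneq j i; last by exists j.
  by exists k; rewrite ki -e eq_sym jk.
have xis : x i <= s by rewrite /x xa ler_piMr ?(ltW s0)// sin_le1.
rewrite -(ang_lt s0) ?xis ?(ltW (d0 _)) ?(ltW xs)//.
rewrite -/(x i) -/(x i0) -sumE (bigD1 i)//= ltrDl (bigD1 l)/=; last by rewrite li0.
apply: ltr_pwDl; first exact: x_lt0.
by apply: sumr_ge0 => m _; exact: ltW (x_lt0 _ s0).
Qed.

Lemma centered_half_angles s : centered d s -> half_angles d s (fun i => ang (x i) s).
Proof.
move=> [s0 xs e]; split => // i; first exact: ang_pi.
by rewrite sin_ang// xs ltW// d0.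
Qed.

Lemma noncentered_half_angles i0 s : noncentered d i0 s ->
  half_angles d s (fun i => if i == i0 then pi - ang (x i) s else ang (x i) s).
Proof.
move=> [x0 xs lt e]; have s0 := lt_le_trans x0 xs.
have sinA i : x i <= s -> x i = s * sin (ang (x i) s).
  by move=> xi; rewrite sin_ang// xi ltW// d0.
split.
- by move=> i; have := ang_pi (d0 i) s0; case: ifP => _ //; rewrite /x; lra.
- rewrite (bigD1 i0)//= eqxx (eq_bigr (fun i => ang (x i) s)); last by move=> i /negbTE ->.
  by rewrite e subrK.
- move=> i; case: eqVneq => [->|ii0].
    rewrite sinB sinpi cospi mul0r sub0r mulN1r opprK; exact: sinA.
  by apply: sinA; apply: le_trans xs; exact: ltW (lt _ ii0).
Qed.

Let i_ex : exists i : 'I_n, true. Proof. by exists (Ordinal (ltnW (ltnW n3))). Qed.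

Lemma centered_inj s s' : centered d s -> centered d s' -> s = s'.
Proof.
wlog lt : s s' / s < s' => [H c c'|[s0 xs e] [s'0 xs' e']].
  by case: (ltgtP s s') => // l; [exact: H|apply/esym; exact: H].
have := @sum_ang_anti_lt xpredT d s s' i_ex lt.
rewrite e e' ltxx => H; exfalso; suff : false by []; apply: H => i _.
by rewrite d0 xs.
Qed.

Lemma noncentered_inj i0 i1 s s' : noncentered d i0 s -> noncentered d i1 s' ->
  i0 = i1 /\ s = s'.
Proof.
move=> N0 N1; have ii : i0 = i1.
  have [_ _ l0 _] := N0; have [_ _ l1 _] := N1; have [//|ne] := eqVneq i0 i1.
  by have := lt_trans (l1 _ ne) (l0 i1 _); rewrite eq_sym ne ltxx => /(_ isT).
split => //; rewrite -{}ii in N1.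
wlog lt : s s' N0 N1 / s < s' => [H|].
  by case: (ltgtP s s') => // l; [exact: H|apply/esym; exact: H].
have [x0 xs l0 e] := N0; have [_ xs' _ e'] := N1.
have := @ang_cross _ _ (index_enum 'I_n) (fun i => i != i0) (half_side d) (half_side d i0) s s' x0 xs lt.
rewrite e e' lexx ltxx => H; exfalso; suff : false by []; apply: H => // i /l0 ->.
by rewrite ltW// d0.
Qed.

(** At a centered radius the sides other than i0 have angle sum pi - ang, at least pi/2. Then s < s'
    contradicts [ang_cross], and s' < s contradicts monotonicity of the angles. At equal radii the
    angle of i0 must be pi/2. *)
Lemma centered_noncentered i0 s s' : centered d s -> noncentered d i0 s' ->
  s = s' /\ x i0 = s.
Proof.
move=> [s0 xs e] [x0 xs' l0 e'].
have p0 := pi2_gt0 R; have s'0 := lt_le_trans x0 xs'.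
have eN : \sum_(i | i != i0) ang (x i) s = pi - ang (x i0) s.
  by have := e; rewrite (bigD1 i0)//= /x; lra.
have h1 := ang_le_pihalf (x i0) s; have h2 := ang_le_pihalf (x i0) s'.
have ss : s = s'.
  case: (ltgtP s s') => // lt.
    have := @ang_cross _ _ (index_enum 'I_n) (fun i => i != i0) (half_side d) (half_side d i0) s s' x0 (xs i0) lt.
    rewrite e' ltxx -/(x _) eN => H; exfalso; suff : false by [].
    by apply: H; [move=> i /l0 ->; rewrite ltW// d0|rewrite /x; lra].
  have [j [_ [ji _ _]]] := other_indices i0.
  have := @sum_ang_anti_lt (fun i => i != i0) d s' s (ex_intro _ j ji) lt.
  rewrite e' -/(x _) eN => H; exfalso.
  suff : pi - ang (x i0) s < ang (x i0) s' by lra.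
  by apply: H => i /l0 l; rewrite d0 ltW// (lt_le_trans l).
split => //; apply: ang_eq_pihalf => //; first by rewrite xs ltW// d0.
by have := eN; rewrite [in LHS]ss e' -ss /x; lra.
Qed.

End given_sides.
End characterization.

(** * Base angles in terms of chord and radius *)

Section half_apex_psi.
Context (R : realType).

(** The arguments v and w of the two arcsines satisfy v^2 + w^2 = 1, so the arcsines are
    complementary when w is nonnegative. For an obtuse half-angle w is negative, whence the
    reflection in pi. *)
Lemma half_apex_psi (r a : R) : 0 < r -> 0 < a < pi ->
  half_apex (radius_klein r) a =
  if a <= pi / 2 then psi (sh r * sin a) (sh r) else pi - psi (sh r * sin a) (sh r).
Proof.
move=> r0 /andP[a0 a1].
have s0 : 0 < sh r by rewrite sh_gt0.
have c0 := ch_gt0 r; have cn := lt0r_neq0 c0; have sn := lt0r_neq0 s0.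
have cE := ch2_sh2 r.
have sa : 0 < sin a by rewrite sin_gt0_pi// a0.
pose D := Num.sqrt (1 + (sh r * sin a) ^+ 2).
have DE : D ^+ 2 = 1 + (sh r * sin a) ^+ 2 by rewrite sqr_sqrtr//; have := sqr_ge0 (sh r * sin a); lra.
have D0 : 0 < D by rewrite sqrtr_gt0; have := sqr_ge0 (sh r * sin a); lra.
have Dn := lt0r_neq0 D0.
pose v := ch r * sin a / D; pose w := cos a / D.
have vw : v ^+ 2 + w ^+ 2 = 1.
  transitivity ((ch r ^+ 2 * sin a ^+ 2 + cos a ^+ 2) / D ^+ 2); first by rewrite /v /w; field.
  rewrite (_ : ch r ^+ 2 * sin a ^+ 2 + cos a ^+ 2 = D ^+ 2) ?divff ?expf_neq0//.
  by rewrite DE cE cos2sin2; ring.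
have v0 : 0 < v by rewrite divr_gt0// mulr_gt0.
have psiE : psi (sh r * sin a) (sh r) = asc v.
  by rewrite /psi -chE -/D /v; congr asc; field; rewrite sn Dn.
have hE : half_apex (radius_klein r) a = pi / 2 - asc w.
  rewrite /half_apex sqrt_radius_klein; congr (_ - asc _).
  have -> : Num.sqrt (1 - (radius_klein r * cos a) ^+ 2) = D / ch r.
    rewrite (_ : 1 - _ = (D / ch r) ^+ 2); last first.
      transitivity ((ch r ^+ 2 - sh r ^+ 2 * cos a ^+ 2) / ch r ^+ 2); first by rewrite /radius_klein; field.
      transitivity (D ^+ 2 / ch r ^+ 2); last by field.
      by rewrite DE cos2sin2 cE; congr (_ / _); ring.
    by rewrite sqrtr_sqr ger0_norm// divr_ge0 ?ltW.
  by rewrite /radius_klein /w; field; rewrite cn sn Dn.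
have key u : 0 <= u -> v ^+ 2 + u ^+ 2 = 1 -> asc v = pi / 2 - asc u.
  move=> u0 vu; have u1 : -1 <= u <= 1 by apply/andP; split; nra.
  have -> : v = sin (pi / 2 - asc u).
    rewrite -[X in sin X]opprB sinN sinBpihalf opprK cos_asc//.
    by rewrite (_ : 1 - _ = v ^+ 2); [rewrite sqrtr_sqr ger0_norm// ltW|lra].
  rewrite ascK//; have := ang_ge0 u0 ltr01; have := ang_le_pihalf u 1.
  by rewrite /ang divr1; have := pi2_gt0 R; lra.
rewrite hE psiE; case: ifPn => ha.
  rewrite (key w)//; rewrite divr_ge0 ?(ltW D0)// cos_ge0_pihalf//.
  by have := pi2_gt0 R; lra.
rewrite (key (- w)) ?sqrrN//; first by rewrite ascN; field.
rewrite -mulNr divr_ge0 ?(ltW D0)// oppr_ge0 leNgt cos_gt0_lt_pihalf ?a0//.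
by apply: contra ha => /ltW.
Qed.

Lemma psixx (x : R) : 0 < x -> psi x x = pi / 2.
Proof.
move=> x0; rewrite /psi divff ?asc1// mulf_neq0 ?lt0r_neq0// sqrtr_gt0.
by have := sqr_ge0 x; lra.
Qed.

End half_apex_psi.

(** * Interior of the polygonal region *)

Section interior_region.
Context (R : realType) (n : nat).
Implicit Types (P : 'I_n -> R * R) (c : R * R).

Lemma continuous_leftof (p q : R * R) : continuous (leftof p q : R * R -> R).
Proof.
move=> z; apply: cvgB; apply: cvgMr; apply: cvgB; try exact: cvg_cst;
  (exact: cvg_fst || exact: cvg_snd).
Qed.

Lemma interior_region_gt0 P c : (forall i, P i != P (ordS i)) ->
  interior (region P) c <-> forall i, 0 < leftof (P i) (P (ordS i)) c.
Proof.
move=> PS; split => [H i|H]; last first.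
  have near_pos i : \forall z \near c, 0 < leftof (P i) (P (ordS i)) z.
    exact: (@continuous_leftof (P i) (P (ordS i)) c _ (lt_nbhsr (H i))).
  have h := filter_forall (nbhs_filter c) near_pos.
  suff : nbhs c (region P) by [].
  by apply: (@filterS _ _ (nbhs_filter c) _ _ _ h) => z zP i; exact: ltW.
have c0 : 0 <= leftof (P i) (P (ordS i)) c by exact: (nbhs_singleton H).
rewrite lt_neqAle c0 andbT eq_sym; apply/eqP => e.
pose p := P i; pose q := P (ordS i).
(* [g] moves c perpendicularly across side i, decreasing the [leftof] value at constant speed. If
   that value were 0 at c, points of [g] near c would leave the region. *)
pose g (t : R) : R * R := (c.1 + t * (q.2 - p.2), c.2 - t * (q.1 - p.1)).
have gc : g t @[t --> 0] --> c.
  have h1 : c.1 + t * (q.2 - p.2) @[t --> (0 : R)] --> c.1.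
    have e1 : c.1 + 0 * (q.2 - p.2) = c.1 by ring.
    rewrite -[X in _ --> X]e1.
    by apply: cvgD; [exact: cvg_cst|apply: cvgMl; exact: cvg_id].
  have h2 : c.2 - t * (q.1 - p.1) @[t --> (0 : R)] --> c.2.
    have e1 : c.2 - 0 * (q.1 - p.1) = c.2 by ring.
    rewrite -[X in _ --> X]e1.
    by apply: cvgB; [exact: cvg_cst|apply: cvgMl; exact: cvg_id].
  by rewrite [X in _ --> X]surjective_pairing; exact: cvg_pair h1 h2.
have /nbhs_ballP[eps /= eps0 Heps] := gc _ H.
have := Heps (eps / 2); rewrite /ball/= sub0r normrN ger0_norm ?divr_ge0 ?(ltW eps0)//.
have lt2 : eps / 2 < eps by rewrite ltr_pdivrMr// ltr_pMr// ltr1n.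
move=> /(_ lt2) /(_ i); rewrite -/p -/q leNgt => /negP; apply.
have -> : leftof p q (g (eps / 2)) = leftof p q c -
    eps / 2 * ((q.1 - p.1) ^+ 2 + (q.2 - p.2) ^+ 2) by rewrite /leftof /g/=; ring.
rewrite e sub0r oppr_lt0 mulr_gt0 ?divr_gt0//.
rewrite lt_neqAle addr_ge0 ?sqr_ge0// andbT eq_sym.
apply/negP => /eqP s0; move: (PS i); rewrite -/p -/q => /eqP; apply.
have h1 := sqr_ge0 (q.1 - p.1); have h2 := sqr_ge0 (q.2 - p.2).
have : (q.1 - p.1) ^+ 2 = 0 by lra.
have : (q.2 - p.2) ^+ 2 = 0 by lra.
move=> /eqP; rewrite sqrf_eq0 subr_eq0 => /eqP e2 /eqP; rewrite sqrf_eq0 subr_eq0 => /eqP e1.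
by rewrite [p]surjective_pairing [q]surjective_pairing e1 e2.
Qed.

End interior_region.

(** * From polygons to half-angles and back *)

Section polygon_data.
Context (R : realType) (n : nat).
Implicit Types (d : n.-tuple R) (i j : 'I_n) (s : R).

Lemma cyclic_half_angles d c r (P : 'I_n -> R * R) : cyclic_ngon c r P d ->
  [/\ (3 <= n)%N, 0 < r, forall i, 0 < half_side d i &
  exists a, [/\ half_angles d (sh r) a,
    interior (region P) c <-> (forall i, a i < pi / 2),
    forall i, side P i c -> a i = pi / 2 &
    harea (region P) = 2 * (\sum_i (if a i <= pi / 2 then psi (half_side d i) (sh r)
      else pi - psi (half_side d i) (sh r))) - 2 * pi]].
Proof.
move=> cyc; have [a [a0 a_sum da al area]] := cyclic_angles cyc.
have [[n3 PH Pc] [cH r0 _] _] := cyc; have s0 : 0 < sh r by rewrite sh_gt0.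
split => //.
  by move=> i; rewrite /half_side da mulr_gt0// sin_gt0_pi.
exists a; split => //.
- rewrite interior_region_gt0; last first.
    move=> i; apply/eqP => e.
    have [j [ji jS]] : exists j : 'I_n, j != i /\ j != ordS i.
      pose o (k : nat) (kn : (k < 3)%N) : 'I_n := Ordinal (leq_trans kn n3).
      apply: contrapT => H; have H' j : j = i \/ j = ordS i.
        have [|ji] := eqVneq j i; first by left.
        by have [|jS] := eqVneq j (ordS i); [right|exfalso; apply: H; exists j].
      have := H' (o 0%N isT); have := H' (o 1%N isT); have := H' (o 2%N isT).
      by case=> e1; case=> e2; case=> e3; have := e1; have := e2; rewrite -?e3 -?e2 => *;
        move: (congr1 val e1) (congr1 val e2) (congr1 val e3); rewrite /= => *; congruence.
    by have := Pc _ _ ji jS; rewrite -e /leftof !subrr !mul0r subrr ltxx.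
  by split => H i; have [e _] := al i; [rewrite -e|rewrite e].
- move=> i [t [_ _ c1 c2]]; have [_ e] := al i; apply/eqP; rewrite -e.
  by rewrite /leftof c1 c2; apply/eqP; ring.
- rewrite area; congr (2 * _ - _); apply: eq_bigr => i _.
  by rewrite half_apex_psi// /half_side da.
Qed.

Lemma half_angles_cyclic d s a : (3 <= n)%N -> 0 < s ->
  (forall i, 0 < half_side d i) -> half_angles d s a ->
  exists P, [/\ cyclic_ngon (0, 0) (arsh s) P d,
    (forall i, a i < pi / 2) -> interior (region P) (0, 0) &
    forall i, a i = pi / 2 -> side P i (0, 0)].
Proof.
move=> n3 s0 d0 [a0 a_sum da].
have r0 : 0 < arsh s by rewrite -sh_gt0 arshK.
have rk := radius_klein_bound r0; have /andP[rk0 rk1] := rk.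
pose P := inscribed a 0 (radius_klein (arsh s)).
have cyc : cyclic_ngon (0, 0) (arsh s) P d.
  apply: inscribed_cyclic => // i; last by rewrite arshK; exact: da.
  by have := d0 i; rewrite /half_side sh_gt0 => ?; lra.
exists P; split => //.
- move=> ai; have [_ _ _ [a' [ha' int _ _]]] := cyclic_half_angles cyc.
  rewrite interior_region_gt0.
    move=> i; rewrite /P inscribedS// leftof_chord /= !mulr0 addr0 subr0.
    have sa := sin_gt0_pi (a0 i); have ca : 0 < cos (a i) by rewrite cos_gt0_lt_pihalf.
    by apply: mulr_gt0; apply: mulr_gt0 => //; apply: mulr_gt0.
  move=> i; apply/eqP => e.
  have : leftof (P i) (P (ordS i)) (0, 0) = 0 by rewrite -e /leftof /=; ring.
  rewrite /P inscribedS// leftof_chord /= !mulr0 addr0 subr0.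
  have sa := sin_gt0_pi (a0 i); have ca : 0 < cos (a i) by rewrite cos_gt0_lt_pihalf.
  apply/eqP/lt0r_neq0; by apply: mulr_gt0; apply: mulr_gt0 => //; apply: mulr_gt0.
(* A side of half-angle pi/2 is a diameter, with the center as midpoint. *)
- move=> i ai; exists (1 / 2); rewrite /P inscribedS// ai; split; [lra|lra| |].
    rewrite /inscribed /pt /= (_ : 2 * (pi / 2) = pi); last by field.
    by rewrite cosDpi; field.
  rewrite /inscribed /pt /= (_ : 2 * (pi / 2) = pi); last by field.
  by rewrite sinDpi; field.
Qed.

End polygon_data.

(** * Circumradius, area and the three types of polygons *)

Section radius_and_area.
Context (R : realType) (n : nat).
Implicit Types (d : n.-tuple R) (i j : 'I_n) (s : R).

(** [J] and [D0] are defined by choice; this uniqueness is what allows them to be computed from any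
    solution of the angle equation. *)
Lemma half_angles_radius d s s' a a' : (3 <= n)%N -> (forall i, 0 < half_side d i) ->
  0 < s -> 0 < s' -> half_angles d s a -> half_angles d s' a' -> s = s'.
Proof.
move=> n3 d0 s0 s'0 h h'.
case: (half_angles_cases n3 d0 s0 h) => [[c _ _]|[i0 [c _ _ _ _]]];
case: (half_angles_cases n3 d0 s'0 h') => [[c' _ _]|[i1 [c' _ _ _ _]]].
- exact: centered_inj c c'.
- by have [] := centered_noncentered n3 d0 c c'.
- by have [] := centered_noncentered n3 d0 c' c.
- by have [] := noncentered_inj d0 c c'.
Qed.

Lemma J_half_angles d s a : (3 <= n)%N -> (forall i, 0 < half_side d i) -> 0 < s ->
  half_angles d s a -> J d = arsh s.
Proof.
move=> n3 d0 s0 h; have [P [cyc _ _]] := half_angles_cyclic n3 s0 d0 h.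
have [c [Q cycQ]] : exists c P, cyclic_ngon c (J d) P d.
  by apply: (@xgetPex _ 0 [set r | exists c P, cyclic_ngon c r P d]); exists (arsh s), (0, 0), P.
have [_ r0 _ [a' [h' _ _ _]]] := cyclic_half_angles cycQ.
have sJ : 0 < sh (J d) by rewrite sh_gt0.
by rewrite (half_angles_radius n3 d0 s0 sJ h h') shK.
Qed.

(** The polygon selected in [D0] comes with its own half-angles a', a priori different from a; only
    the radius is known to agree. [half_angles_cases] identifies them afterwards. *)
Lemma D0_half_angles d s a : (3 <= n)%N -> (forall i, 0 < half_side d i) -> 0 < s ->
  half_angles d s a -> exists2 a', half_angles d s a' &
  D0 d = 2 * (\sum_i (if a' i <= pi / 2 then psi (half_side d i) s
      else pi - psi (half_side d i) s)) - 2 * pi.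
Proof.
move=> n3 d0 s0 h; have [P [cyc _ _]] := half_angles_cyclic n3 s0 d0 h.
have [c [r [Q [cycQ ->]]]] : exists c r P, cyclic_ngon c r P d /\ D0 d = harea (region P).
  apply: (@xgetPex _ 0 [set a | exists c r P, cyclic_ngon c r P d /\ a = harea (region P)]).
  by exists (harea (region P)), (0, 0), (arsh s), P.
have [_ r0 _ [a' [h' _ _ area]]] := cyclic_half_angles cycQ.
have sr : 0 < sh r by rewrite sh_gt0.
have e := half_angles_radius n3 d0 s0 sr h h'.
by exists a'; rewrite e.
Qed.

(** In the semicyclic case [psi] of the longest side is pi/2, so the two area formulas agree. *)
Lemma centered_psi d i0 s : (3 <= n)%N -> (forall i, 0 < half_side d i) ->
  centered d s -> noncentered d i0 s ->
  2 * (\sum_i psi (half_side d i) s) - 2 * pi =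
  2 * (\sum_(i | i != i0) psi (half_side d i) s - psi (half_side d i0) s).
Proof.
move=> n3 d0 c N; have [_ e] := centered_noncentered n3 d0 c N.
by rewrite (bigD1 i0)//= e psixx; [field|case: c].
Qed.

Lemma D0_centered d s : (3 <= n)%N -> (forall i, 0 < half_side d i) -> centered d s ->
  D0 d = 2 * (\sum_i psi (half_side d i) s) - 2 * pi.
Proof.
move=> n3 d0 c; have s0 : 0 < s by case: c.
have [a h ->] := D0_half_angles n3 d0 s0 (centered_half_angles d0 c).
case: (half_angles_cases n3 d0 s0 h) => [[_ ai _]|[i0 [N xs _ _ _]]].
  by congr (2 * _ - _); apply: eq_bigr => i _; rewrite ai.
by have [_ e] := centered_noncentered n3 d0 c N; move: xs; rewrite e ltxx.
Qed.

Lemma D0_noncentered d i0 s : (3 <= n)%N -> (forall i, 0 < half_side d i) ->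
  noncentered d i0 s ->
  D0 d = 2 * (\sum_(i | i != i0) psi (half_side d i) s - psi (half_side d i0) s).
Proof.
move=> n3 d0 N; have s0 : 0 < s by case: N => x0 xs _ _; exact: lt_le_trans xs.
have [a h ->] := D0_half_angles n3 d0 s0 (noncentered_half_angles d0 N).
case: (half_angles_cases n3 d0 s0 h) => [[c ai _]|[i1 [N1 _ big _ small]]].
  rewrite -(centered_psi n3 d0 c N).
  by congr (2 * _ - _); apply: eq_bigr => i _; rewrite ai.
have [e _] := noncentered_inj d0 N N1; rewrite e.
rewrite (bigD1 i1)//= leNgt big /= (eq_bigr (fun i => psi (half_side d i) s)); first by ring.
by move=> i /small[_ ->].
Qed.

Lemma CC_BC_centered d : CC d \/ BC d ->
  [/\ (3 <= n)%N, forall i, 0 < half_side d i & exists s, centered d s].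
Proof.
move=> H; have [c [r [P [cyc or]]]] : exists c r P, cyclic_ngon c r P d /\
    (interior (region P) c \/ exists i, side P i c).
  by case: H => -[c [r [P [cyc ?]]]]; exists c, r, P; split => //; [left|right].
have [n3 r0 d0 [a [h int sid _]]] := cyclic_half_angles cyc.
have s0 : 0 < sh r by rewrite sh_gt0.
split => //; exists (sh r).
case: (half_angles_cases n3 d0 s0 h) => [[]//|[i0 [N _ big _ small]]]; exfalso.
case: or => [/int/(_ i0)|[i /sid ai]]; first by lra.
have [e|ii0] := eqVneq i i0; first by move: big; rewrite -e ai ltxx.
have [a0 a_sum _] := h; move: a_sum; rewrite (bigD1 i0)//= (bigD1 i)//= ai.
have : 0 <= \sum_(j | (j != i0) && (j != i)) a j.
  by apply: sumr_ge0 => j _; case/andP: (a0 j) => /ltW.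
lra.
Qed.

Lemma centered_CC d s : (3 <= n)%N -> (forall i, 0 < half_side d i) -> centered d s ->
  CC d <-> forall i, half_side d i < s.
Proof.
move=> n3 d0 c; have [s0 xs _] := c.
split => [[c' [r [P [cyc int]]]] i|lx].
  have [_ r0 _ [a [h [/(_ int) ai _] _ _]]] := cyclic_half_angles cyc.
  have sr : 0 < sh r by rewrite sh_gt0.
  have -> := half_angles_radius n3 d0 s0 sr (centered_half_angles d0 c) h.
  have [a0 _ ->] := h; rewrite gtr_pMr// -sin_pihalf; have := ai i; have := a0 i.
  by move=> /andP[? ?] ?; have := pi2_gt0 R => ?; rewrite ltr_sin// in_itv/=; apply/andP; split; lra.
have [P [cyc int _]] := half_angles_cyclic n3 s0 d0 (centered_half_angles d0 c).
exists (0, 0), (arsh s), P; split => //; apply: int => i.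
rewrite -(angxx s0) ang_lt ?lexx ?(ltW s0)//; by rewrite ltW ?d0 ?xs.
Qed.

Lemma centered_BC d s : (3 <= n)%N -> (forall i, 0 < half_side d i) -> centered d s ->
  BC d <-> exists i, half_side d i = s.
Proof.
move=> n3 d0 c; have [s0 xs _] := c.
split => [[c' [r [P [cyc [i si]]]]]|[i xi]].
  have [_ r0 _ [a [h _ /(_ i si) ai _]]] := cyclic_half_angles cyc.
  have sr : 0 < sh r by rewrite sh_gt0.
  have -> := half_angles_radius n3 d0 s0 sr (centered_half_angles d0 c) h.
  by exists i; have [_ _ ->] := h; rewrite ai sin_pihalf mulr1.
have [P [cyc _ sid]] := half_angles_cyclic n3 s0 d0 (centered_half_angles d0 c).
exists (0, 0), (arsh s), P; split => //; exists i; apply: sid.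
by rewrite xi angxx.
Qed.

Lemma centered_CC_BC d s : (3 <= n)%N -> (forall i, 0 < half_side d i) -> centered d s ->
  CC d \/ BC d.
Proof.
move=> n3 d0 c; have [lx|/existsNP[i /negP]] := pselect (forall i, half_side d i < s).
  by left; apply/(centered_CC n3 d0 c).
rewrite -leNgt => le; right; apply/(centered_BC n3 d0 c); exists i.
by apply/eqP; rewrite eq_le le andbT; case: c.
Qed.

(** A side with half-length parameter s has half-angle pi/2. Two such sides would use up pi and
    leave no angle for a third side. *)
Lemma centered_max_noncentered d i0 s : (3 <= n)%N -> (forall i, 0 < half_side d i) ->
  centered d s -> half_side d i0 = s -> noncentered d i0 s.
Proof.
move=> n3 d0 [s0 xs e] xi; have p0 := pi2_gt0 R.
have sumE : \sum_(i | i != i0) ang (half_side d i) s = pi / 2.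
  by have := e; rewrite (bigD1 i0)//= xi angxx//; lra.
split; [exact: d0|by rewrite xi| |by rewrite sumE xi angxx].
move=> i ii0; rewrite xi lt_neqAle xs andbT; apply/eqP => xis.
have [j [ji0 ji]] : exists j, j != i0 /\ j != i.
  pose o (k : nat) (kn : (k < 3)%N) : 'I_n := Ordinal (leq_trans kn n3).
  have oE k l kn ln : k != l -> o k kn != o l ln.
    by move=> kl; apply: contra kl => /eqP[->].
  have [e0|n0] := eqVneq (o 0%N isT) i0; have [e1|n1] := eqVneq (o 0%N isT) i.
  - by move: ii0; rewrite -e0 -e1 eqxx.
  - have [e2|n2] := eqVneq (o 1%N isT) i.
      by exists (o 2%N isT); rewrite -e0 -e2 !oE.
    by exists (o 1%N isT); rewrite -e0 oE.
  - have [e2|n2] := eqVneq (o 1%N isT) i0.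
      by exists (o 2%N isT); rewrite -e1 -e2 !oE.
    by exists (o 1%N isT); rewrite -e1 oE.
  - by exists (o 0%N isT).
move: sumE; rewrite (bigD1 i)//= xis angxx// (bigD1 j)/=; last by rewrite ji0.
have := ang_gt0 (d0 j) s0.
have : 0 <= \sum_(k | (k != i0) && (k != i) && (k != j)) ang (half_side d k) s.
  by apply: sumr_ge0 => k _; apply: ang_ge0 => //; exact: ltW.
lra.
Qed.

(** If all half-angles are at most pi/2, failure of [CC] means that some side reaches s, hence the
    longest does. Otherwise the obtuse half-angle belongs to the strictly longest side, which must
    be i0. *)
Lemma AC_noncentered d i0 : Defs.AC d -> ~ CC d -> (forall i, tnth d i <= tnth d i0) ->
  [/\ (3 <= n)%N, forall i, 0 < half_side d i & exists s, noncentered d i0 s].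
Proof.
move=> [c [r [P cyc]]] nCC dmax.
have [n3 r0 d0 [a [h _ _ _]]] := cyclic_half_angles cyc.
have s0 : 0 < sh r by rewrite sh_gt0.
have xmax i : half_side d i <= half_side d i0.
  by rewrite /half_side sh_le ler_pM2r// invr_gt0.
split => //; exists (sh r).
case: (half_angles_cases n3 d0 s0 h) => [[C _ _]|[i1 [N _ _ _ _]]].
  apply: centered_max_noncentered => //.
  have [_ xs _] := C; apply/eqP; rewrite eq_le xs/= leNgt; apply/negP => lx.
  by apply: nCC; apply/(centered_CC n3 d0 C) => i; exact: le_lt_trans lx.
have [<-//|ne] := eqVneq i1 i0.
by have [_ _ ltx _] := N; have := lt_le_trans (ltx i0 _) (xmax i1); rewrite eq_sym ne ltxx => /(_ isT).
Qed.

Lemma noncentered_AC d i0 s : (3 <= n)%N -> (forall i, 0 < half_side d i) ->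
  noncentered d i0 s -> Defs.AC d /\ ~ CC d.
Proof.
move=> n3 d0 N; have s0 : 0 < s by case: N => x0 xs _ _; exact: lt_le_trans xs.
split.
  have [P [cyc _ _]] := half_angles_cyclic n3 s0 d0 (noncentered_half_angles d0 N).
  by exists (0, 0), (arsh s), P.
move=> dCC; have [_ _ [s' c]] := CC_BC_centered (or_introl dCC).
have /(centered_CC n3 d0 c)/(_ i0) := dCC.
by have [-> ->] := centered_noncentered n3 d0 c N; rewrite -(centered_noncentered n3 d0 c N).1 ltxx.
Qed.

Lemma noncentered_BC d i0 s : (3 <= n)%N -> (forall i, 0 < half_side d i) ->
  noncentered d i0 s -> BC d <-> half_side d i0 = s.
Proof.
move=> n3 d0 N; have [x0 xs ltx e] := N; have s0 := lt_le_trans x0 xs.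
split => [B|xi].
  have [_ _ [s' c]] := CC_BC_centered (or_intror B).
  by have [<- ->] := centered_noncentered n3 d0 c N.
have c : centered d s.
  split => // [i|]; last by rewrite (bigD1 i0)//= e xi angxx//; field.
  by have [->//|/ltx/ltW] := eqVneq i i0; rewrite xi.
by apply/(centered_BC n3 d0 c); exists i0.
Qed.

End radius_and_area.

(** * Rooted trees *)

Section walks.
Local Open Scope fset_scope.
Local Open Scope ring_scope.
Variables (V : graph).
Implicit Types (G H : subgraph V) (u v w : gvert V) (e : gedge V).

Lemma edge_end_in G e v : e \in se G -> v \in ends e -> v \in sv G.
Proof. by move=> /(@se_ends _ G)/fsubsetP; apply. Qed.

Lemma walk_le G H v s w : subgraph_le G H -> walk G v s w -> walk H v s w.
Proof.
move=> [_ /fsubsetP h]; elim: s v => [//|[e u] s IH] v /= [eG eE] /IH; split => //; exact: h.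
Qed.

Lemma arc_le G H v s w : subgraph_le G H -> Defs.arc G v s w -> Defs.arc H v s w.
Proof.
by move=> le [vG W U]; split => //; [have [/fsubsetP + _] := le; apply|exact: walk_le W].
Qed.

Lemma walk_cat G v s w t z : walk G v s w -> walk G w t z -> walk G v (s ++ t) z.
Proof. by elim: s v => [|[e u] s IH] v /= => [->//|[eG eE] /IH h /h]. Qed.

Lemma walk_rev G v s w : walk G v s w -> exists t, walk G w t v.
Proof.
elim: s v => [|[e u] s IH] v /= => [->|[eG eE] /IH[t tP]]; first by exists [::].
by exists (t ++ [:: (e, v)]); apply: (walk_cat tP); split => //; rewrite eE fsetUC.
Qed.

Lemma arc_suffix G v s w u : Defs.arc G v s w -> u \in map snd s ->
  exists t t', s = t ++ t' /\ Defs.arc G u t' w.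
Proof.
move=> [vG W D] /mapP[[e1 u1] p1 /= ->].
have [p [q pq]] : exists p q, s = p ++ (e1, u1) :: q by case/splitPr: p1 => p q; exists p, q.
exists (rcons p (e1, u1)), q; rewrite cat_rcons; split => //.
suff [] : [/\ u1 \in sv G, walk G u1 q w & uniq (u1 :: map snd q)] by [].
move: vG W D; rewrite pq; clear; elim: p v => [|[e2 u2] p IH] v /= vG.
  move=> [eG eE W] /andP[_ U]; split => //.
  by apply: (edge_end_in eG); rewrite eE !inE eqxx orbT.
move=> [eG eE W] /andP[_ U]; apply: (IH u2) => //.
by apply: (edge_end_in eG); rewrite eE !inE eqxx orbT.
Qed.

Lemma walk_arc G v s w : v \in sv G -> walk G v s w -> exists t, Defs.arc G v t w.
Proof.
elim: s v => [|[e u] s IH] v vG /=; first by move=> <-; exists [::]; split.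
move=> [eG eE W].
have uG : u \in sv G by apply: (edge_end_in eG); rewrite eE !inE eqxx orbT.
have [t a] := IH u uG W; have [_ W' U'] := a.
have [->|vu] := eqVneq v u; first by exists t.
have [vt|vt] := boolP (v \in map snd t).
  by have [t1 [t2 [_ a2]]] := arc_suffix a vt; exists t2.
exists ((e, u) :: t); split => //.
by rewrite [uniq _]/= -/(uniq (u :: map snd t)) U' andbT inE negb_or vu.
Qed.

End walks.

Section rooted_tree.
Local Open Scope fset_scope.
Local Open Scope ring_scope.
Variables (V : graph) (T : subgraph V) (r : gvert V) (F : {fset gedge V}) (e0 : gedge V).
Hypotheses (T_tree : is_tree T) (r_in : r \in sv T) (F_frontier : is_frontier T F).
Implicit Types (u v w : gvert V) (e f : gedge V) (s : seq (gedge V * gvert V)).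

Definition arc_of v := xget [::] [set s | Defs.arc T v s r].

Lemma arc_ofP v : v \in sv T -> Defs.arc T v (arc_of v) r.
Proof.
move=> vT; have [s [sP _]] := T_tree.2 _ _ vT r_in.
by apply: (@xgetPex _ [::] [set s | Defs.arc T v s r]); exists s.
Qed.

Lemma arc_of_unique v s : Defs.arc T v s r -> s = arc_of v.
Proof.
move=> sP; have vT : v \in sv T by case: sP.
have [t [_ tu]] := T_tree.2 _ _ vT r_in.
by rewrite -(tu _ sP) -(tu _ (arc_ofP vT)).
Qed.

(* [e0] is a junk value for the root, which has no initial edge. *)
Definition ev v := if arc_of v is (e, _) :: _ then e else e0.
Definition par v := if arc_of v is (_, w) :: _ then w else v.
Definition depth v := size (arc_of v).

Lemma arc_of_root : arc_of r = [::].
Proof. by apply/esym/arc_of_unique; split. Qed.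

Lemma arc_of_cons v : v \in sv T -> v != r -> [/\ arc_of v = (ev v, par v) :: arc_of (par v),
  ev v \in se T, ends (ev v) = [fset v; par v], par v \in sv T & par v != v].
Proof.
move=> vT vr; have := arc_ofP vT; rewrite /ev /par.
case: (arc_of v) (erefl (arc_of v)) => [|[e w] s] E [_ /= W U]; first by rewrite W eqxx in vr.
have [eT eE Ws] := W.
have wT : w \in sv T.
  by have /fsubsetP := se_ends eT; apply; rewrite eE !inE eqxx orbT.
move: U; rewrite inE negb_or => /andP[/andP[vw vs] /andP[ws us]].
have as' : Defs.arc T w s r by split => //=; rewrite ws.
by split => //; [rewrite (arc_of_unique as')|rewrite eq_sym].
Qed.

Lemma ev_se v : v \in sv T -> v != r -> ev v \in se T.
Proof. by move=> vT vr; have [] := arc_of_cons vT vr. Qed.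

Lemma ends_ev v : v \in sv T -> v != r -> ends (ev v) = [fset v; par v].
Proof. by move=> vT vr; have [] := arc_of_cons vT vr. Qed.

Lemma par_in v : v \in sv T -> v != r -> par v \in sv T.
Proof. by move=> vT vr; have [] := arc_of_cons vT vr. Qed.

Lemma par_neq v : v \in sv T -> v != r -> par v != v.
Proof. by move=> vT vr; have [] := arc_of_cons vT vr. Qed.

Lemma depth_par v : v \in sv T -> v != r -> depth v = (depth (par v)).+1.
Proof. by move=> vT vr; rewrite /depth; have [-> _ _ _ _] := arc_of_cons vT vr. Qed.

Lemma init_edgeP v e : v \in sv T -> init_edge T r v e <-> v != r /\ e = ev v.
Proof.
move=> vT; split => [[w [s /arc_of_unique E]]|[vr ->]].
  by split; [apply/eqP => vr; move: E; rewrite vr arc_of_root|rewrite /ev -E].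
have [E _ _ _ _] := arc_of_cons vT vr.
by exists (par v), (arc_of (par v)); rewrite -E; exact: arc_ofP.
Qed.

Lemma childP v w : child T r v w <-> [/\ w \in sv T, w != r & par w = v].
Proof.
split => [[wT wr wv [e /(init_edgeP _ wT)[_ ->]]]|[wT wr <-]].
  by rewrite ends_ev// !inE eq_sym (negbTE wv) /= => /eqP <-.
split => //; first by rewrite eq_sym par_neq.
exists (ev w); first by apply/(init_edgeP _ wT).
by rewrite ends_ev// !inE eqxx orbT.
Qed.

Lemma ev_inj u v : u \in sv T -> u != r -> v \in sv T -> v != r -> ev u = ev v -> u = v.
Proof.
move=> uT ur vT vr e; have := ends_ev uT ur; rewrite e ends_ev// => E.
apply/eqP; apply: contraT => uv.
have vu : v = par u by apply/eqP; have : v \in [fset u; par u]; [rewrite -E !inE eqxx|rewrite !inE eq_sym (negbTE uv)].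
have uv' : u = par v by apply/eqP; have : u \in [fset v; par v]; [rewrite E !inE eqxx|rewrite !inE (negbTE uv)].
have : (depth v < depth u)%N by rewrite (depth_par uT ur) -vu.
by rewrite (depth_par vT vr) -uv' ltnNge leqnSn.
Qed.

(** Let u and w be the ends of e. If w is on the arc from u to the root, uniqueness of arcs makes e
    the initial edge of u; if not, e followed by that arc is the arc from w. *)
Lemma ev_surj e : e \in se T -> exists v, [/\ v \in sv T, v != r & e = ev v].
Proof.
move=> eT; have [u [w [uw E]]] : exists u w, u != w /\ ends e = [fset u; w].
  have /fset0Pn[u ue] : ends e != fset0 by rewrite -cardfs_gt0 card_ends.
  have /cardfs1P[w wE] : #|` ends e `\ u| == 1%N by move: (card_ends e); rewrite (cardfsD1 u) ue add1n => -[->].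
  exists u, w; split; last by rewrite -(fsetD1K ue) wE.
  by have := fset11 w; rewrite -wE !inE => /andP[]; rewrite eq_sym.
have /fsubsetP sub := se_ends eT.
have uT : u \in sv T by apply: sub; rewrite E !inE eqxx.
have wT : w \in sv T by apply: sub; rewrite E !inE eqxx orbT.
have [U W D] := arc_ofP uT.
have [wu|wu] := boolP (w \in map snd (arc_of u)); last first.
  have a : Defs.arc T w ((e, u) :: arc_of u) r.
    split => //=; first by split => //; rewrite E fsetUC.
    by rewrite inE eq_sym (negbTE uw) /= wu.
  exists w; split => //; last by rewrite /ev -(arc_of_unique a).
  by apply/eqP => wr; move: (arc_of_unique a); rewrite wr arc_of_root.
have [t [t' [tE a']]] := arc_suffix (arc_ofP uT) wu.
have ur : u != r by apply/eqP => ur; move: wu; rewrite ur arc_of_root.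
have a : Defs.arc T u ((e, w) :: t') r.
  have [_ W' U'] := a'; split => //.
  rewrite [uniq _]/= -/(uniq (w :: map snd t')) U' andbT inE (negbTE uw)/=.
  move: D; rewrite /= => /andP[ut _]; apply: contra ut => ut.
  by rewrite tE map_cat mem_cat ut orbT.
by exists u; split => //; rewrite /ev -(arc_of_unique a).
Qed.

Lemma F_se e : e \in F -> e \notin se T.
Proof. by move=> /F_frontier.1[]. Qed.

Lemma starE v e : (e \in star T F v) = ((e \in se T) || (e \in F)) && (v \in ends e).
Proof. by rewrite !inE. Qed.

Lemma ev_star v : v \in sv T -> v != r -> ev v \in star T F v.
Proof. by move=> vT vr; rewrite starE ev_se// ends_ev// !inE eqxx. Qed.

Lemma ev_star_par v : v \in sv T -> v != r -> ev v \in star T F (par v).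
Proof. by move=> vT vr; rewrite starE ev_se// ends_ev// !inE eqxx orbT. Qed.

Lemma star_cases v e : e \in star T F v -> [\/ e \in F,
  [/\ e = ev v, v \in sv T & v != r] | exists u, [/\ u \in sv T, u != r, par u = v & e = ev u]].
Proof.
rewrite starE => /andP[/orP[eT|eF] ve]; last by constructor 1.
have [u [uT ur eE]] := ev_surj eT.
move: ve; rewrite eE ends_ev// !inE => /orP[/eqP ->|/eqP ->]; first by constructor 2.
by constructor 3; exists u.
Qed.

Section edge_sums.
Variables (R : realType) (G : gedge V -> gvert V -> R).

Lemma star_sum v (P : pred (gedge V)) : \sum_(e <- star T F v | P e) G e v =
  \sum_(e <- se T `|` F | P e && (v \in ends e)) G e v.
Proof.
rewrite -[LHS]big_filter -[RHS]big_filter; apply: perm_big.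
apply: uniq_perm; rewrite ?filter_uniq ?fset_uniq// => e.
by rewrite !mem_filter !inE -andbA [X in _ && X]andbC.
Qed.

(** Double counting: every edge of the tree is [ev v] for one nonroot v and has the two ends v and
    [par v]. *)
Lemma edge_sum : \sum_(v <- sv T) \sum_(e <- star T F v | e \notin F) G e v =
  \sum_(v <- sv T | v != r) (G (ev v) v + G (ev v) (par v)).
Proof.
under eq_bigr do rewrite star_sum.
rewrite (exchange_big_dep (fun e => e \notin F))/=; last by move=> v e _ /andP[].
transitivity (\sum_(e <- se T) \sum_(v <- sv T | v \in ends e) G e v).
  rewrite -[LHS]big_filter; rewrite (perm_big (se T))/=; last first.
    apply: uniq_perm; rewrite ?filter_uniq ?fset_uniq// => e.
    rewrite mem_filter in_fsetU; case: (boolP (e \in F)) => [/F_se/negbTE -> //|_].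
    by rewrite orbF.
  rewrite big_seq [RHS]big_seq; apply: eq_bigr => e eT; apply: eq_bigl => v.
  by rewrite (contraL (@F_se e))// eT.
rewrite (perm_big [seq ev v | v <- sv T & v != r])/=; last first.
  apply: uniq_perm; first exact: fset_uniq.
    rewrite map_inj_in_uniq ?filter_uniq ?fset_uniq// => u v.
    rewrite !mem_filter => /andP[ur uT] /andP[vr vT]; exact: ev_inj.
  move=> e; apply/idP/mapP => [/ev_surj[v [vT vr ->]]|[v]].
    by exists v => //; rewrite mem_filter vr.
  by rewrite mem_filter => /andP[vr vT] ->; exact: ev_se.
rewrite big_map big_filter big_seq_cond [RHS]big_seq_cond; apply: eq_bigr => v /andP[vT vr].
rewrite -big_filter (perm_big [:: v; par v])/=.
  by rewrite !big_cons big_nil addr0.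
apply: uniq_perm; rewrite ?filter_uniq ?fset_uniq//=.
  by rewrite inE eq_sym par_neq.
move=> u; rewrite mem_filter ends_ev// !inE; apply/andP/orP => [[]//|].
  by move=> /orP.
by move=> [/eqP ->|/eqP ->]; rewrite eqxx ?orbT; split => //; exact: par_in.
Qed.

(** The shape shared by the total area and the angle equations: at each nonroot vertex the edge
    toward the root, its longest, has the opposite sign. *)
Definition signed_sum : R :=
  \sum_(v <- sv T | v != r) (\sum_(e <- star T F v | e != ev v) G e v - G (ev v) v)
  + \sum_(e <- star T F r) G e r.

(** Regrouped by edges: a tree edge counts with a plus sign at its upper end and a minus sign at its
    lower end, a frontier edge always with a plus sign. *)
Lemma signed_sumE : signed_sum =
  \sum_(v <- sv T | v != r) (G (ev v) (par v) - G (ev v) v) +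
  \sum_(v <- sv T) \sum_(e <- star T F v | e \in F) G e v.
Proof.
have H v : v \in sv T -> v != r -> \sum_(e <- star T F v | e != ev v) G e v - G (ev v) v =
    \sum_(e <- star T F v) G e v - 2 * G (ev v) v.
  move=> vT vr; rewrite [in RHS](bigID (pred1 (ev v)))/=.
  rewrite -[in RHS]big_filter filter_pred1_uniq ?fset_uniq ?ev_star// big_seq1; ring.
rewrite /signed_sum.
have -> : \sum_(v <- sv T | v != r) (\sum_(e <- star T F v | e != ev v) G e v - G (ev v) v) =
  \sum_(v <- sv T | v != r) (\sum_(e <- star T F v) G e v) - \sum_(v <- sv T | v != r) 2 * G (ev v) v.
  rewrite -sumrB big_seq_cond [RHS]big_seq_cond; apply: eq_bigr => v /andP[vT vr]; exact: H.
have -> : \sum_(v <- sv T | v != r) (\sum_(e <- star T F v) G e v) =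
  \sum_(v <- sv T) (\sum_(e <- star T F v) G e v) - \sum_(e <- star T F r) G e r.
  rewrite [in RHS](bigID (pred1 r))/=.
  by rewrite -[X in _ = X + _ - _]big_filter filter_pred1_uniq ?fset_uniq// big_seq1 addrAC subrr add0r.
have -> : \sum_(v <- sv T) (\sum_(e <- star T F v) G e v) =
  \sum_(v <- sv T) (\sum_(e <- star T F v | e \notin F) G e v) +
  \sum_(v <- sv T) (\sum_(e <- star T F v | e \in F) G e v).
  rewrite -big_split/=; apply: eq_bigr => v _.
  by rewrite (bigID (fun e => e \in F))/= addrC.
rewrite edge_sum big_split/= sumrB -mulr_sumr; ring.
Qed.

End edge_sums.
End rooted_tree.

(** * Angle equations at a vertex, indexed by edges *)

Section vertex_conditions.
Local Open Scope fset_scope.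
Local Open Scope ring_scope.
Variables (R : realType) (V : graph) (T : subgraph V) (F : {fset gedge V}).
Implicit Types (u v w : gvert V) (e f : gedge V) (x : gedge V -> R) (s : R).

Definition vcen v x s := [/\ 0 < s, forall e, e \in star T F v -> x e <= s &
  \sum_(e <- star T F v) ang (x e) s = pi].

Definition vnon v f x s := [/\ f \in star T F v, 0 < x f, x f <= s,
  forall e, e \in star T F v -> e != f -> x e < x f &
  \sum_(e <- star T F v | e != f) ang (x e) s = ang (x f) s].

Definition half_length (d : gedge V -> R) e := sh (d e / 2).

Lemma half_length_gt0 d e : (0 < half_length d e) = (0 < d e).
Proof. by rewrite /half_length -{1}(sh0 R) sh_lt; apply/idP/idP; lra. Qed.

Definition nth_edge v (i : 'I_#|` star T F v|) : gedge V := tnth (in_tuple (enum_fset (star T F v))) i.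

Lemma half_side_Pv d v i : half_side (Pv T F d v) i = half_length d (nth_edge i).
Proof. by rewrite /half_side /Pv tnth_map. Qed.

Lemma nth_edge_star v i : @nth_edge v i \in star T F v.
Proof. exact: mem_tnth. Qed.

Lemma nth_edge_onto v e : e \in star T F v -> exists i, e = @nth_edge v i.
Proof. by move=> h; have /tnthP[i ->] : e \in in_tuple (enum_fset (star T F v)) by []; exists i. Qed.

Lemma nth_edge_eq v i j : (@nth_edge v i == nth_edge j) = (i == j).
Proof.
apply/eqP/eqP => [|-> //] E; apply/val_inj/eqP => /=.
move: E; rewrite /nth_edge !(tnth_nth (nth_edge i))/= => /eqP; rewrite nth_uniq ?fset_uniq//; exact: ltn_ord.
Qed.

Lemma sum_star v (P : pred (gedge V)) (G : gedge V -> R) :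
  \sum_(e <- star T F v | P e) G e = \sum_(i | P (@nth_edge v i)) G (nth_edge i).
Proof. by rewrite big_tnth. Qed.

Lemma sum_star_neq v i (G : gedge V -> R) :
  \sum_(e <- star T F v | e != nth_edge i) G e = \sum_(j | j != i) G (@nth_edge v j).
Proof. by rewrite sum_star; apply: eq_bigl => j; rewrite nth_edge_eq. Qed.

Lemma vcenE v d s : vcen v (half_length d) s <-> centered (Pv T F d v) s.
Proof.
rewrite /vcen /centered sum_star.
under [in X in _ <-> X]eq_bigr do rewrite half_side_Pv.
split => [[h1 h2 h3]|[h1 h2 h3]]; split => //.
- by move=> i; rewrite half_side_Pv; apply: h2; exact: nth_edge_star.
- by move=> e /nth_edge_onto[i ->]; rewrite -half_side_Pv.
Qed.

Lemma vnonE v d i s : vnon v (nth_edge i) (half_length d) s <-> noncentered (Pv T F d v) i s.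
Proof.
rewrite /vnon /noncentered sum_star_neq !half_side_Pv.
under [in X in _ <-> X]eq_bigr do rewrite half_side_Pv.
split => [[h1 h2 h3 h4 h5]|[h1 h2 h3 h4]]; split => //.
- by move=> j ij; rewrite half_side_Pv; apply: h4; [exact: nth_edge_star|rewrite nth_edge_eq].
- exact: nth_edge_star.
- by move=> e /nth_edge_onto[j ->]; rewrite nth_edge_eq -half_side_Pv; exact: h3.
Qed.

End vertex_conditions.

(** * Admissibility and area in the sinh coordinates *)

Section admissible.
Local Open Scope fset_scope.
Local Open Scope ring_scope.
Variables (R : realType) (V : graph) (T : subgraph V) (r : gvert V) (F : {fset gedge V}) (e0 : gedge V).
Hypotheses (T_tree : is_tree T) (r_in : r \in sv T) (F_frontier : is_frontier T F).
Hypothesis T_valence : forall v, v \in sv T -> (3 <= valence T F v)%N.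
Implicit Types (u v w : gvert V) (e f : gedge V) (x : gedge V -> R) (s : gvert V -> R).
Local Notation ev := (ev T r e0).
Local Notation par := (par T r).

(* [x e] is sinh of half the length of e, [s v] is sinh of the circumradius at v. *)
Record adm x s : Prop := Adm {
  adm_gt0 : forall e, e \in se T `|` F -> 0 < x e;
  adm_non : forall v, v \in sv T -> v != r -> vnon T F v (ev v) x (s v);
  adm_cen : vcen T F r x (s r);
  adm_par : forall v, v \in sv T -> v != r -> s v <= s (par v) }.

(** Half of D_T, see [adm_area]. The angle equations cancel the [kap] terms at nonroot vertices and
    turn the one at the root into [pi * kap (s r)]. *)
Definition area x s : R :=
  \sum_(v <- sv T | v != r)
     (\sum_(e <- star T F v | e != ev v) gfun (x e) (s v) - gfun (x (ev v)) (s v))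
  + \sum_(e <- star T F r) gfun (x e) (s r) + pi * kap (s r) - pi.

Lemma star_sub v e : e \in star T F v -> e \in se T `|` F.
Proof. by rewrite starE inE => /andP[]. Qed.

Lemma adm_half_side_gt0 d s v : adm (half_length d) s -> forall i, 0 < half_side (Pv T F d v) i.
Proof. by move=> A i; rewrite half_side_Pv; apply: (adm_gt0 A); apply: star_sub; exact: nth_edge_star. Qed.

Lemma adm_noncentered d s v : adm (half_length d) s -> v \in sv T -> v != r ->
  exists i, nth_edge i = ev v /\ noncentered (Pv T F d v) i (s v).
Proof.
move=> A vT vr; have N := adm_non A vT vr.
have [i iE] : exists i, ev v = @nth_edge _ T F v i by apply: nth_edge_onto; case: N.
by exists i; split => //; apply/vnonE; rewrite -iE.
Qed.

Lemma adm_radius d s v : adm (half_length d) s -> v \in sv T -> J (Pv T F d v) = arsh (s v).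
Proof.
move=> A vT; have [->|vr] := eqVneq v r.
  have C : centered (Pv T F d r) (s r) by apply/vcenE; exact: adm_cen A.
  have s0 : 0 < s r by case: C.
  exact: J_half_angles (T_valence r_in) (adm_half_side_gt0 A) s0 (centered_half_angles (adm_half_side_gt0 A) C).
have [i [_ N]] := adm_noncentered A vT vr.
have s0 : 0 < s v by case: N => x0 xs _ _; exact: lt_le_trans xs.
exact: J_half_angles (T_valence vT) (adm_half_side_gt0 A) s0 (noncentered_half_angles (adm_half_side_gt0 A) N).
Qed.

Lemma adm_BC d s v : adm (half_length d) s -> v \in sv T -> v != r ->
  BC (Pv T F d v) <-> half_length d (ev v) = s v.
Proof.
move=> A vT vr; have [i [iE N]] := adm_noncentered A vT vr.
by rewrite (noncentered_BC (T_valence vT) (adm_half_side_gt0 A) N) half_side_Pv iE.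
Qed.

Lemma adm_BC_root d s : adm (half_length d) s ->
  BC (Pv T F d r) <-> exists2 e, e \in star T F r & half_length d e = s r.
Proof.
move=> A; have C : centered (Pv T F d r) (s r) by apply/vcenE; exact: adm_cen A.
rewrite (centered_BC (T_valence r_in) (adm_half_side_gt0 A) C).
split => [[i <-]|[e /nth_edge_onto[i ->] E]].
  by exists (nth_edge i); [exact: nth_edge_star|rewrite half_side_Pv].
by exists i; rewrite half_side_Pv.
Qed.

Lemma adm_area d s : adm (half_length d) s -> DT T F d = 2 * area (half_length d) s.
Proof.
move=> A; rewrite /DT (bigID (pred1 r))/= -[X in X + _]big_filter filter_pred1_uniq ?fset_uniq// big_seq1.
have C : centered (Pv T F d r) (s r) by apply/vcenE; exact: adm_cen A.
have Cv := adm_cen A.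
have -> : D0 (Pv T F d r) = 2 * (\sum_(e <- star T F r) gfun (half_length d e) (s r) + pi * kap (s r) - pi).
  rewrite (D0_centered (T_valence r_in) (adm_half_side_gt0 A) C).
  under eq_bigr do rewrite half_side_Pv.
  rewrite -(@sum_star _ _ T F r (fun=> true) (fun e => psi (half_length d e) (s r))) /gfun sumrB -mulr_sumr.
  by case: Cv => _ _ ->; ring.
have -> : \sum_(v <- sv T | v != r) D0 (Pv T F d v) = 2 * \sum_(v <- sv T | v != r)
    (\sum_(e <- star T F v | e != ev v) gfun (half_length d e) (s v) - gfun (half_length d (ev v)) (s v)).
  rewrite mulr_sumr big_seq_cond [RHS]big_seq_cond; apply: eq_bigr => v /andP[vT vr].
  have [i [iE N]] := adm_noncentered A vT vr.
  rewrite (D0_noncentered (T_valence vT) (adm_half_side_gt0 A) N) half_side_Pv iE.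
  under eq_bigr do rewrite half_side_Pv.
  rewrite -(sum_star_neq i (fun e => psi (half_length d e) (s v))) iE /gfun sumrB -mulr_sumr.
  by have [_ _ _ _ ->] := adm_non A vT vr; ring.
by rewrite /area; ring.
Qed.

Lemma Ad_adm dF d : (forall f, f \in F -> 0 < dF f) -> Ad T r F dF d -> exists s, adm (half_length d) s.
Proof.
move=> dF_gt0 [[dE dFE] hv hr hJ].
have d_gt0 e : e \in se T `|` F -> 0 < half_length d e.
  by rewrite half_length_gt0 inE => /orP[/dE//|eF]; rewrite dFE// dF_gt0.
have hs v i : 0 < half_side (Pv T F d v) i.
  by rewrite half_side_Pv; apply: d_gt0; apply: star_sub; exact: nth_edge_star.
exists (fun v => sh (J (Pv T F d v))); split => //.
- move=> v vT vr; have [[hA hC] hmax] := hv v vT vr.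
  have [i iE] := nth_edge_onto (ev_star F e0 T_tree r_in vT vr).
  have dmax j : tnth (Pv T F d v) j <= tnth (Pv T F d v) i.
    rewrite !tnth_map -[X in _ <= d X]iE; apply: hmax; last exact: nth_edge_star.
    by apply/(init_edgeP e0 T_tree r_in _ vT).
  have [n3 d0 [s N]] := AC_noncentered hA hC dmax.
  have s0 : 0 < s by case: N => x0 xs _ _; exact: lt_le_trans xs.
  rewrite (J_half_angles n3 d0 s0 (noncentered_half_angles d0 N)) arshK iE; exact/vnonE.
- have [n3 d0 [s C]] := CC_BC_centered hr.
  have s0 : 0 < s by case: C.
  by rewrite (J_half_angles n3 d0 s0 (centered_half_angles d0 C)) arshK; apply/vcenE.
- move=> v vT vr; rewrite sh_le; apply: hJ; first exact: par_in.
  by apply/(childP e0 T_tree r_in).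
Qed.

Lemma adm_Ad dF d s : (forall f, f \in F -> d f = dF f) -> adm (half_length d) s -> Ad T r F dF d.
Proof.
move=> dFE A; split.
- by split => // e eT; rewrite -half_length_gt0; apply: (adm_gt0 A); rewrite inE eT.
- move=> v vT vr; have [i [iE N]] := adm_noncentered A vT vr.
  split; first exact: noncentered_AC (T_valence vT) (adm_half_side_gt0 A) N.
  move=> e /(init_edgeP e0 T_tree r_in _ vT)[_ ->] f fv.
  have [->//|fe] := eqVneq f (ev v).
  have [_ _ _ + _] := adm_non A vT vr; move=> /(_ f fv fe) /ltW; rewrite sh_le; lra.
- have C : centered (Pv T F d r) (s r) by apply/vcenE; exact: adm_cen A.
  exact: centered_CC_BC (T_valence r_in) (adm_half_side_gt0 A) C.
- move=> v w vT /(childP e0 T_tree r_in)[wT wr <-].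
  rewrite !(adm_radius A) ?par_in// -(@sh_le R) !arshK; exact: adm_par A _ wT wr.
Qed.

End admissible.

(** * Comparison of areas *)

Lemma ler_sum_mem (R : realType) (I : eqType) (t : seq I) (P : pred I) (A B : I -> R) :
  (forall i, i \in t -> P i -> A i <= B i) -> \sum_(i <- t | P i) A i <= \sum_(i <- t | P i) B i.
Proof.
by move=> h; rewrite big_seq_cond [leRHS]big_seq_cond; apply: ler_sum => i /andP[]; exact: h.
Qed.

Lemma ltr_sum_mem (R : realType) (I : choiceType) (t : {fset I}) (P : pred I) (A B : I -> R) j :
  (forall i, i \in t -> P i -> A i <= B i) -> j \in t -> P j -> A j < B j ->
  \sum_(i <- t | P i) A i < \sum_(i <- t | P i) B i.
Proof.
move=> h jt Pj lj; rewrite (bigID (pred1 j))/= [ltRHS](bigID (pred1 j))/=.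
apply: ltr_leD; last by apply: ler_sum_mem => i it /andP[Pi _]; exact: h.
have E : forall C : I -> R, \sum_(i <- t | P i && (i == j)) C i = C j.
  move=> C; rewrite -big_filter; have -> : [seq i <- t | P i & i == j] = [:: j]; last exact: big_seq1.
  rewrite -(@filter_pred1_uniq _ t j) ?fset_uniq//; apply: eq_filter => i /=.
  by apply/andP/eqP => [[_ /eqP]//|->].
by rewrite !E.
Qed.

Section area_decrease.
Local Open Scope fset_scope.
Local Open Scope ring_scope.
Variables (R : realType) (V : graph) (T : subgraph V) (r : gvert V) (F : {fset gedge V}) (e0 : gedge V).
Hypotheses (T_tree : is_tree T) (r_in : r \in sv T) (F_frontier : is_frontier T F).
Implicit Types (u v w : gvert V) (e f : gedge V) (x : gedge V -> R) (s : gvert V -> R).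
Local Notation ev := (ev T r e0).
Local Notation par := (par T r).

Lemma tree_ind (P : gvert V -> Prop) : P r ->
  (forall v, v \in sv T -> v != r -> P (par v) -> P v) -> forall v, v \in sv T -> P v.
Proof.
move=> Pr PS v; move: {2}(depth T r v) (leqnn (depth T r v)) => k; elim: k v => [|k IH] v hk vT.
  have [->//|vr] := eqVneq v r.
  by move: hk; rewrite (depth_par e0 T_tree r_in vT vr).
have [->//|vr] := eqVneq v r.
apply: PS => //; apply: IH; last exact: par_in.
by move: hk; rewrite (depth_par e0 T_tree r_in vT vr).
Qed.

Section adm_facts.
Variables (x : gedge V -> R) (s : gvert V -> R).
Hypothesis A : adm T r F e0 x s.

Lemma adm_le_root v : v \in sv T -> s v <= s r.
Proof.
by apply: (tree_ind (P := fun v => s v <= s r)) v => // v vT vr; apply: le_trans; exact: adm_par A _ vT vr.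
Qed.

Lemma adm_star_le v e : v \in sv T -> e \in star T F v -> 0 < x e <= s v.
Proof.
move=> vT es; rewrite (adm_gt0 A) ?(star_sub es)//=.
have [vr|vr] := eqVneq v r; first by rewrite vr in es *; case: (adm_cen A) => _ h _; exact: h.
have [_ _ xs lx _] := adm_non A vT vr.
by have [->//|ne] := eqVneq e (ev v); apply: le_trans xs; apply/ltW/lx.
Qed.

Lemma adm_s_gt0 v : v \in sv T -> 0 < s v.
Proof.
move=> vT; have [->|vr] := eqVneq v r; first by case: (adm_cen A).
by have [_ x0 xs _ _] := adm_non A vT vr; exact: lt_le_trans xs.
Qed.

Lemma adm_gfun_min v t : v \in sv T -> v != r -> x (ev v) <= t -> t != s v ->
  \sum_(e <- star T F v | e != ev v) gfun (x e) (s v) - gfun (x (ev v)) (s v) <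
  \sum_(e <- star T F v | e != ev v) gfun (x e) t - gfun (x (ev v)) t.
Proof.
move=> vT vr xt ts; have [_ x0 xs lx E] := adm_non A vT vr.
rewrite big_seq_cond [X in _ < X - _]big_seq_cond.
apply: gfun_noncentered => //; first by rewrite eq_sym.
  by move=> e /andP[es ne]; rewrite lx// andbT ltW// (adm_gt0 A)// (star_sub es).
by rewrite -E [RHS]big_seq_cond.
Qed.

End adm_facts.

Variables (x x' : gedge V -> R) (s s' : gvert V -> R).
Hypotheses (A : adm T r F e0 x s) (A' : adm T r F e0 x' s').
Hypotheses (x'F : forall f, f \in F -> x' f = x f)
  (x'le : forall v, v \in sv T -> v != r -> x' (ev v) <= x (ev v))
  (s'r : s' r <= s r)
  (s_cases : forall v, v \in sv T -> v != r -> s v <= s' r \/ s v = s r).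
Let b := s' r.
Let t v := Num.min (s v) b.
(* The radii t replace s in three steps: s' minimizes the corrected area at each
   nonroot vertex, the difference of [gfun] along an edge is monotone in its
   length, and where s exceeds b the loss at the vertices is paid for by the
   angle equations through [gfun_chord]. *)
Let Lam y q := \sum_(v <- sv T | v != r)
     (\sum_(e <- star T F v | e != ev v) gfun (y e) (q v) - gfun (y (ev v)) (q v))
  + \sum_(e <- star T F r) gfun (y e) (q r) :> R.

Let LamE y q : Lam y q = signed_sum T r F e0 (fun e v => gfun (y e) (q v)).
Proof. by []. Qed.

Let tr : t r = b. Proof. by rewrite /t min_r. Qed.

Let t_gt0 v : v \in sv T -> 0 < t v.
Proof. by move=> vT; rewrite /t lt_min (adm_s_gt0 A vT) (adm_s_gt0 A' r_in). Qed.

Let s_cases' v : v \in sv T -> s v <= b \/ (b < s v /\ s v = s r).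
Proof.
move=> vT; have [|bs] := leP (s v) b; first by left.
right; split => //; have [->//|vr] := eqVneq v r.
by have [h|//] := s_cases vT vr; move: bs; rewrite ltNge h.
Qed.

Let x't v : v \in sv T -> v != r -> x' (ev v) <= t v.
Proof.
move=> vT vr; rewrite /t le_min.
have [_ _ h _ _] := adm_non A vT vr; rewrite (le_trans (x'le vT vr) h)/=.
have [_ _ h' _ _] := adm_non A' vT vr; exact: le_trans h' (adm_le_root A' vT).
Qed.

Let step1 : (exists v, [/\ v \in sv T, v != r & s' v != t v]) -> Lam x' s' < Lam x' t.
Proof.
move=> [v [vT vr sv]]; rewrite /Lam tr ltrD2r; apply: (@ltr_sum_mem _ _ _ _ _ _ v) => //.
  move=> u uT ur; have [->//|ne] := eqVneq (s' u) (t u).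
  by apply/ltW/(adm_gfun_min A') => //; [exact: x't|rewrite eq_sym].
by apply: (adm_gfun_min A') => //; [exact: x't|rewrite eq_sym].
Qed.

Let step2 : Lam x' t <= Lam x t.
Proof.
rewrite !LamE !(signed_sumE e0 T_tree r_in F_frontier); apply: lerD; last first.
  by apply: ler_sum => v _; apply: ler_sum => e eF; rewrite x'F.
apply: ler_sum_mem => v vT vr.
have pT := par_in e0 T_tree r_in vT vr.
have [sb|[bs sr]] := s_cases' vT; last first.
  have -> : t (par v) = t v; last by rewrite !subrr.
  rewrite /t !min_r//; first exact: ltW.
  exact: le_trans (ltW bs) (adm_par A vT vr).
have tv : t v = s v by rewrite /t min_l.
have tt : t v <= t (par v) by rewrite tv /t le_min sb andbT (adm_par A vT vr).
have x'0 : 0 <= x' (ev v) by apply/ltW; case: (adm_non A' vT vr).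
have xs : x (ev v) <= t v by rewrite tv; case: (adm_non A vT vr).
have := gfun_diff_le x'0 (x'le vT vr) xs (t_gt0 vT) tt; lra.
Qed.

Let step3 : Lam x t + pi * kap b <= Lam x s + pi * kap (s r).
Proof.
pose w v : R := if b < s v then 1 else 0.
pose K := kap b - kap (s r).
have b0 : 0 < b := adm_s_gt0 A' r_in.
(* [w] selects the vertices whose radius is truncated. By the angle equations the signed sum of [G2]
   vanishes at every nonroot vertex and is [pi * K] at the root, so subtracting [G2] accounts
   exactly for the change of [pi * kap]. *)
pose G2 e v := ang (x e) (s v) * (w v * K).
have G2E : signed_sum T r F e0 G2 = pi * K.
  rewrite /signed_sum big_seq_cond big1 ?add0r; last first.
    move=> v /andP[vT vr]; rewrite -mulr_suml -mulrBl.
    by have [_ _ _ _ ->] := adm_non A vT vr; rewrite subrr mul0r.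
  rewrite -mulr_suml; case: (adm_cen A) => _ _ ->; rewrite /w; case: ltP => [_|sb]; first by rewrite mul1r.
  by have -> : K = 0; [rewrite /K -[s r](@le_anti _ _ b) ?subrr// sb andbT|rewrite !mulr0].
pose H e v := gfun (x e) (s v) - gfun (x e) (t v) - G2 e v.
have HE : signed_sum T r F e0 H = Lam x s - Lam x t - pi * K.
  rewrite -G2E !LamE /signed_sum /H !sumrB.
  have -> : forall a1 a2 a3 b1 b2 b3 c1 c2 c3 : R,
    a1 - a2 + a3 - (b1 - b2 + b3) - (c1 - c2 + c3) = (a1 - b1 - c1) - (a2 - b2 - c2) + (a3 - b3 - c3) by move=> *; ring.
  do 2 congr (_ + _).
  by rewrite -!sumrB; apply: eq_bigr => v _; rewrite !sumrB.
suff : 0 <= signed_sum T r F e0 H by rewrite HE /K; lra.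
(* Where nothing is truncated [H] vanishes; where the radius drops from [s r] to b it is nonnegative
   on edges that still fit into radius b. *)
have Hlow e v : v \in sv T -> s v <= b -> H e v = 0.
  by move=> vT sb; rewrite /H /G2 /w ltNge sb /= /t min_l// mul0r mulr0 !subrr.
have Hhigh e v : v \in sv T -> b < s v -> s v = s r -> 0 < x e <= b -> 0 <= H e v.
  move=> vT bs sr /andP[x0 xb]; rewrite /H /G2 /w bs mul1r /t (min_r (ltW bs)) sr.
  have xb' : 0 <= x e <= b by rewrite ltW.
  have := gfun_chord xb' b0 s'r; rewrite /K -/b; lra.
rewrite (signed_sumE e0 T_tree r_in F_frontier) addr_ge0//.
  rewrite big_seq_cond sumr_ge0// => v /andP[vT vr].
  have pT := par_in e0 T_tree r_in vT vr.
  have [sb|[bs sr]] := s_cases' vT.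
    rewrite (Hlow _ v)// subr0; have [sb'|[bs' sr']] := s_cases' pT; first by rewrite Hlow.
    apply: Hhigh => //; have [_ -> h _ _] := adm_non A vT vr; exact: le_trans h sb.
  (* By [s_cases] all radii above b equal [s r], so an edge with truncated lower end has the same
     radius at both ends and cancels. An edge leaving the truncated part contributes only at its
     upper end, with a plus sign. *)
  have sp : s (par v) = s r by apply/le_anti; rewrite (adm_le_root A pT) -sr (adm_par A vT vr).
  by rewrite /H /G2 /w /t sp sr subrr.
rewrite big_seq sumr_ge0// => v vT; rewrite big_seq_cond sumr_ge0// => e /andP[es eF].
have [sb|[bs sr]] := s_cases' vT; first by rewrite Hlow.
apply: Hhigh => //; rewrite -x'F//; have /andP[-> h] := adm_star_le A' vT es.
exact: le_trans h (adm_le_root A' vT).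
Qed.

Lemma area_decrease : (exists v, [/\ v \in sv T, v != r & s' v != Num.min (s v) (s' r)]) ->
  area T r F e0 x' s' < area T r F e0 x s.
Proof.
move=> h; rewrite /area ltrD2r.
apply: lt_le_trans step3; rewrite ltrD2r; exact: lt_le_trans (step1 h) step2.
Qed.

End area_decrease.

(** * Deformation of clusters *)

Lemma cvg_big_sum (R : realType) (I : eqType) (t : seq I) (P : pred I) (f : I -> R -> R) (l : I -> R)
    (K : set_system R) : Filter K -> (forall i, i \in t -> P i -> f i z @[z --> K] --> l i) ->
  (\sum_(i <- t | P i) f i z) @[z --> K] --> \sum_(i <- t | P i) l i.
Proof.
move=> FK; elim: t => [|i t IH] h.
  by under eq_fun do rewrite big_nil; rewrite big_nil; exact: cvg_cst.
rewrite big_cons; under eq_fun do rewrite big_cons.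
have {}IH := IH (fun j jt => h j (mem_behead (s := i :: t) jt)).
case: ifPn => // Pi; apply: cvgD => //; exact: h (mem_head _ _) Pi.
Qed.

Lemma cvg_ang (R : realType) (K : set_system R) (y s : R -> R) (y0 s0 : R) : Filter K -> 0 < s0 ->
  y z @[z --> K] --> y0 -> s z @[z --> K] --> s0 -> ang (y z) (s z) @[z --> K] --> ang y0 s0.
Proof.
move=> FK s0P hy hs; rewrite /ang.
apply: (@cvg_comp _ _ _ (fun z => y z / s z) (@asc R) K (nbhs (y0 / s0)) _); last exact: continuous_asc.
by apply: cvgM => //; apply: cvgV => //; rewrite gt_eqF.
Qed.

Lemma near_fset (I : choiceType) (R : Type) (t : {fset I}) (K : set_system R) {FK : Filter K} (Q : I -> set R) :
  (forall i, i \in t -> \forall z \near K, Q i z) -> \forall z \near K, forall i, i \in t -> Q i z.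
Proof.
by move=> h; have := filter_bigI FK h; apply: filterS => z /= hz i it; exact: hz.
Qed.

Section deformation.
Local Open Scope fset_scope.
Local Open Scope ring_scope.
Variables (R : realType) (V : graph) (T : subgraph V) (r : gvert V) (F : {fset gedge V}) (e0 : gedge V).
Hypotheses (T_tree : is_tree T) (r_in : r \in sv T) (F_frontier : is_frontier T F).
Implicit Types (u v w : gvert V) (e f : gedge V).
Local Notation ev := (ev T r e0).
Local Notation par := (par T r).

Let maxdepth := (\max_(v <- sv T) depth T r v).+1.

Let depth_lt v : v \in sv T -> (depth T r v < maxdepth)%N.
Proof. by move=> vT; rewrite ltnS (leq_bigmax_seq (F := depth T r)). Qed.

(** Induction from the leaves to the root, by decreasing depth. *)
Lemma tree_coind (P : gvert V -> Prop) :
  (forall v, v \in sv T -> (forall u, u \in sv T -> u != r -> par u = v -> P u) -> P v) ->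
  forall v, v \in sv T -> P v.
Proof.
move=> H v; have : (maxdepth <= depth T r v + maxdepth)%N by rewrite leq_addl.
move: {2}maxdepth => k; elim: k v => [|k IH] v hk vT; apply: H => // u uT ur uv.
  by move: hk; rewrite addn0 leqNgt depth_lt.
by apply: IH => //; rewrite (depth_par e0 T_tree r_in uT ur) uv addSnnS.
Qed.

Variables (x : gedge V -> R) (s : gvert V -> R) (c : R) (S : gvert V -> Prop).
Hypotheses (A : adm T r F e0 x s) (c0 : 0 < c)
  (S_cluster : forall v, S v -> [/\ v \in sv T, v != r, s v = c & x (ev v) < c])
  (S_closed : forall v, v \in sv T -> v != r -> S (par v) -> s v = c -> S v).

(** The vertex of [S] whose edge toward the root is e; the root is a junk value for other edges. *)
Let bottom e := xget r [set v | S v /\ e = ev v].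

Let bottom_ev v : S v -> bottom (ev v) = v.
Proof.
move=> Sv; have [Su E] : S (bottom (ev v)) /\ ev v = ev (bottom (ev v)).
  by apply: (@xgetPex _ r [set u | S u /\ ev v = ev u]); exists v.
have [uT ur _ _] := S_cluster Su; have [vT vr _ _] := S_cluster Sv.
by apply/esym/(ev_inj T_tree r_in vT vr uT ur E).
Qed.

(* The edges below S are determined by the angle equations at radius t, leaves
   first: each iteration makes one more level of the tree correct. *)
Fixpoint deform_iter k (t : R) e : R := if k is k'.+1 then
    if `[< exists2 v, S v & e = ev v >]
    then t * sin (\sum_(f <- star T F (bottom e) | f != e) ang (deform_iter k' t f) t)
    else x e
  else x e.

Let X_S k t v : S v -> deform_iter k.+1 t (ev v) =
  t * sin (\sum_(f <- star T F v | f != ev v) ang (deform_iter k t f) t).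
Proof. by move=> Sv /=; rewrite bottom_ev//; case: asboolP => // -[]; exists v. Qed.

Let X_off k t e : (forall v, S v -> e != ev v) -> deform_iter k t e = x e.
Proof.
by move=> h; case: k => //= k; case: asboolP => // -[v /h/eqP].
Qed.

Let star_S v f : S v -> f \in star T F v -> f != ev v ->
  (forall u, S u -> f != ev u) \/ (exists u, [/\ u \in sv T, u != r, par u = v, S u & f = ev u]).
Proof.
move=> Sv fs fv; have [[u Su E]|h] := pselect (exists2 u, S u & f = ev u); last first.
  by left => u Su; apply/eqP => E; apply: h; exists u.
right; have [uT ur _ _] := S_cluster Su.
have [fF|[E' _ _]|[u' [u'T u'r u'v E']]] := star_cases e0 T_tree r_in fs.
- by have := F_se F_frontier fF; rewrite E (ev_se e0 T_tree r_in uT ur).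
- by rewrite E' eqxx in fv.
- have /(ev_inj T_tree r_in uT ur u'T u'r) uu : ev u = ev u' by rewrite -E -E'.
  by exists u; split => //; rewrite uu.
Qed.

(** The value at an edge depends only on edges one level deeper, so it is settled once the number of
    iterations reaches the remaining height. *)
Let X_stable k t v : S v -> (maxdepth <= depth T r v + k)%N ->
  deform_iter k.+1 t (ev v) = deform_iter k t (ev v).
Proof.
elim: k v => [|k IH] v Sv hk; have [vT vr _ _] := S_cluster Sv.
  by move: hk; rewrite addn0 leqNgt depth_lt.
rewrite !X_S//; congr (_ * sin _).
rewrite big_seq_cond [RHS]big_seq_cond; apply: eq_bigr => f /andP[fs fv].
have [h|[u [uT ur uv Su ->]]] := star_S Sv fs fv; first by rewrite !X_off.
by rewrite IH// (depth_par e0 T_tree r_in uT ur) uv addSnnS.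
Qed.

Let X t e := deform_iter maxdepth t e.

Let X_eq t v : S v -> X t (ev v) = t * sin (\sum_(f <- star T F v | f != ev v) ang (X t f) t).
Proof. by move=> Sv; rewrite -X_S// X_stable// leq_addl. Qed.

Let sumx v : S v -> \sum_(f <- star T F v | f != ev v) ang (x f) c = ang (x (ev v)) c.
Proof.
by move=> Sv; have [vT vr sv _] := S_cluster Sv; rewrite -sv; case: (adm_non A vT vr).
Qed.

(** At t = c the recursion is solved by x itself, by the angle equations, and every operation in it
    is continuous. *)
Let X_cvg k e : deform_iter k z e @[z --> c^'-] --> x e.
Proof.
elim: k e => [|k IH] e; first exact: cvg_cst.
have [[v Sv ->]|h] := pselect (exists2 v, S v & e = ev v); last first.
  have off v : S v -> e != ev v by move=> Sv; apply/eqP => E; apply: h; exists v.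
  have -> : (fun z => deform_iter k.+1 z e) = cst (x e) by apply/funext => z; exact: X_off.
  exact: cvg_cst.
have [vT vr sv xv] := S_cluster Sv; have xv0 : 0 < x (ev v) by case: (adm_non A vT vr).
under eq_fun do rewrite X_S//.
have -> : x (ev v) = c * sin (\sum_(f <- star T F v | f != ev v) ang (x f) c).
  by rewrite sumx// sin_ang// !ltW.
have idc : z @[z --> c^'-] --> c by apply: cvg_at_left_filter; exact: cvg_id.
apply: cvgM => //.
apply: (@cvg_comp _ _ _ (fun z => \sum_(f <- star T F v | f != ev v) ang (deform_iter k z f) z) (@sin R)
   (c^'-) (nbhs (\sum_(f <- star T F v | f != ev v) ang (x f) c)) _); last exact: continuous_sin.
by apply: cvg_big_sum => f _ _; apply: cvg_ang.
Qed.

Let pi2 : 0 < pi / 2 :> R. Proof. exact: pi2_gt0. Qed.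

Let near_in v t := S v -> [/\ x (ev v) < t,
  \sum_(f <- star T F v | f != ev v) ang (X t f) t < pi / 2 &
  forall f, f \in star T F v -> f != ev v -> X t f < X t (ev v)].

(** A child of a cluster vertex outside the cluster has radius strictly below c by [S_closed], so a
    radius t near c still dominates it. *)
Let near_below u t := u != r -> S (par u) -> ~ S u -> s u <= t.

Let nearS t := [/\ 0 < t, t < c, forall v, v \in sv T -> near_in v t &
  forall u, u \in sv T -> near_below u t].

Let nearS_near : \forall t \near c^'-, nearS t.
Proof.
have idc : z @[z --> c^'-] --> c by apply: cvg_at_left_filter; exact: cvg_id.
have n1 : \forall t \near c^'-, forall v, v \in sv T -> near_in v t.
  apply: (near_fset (Q := near_in)) => v vT.
  have [Sv|nSv] := pselect (S v); last by apply: nearW => t /nSv.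
  have [_ vr sv xv] := S_cluster Sv; have [_ _ _ lx _] := adm_non A vT vr.
  have h1 : \forall t \near c^'-, x (ev v) < t by exact: nbhs_left_gt.
  have h2 : \forall t \near c^'-, \sum_(f <- star T F v | f != ev v) ang (X t f) t < pi / 2.
    have : \sum_(f <- star T F v | f != ev v) ang (x f) c < pi / 2.
      have x0 : 0 < x (ev v) by case: (adm_non A vT vr).
      by rewrite sumx// -(angxx c0) ang_lt// ?(ltW x0) ?(ltW c0) ?lexx ?(ltW xv).
    by apply: cvgr_lt; apply: cvg_big_sum => f _ _; apply: cvg_ang => //; exact: X_cvg.
  have h3 : \forall t \near c^'-, forall f, f \in star T F v -> f != ev v -> X t f < X t (ev v).
    apply: (near_fset (Q := fun f t => f != ev v -> X t f < X t (ev v))) => f fs; have [->|fv] := eqVneq f (ev v); first by apply: nearW.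
    have : x f - x (ev v) < 0 by rewrite subr_lt0 lx.
    have C : (X t f - X t (ev v)) @[t --> c^'-] --> x f - x (ev v) by apply: cvgB; exact: X_cvg.
    by move=> h; apply: (filterS _ (cvgr_lt _ C _ h)) => t + _; rewrite subr_lt0.
  by near=> t => Sv'; split; near: t.
have n2 : \forall t \near c^'-, forall u, u \in sv T -> near_below u t.
  apply: (near_fset (Q := near_below)) => u uT; have [[ur [Sp nSu]]|h] := pselect (u != r /\ (S (par u) /\ ~ S u)).
    have [pT pr sp xp] := S_cluster Sp.
    have : s u < c.
      rewrite lt_neqAle -{2}sp (adm_par A uT ur) andbT; apply/eqP => su; exact/nSu/S_closed.
    by move=> /nbhs_left_ge h; apply: (filterS _ h) => t ? _ _ _.
  by apply: nearW => t ur Sp nSu; exfalso; apply: h.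
near=> t; split; [| |by near: t|by near: t].
- by near: t; exact: nbhs_left_gt.
- by near: t; exact: nbhs_left_lt.
Unshelve. all: by end_near. Qed.

(** From the leaves up: all edges below v have larger angles at t than at c, so their sum [Sg]
    exceeds the old angle of [ev v]. They are no longer than before, so by [ang_cross] that sum
    stays below the angle of the old [ev v] at t, and the new [ev v] is shorter. *)
Let X_below t : nearS t -> forall v, v \in sv T -> S v ->
  [/\ vnon T F v (ev v) (X t) t, X t (ev v) < x (ev v) & ang (x (ev v)) c < ang (X t (ev v)) t].
Proof.
move=> [t0 tc h1 h2]; apply: tree_coind => v vT IH Sv.
have [_ vr sv xc] := S_cluster Sv; have [xt Xpi lX] := h1 v vT Sv.
have [vs xv0 xvs lx E] := adm_non A vT vr; rewrite sv in xvs E.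
have Xcmp f : f \in star T F v -> f != ev v -> [/\ 0 < X t f, X t f <= x f & ang (x f) c < ang (X t f) t].
  move=> fs fv; have [h|[u [uT ur uv Su ->]]] := star_S Sv fs fv.
    rewrite /X X_off//; have f0 := adm_gt0 A (star_sub fs); split => //.
    by apply: ang_anti_lt => //; apply/ltW/(lt_trans _ xt)/lx.
  by have [[_ ? _ _ _] /ltW ? ?] := IH u uT ur uv Su.
set Sg := \sum_(f <- star T F v | f != ev v) ang (X t f) t in Xpi.
have [g gs gv] : exists2 g, g \in star T F v & g != ev v.
  apply: contrapT => h; have := ang_gt0 xv0 c0; rewrite -E big_seq_cond big1 ?ltxx// => g /andP[gs gv].
  by exfalso; apply: h; exists g.
have Sg_gt : ang (x (ev v)) c < Sg.
  rewrite -E; apply: (@ltr_sum_mem _ _ _ _ _ _ g) => // [f fs fv|]; last by case: (Xcmp g gs gv).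
  by apply/ltW; case: (Xcmp f fs fv).
have Sg_le : Sg <= \sum_(f <- star T F v | f != ev v) ang (x f) t.
  by apply: ler_sum_mem => f fs fv; apply: ang_le => //; case: (Xcmp f fs fv).
have Sg0 : 0 < Sg by apply: le_lt_trans Sg_gt; apply: ang_ge0 => //; exact: ltW.
(* Used backwards: if the other sides already balanced the longest one at t < c, they would strictly
   exceed it at c, where equality holds. *)
have Sg_lt : Sg < ang (x (ev v)) t.
  apply: (le_lt_trans Sg_le); rewrite ltNge; apply/negP.
  rewrite big_seq_cond => /(ang_cross xv0 (ltW xt) tc) H.
  suff : ang (x (ev v)) c < ang (x (ev v)) c by rewrite ltxx.
  rewrite -[ltRHS]E [ltRHS]big_seq_cond; apply: H => f /andP[fs fv].
  by rewrite lx// andbT ltW// (adm_gt0 A)// (star_sub fs).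
have Xv : X t (ev v) = t * sin Sg by rewrite X_eq.
have angX : ang (X t (ev v)) t = Sg by rewrite Xv angK// !ltW.
have Xx : X t (ev v) < x (ev v).
  by rewrite ltNge; apply/negP => /(ang_le t0); rewrite angX leNgt Sg_lt.
split => //; last by rewrite angX.
split => //.
  by rewrite Xv mulr_gt0// sin_gt0_pihalf// Sg0.
exact/ltW/(lt_trans Xx).
Qed.

Lemma deform : exists X : R -> gedge V -> R,
 [/\ forall t e, (forall v, S v -> e != ev v) -> X t e = x e,
     forall e, X t e @[t --> c^'-] --> x e &
     \forall t \near c^'-, [/\ 0 < t, t < c,
       forall v, S v -> [/\ vnon T F v (ev v) (X t) t, X t (ev v) < x (ev v)
         & ang (x (ev v)) c < ang (X t (ev v)) t] &
       forall u, u \in sv T -> u != r -> S (par u) -> ~ S u -> s u <= t]].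
Proof.
exists X; split; [by move=> t e; exact: X_off|by move=> e; exact: X_cvg|].
apply: (filterS _ nearS_near) => t nS; have [t0 tc _ h] := nS.
by split => // v Sv; apply: X_below => //; case: (S_cluster Sv).
Qed.

End deformation.

Lemma near_left_ex (R : realType) (c : R) (P : set R) : (\forall t \near c^'-, P t) ->
  exists2 q, q < c & forall t, q < t -> t < c -> P t.
Proof.
move=> [e /= e0 he]; exists (c - e); first lra.
by move=> t qt tc; apply: he => //=; rewrite ger0_norm; lra.
Qed.

Lemma seq_argmax (R : realType) (I : eqType) (t : seq I) (P : I -> Prop) (f : I -> R) i0 :
  i0 \in t -> P i0 -> exists i, [/\ i \in t, P i & forall j, j \in t -> P j -> f j <= f i].
Proof.
elim: t i0 => // a t IH i0.
have [[j [jt Pj]] _ _|h] := pselect (exists j, j \in t /\ P j).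
  have [i [it Pi hi]] := IH j jt Pj.
  have [[Pa fa]|h] := pselect (P a /\ f i <= f a).
    exists a; rewrite mem_head; split => // k; rewrite inE => /orP[/eqP -> //|kt Pk].
    exact: le_trans (hi k kt Pk) fa.
  exists i; rewrite inE it orbT; split => // k; rewrite inE => /orP[/eqP -> Pa|kt Pk]; last exact: hi.
  by rewrite leNgt; apply/negP => fa; apply: h; rewrite ltW.
rewrite inE => /orP[/eqP -> Pa|it Pi]; last by exfalso; apply: h; exists i0.
exists a; rewrite mem_head; split => // k; rewrite inE => /orP[/eqP -> //|kt Pk].
by exfalso; apply: h; exists k.
Qed.

(** A difference of angle sums need not be monotone in the radius, so both orders of the endpoint
    values are allowed. *)
Lemma ang_sum_IVT (R : realType) (I : Type) (t : seq I) (P : pred I) (x : I -> R) (y a b l : R) : 0 < a -> a <= b ->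
  \sum_(i <- t | P i) ang (x i) b - ang y b <= l <= \sum_(i <- t | P i) ang (x i) a - ang y a \/
  \sum_(i <- t | P i) ang (x i) a - ang y a <= l <= \sum_(i <- t | P i) ang (x i) b - ang y b ->
  exists2 m, a <= m <= b & \sum_(i <- t | P i) ang (x i) m - ang y m = l.
Proof.
move=> a0 ab h.
have ct : {within `[a, b], continuous (fun m => \sum_(i <- t | P i) ang (x i) m - ang y m)}.
  apply: continuous_in_subspaceT => m; rewrite inE/= in_itv/= => /andP[am _].
  have m0 : 0 < m by exact: lt_le_trans am.
  apply: cvgB; last exact: continuous_ang.
  elim: t {h} => [|i t IH]; first by under eq_fun do rewrite big_nil; rewrite big_nil; exact: cvg_cst.
  rewrite big_cons; under eq_fun do rewrite big_cons.
  by case: (P i) => //; apply: cvgD => //; exact: continuous_ang.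
have [m mI mE] : exists2 m, m \in `[a, b] & \sum_(i <- t | P i) ang (x i) m - ang y m = l.
  apply: (IVT ab ct); case: h => /andP[h1 h2]; rewrite ge_min le_max; apply/andP; split; apply/orP; lra.
by exists m => //; move: mI; rewrite in_itv.
Qed.

(** * Clusters of nonsemicyclic vertices of equal radius *)

Section clusters.
Local Open Scope fset_scope.
Local Open Scope ring_scope.
Variables (R : realType) (V : graph) (T : subgraph V) (r : gvert V) (F : {fset gedge V}) (e0 : gedge V).
Hypotheses (T_tree : is_tree T) (r_in : r \in sv T) (F_frontier : is_frontier T F).
Implicit Types (u v w : gvert V) (e f : gedge V).
Local Notation ev := (ev T r e0).
Local Notation par := (par T r).

Lemma star_ev v u : u \in sv T -> u != r -> ev u \in star T F v -> v = u \/ v = par u.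
Proof. by move=> uT ur; rewrite starE ends_ev// !inE => /andP[_ /orP[]/eqP]; [left|right]. Qed.

Lemma vnon_ext v f x y s : (forall e, e \in star T F v -> y e = x e) ->
  vnon T F v f x s -> vnon (R := R) T F v f y s.
Proof.
move=> h [fs f0 fs' lx E]; split; rewrite ?h//; first by move=> e es ef; rewrite h// lx.
by rewrite -E big_seq_cond [RHS]big_seq_cond; apply: eq_bigr => e /andP[es _]; rewrite h.
Qed.

Lemma vcen_ext v x y s : (forall e, e \in star T F v -> y e = x e) ->
  vcen T F v x s -> vcen (R := R) T F v y s.
Proof.
move=> h [s0 lx E]; split => //; first by move=> e es; rewrite h// lx.
by rewrite -E; apply: eq_big_seq => e es; rewrite h.
Qed.

Variables (x : gedge V -> R) (s : gvert V -> R) (close : gedge V -> R -> Prop).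
Hypotheses (A : adm T r F e0 x s)
  (close_near : forall e, e \in se T -> \forall y \near x e, close e y).

(** [Q] restricts the tops only. Below a top all descendants reached through radius c are taken;
    they are automatically nonsemicyclic, because their edges are shorter than the edge above
    ([x_child_lt]). *)
Inductive cluster (Q : gvert V -> Prop) (c : R) : gvert V -> Prop :=
| cluster_top v of v \in sv T & v != r & Q v & s v = c & x (ev v) < c : cluster Q c v
| cluster_step v of v \in sv T & v != r & s v = c & cluster Q c (par v) : cluster Q c v.

Lemma x_child_lt v : v \in sv T -> v != r -> par v != r -> x (ev v) < x (ev (par v)).
Proof.
move=> vT vr pr; have pT := par_in e0 T_tree r_in vT vr.
have [_ _ _ lx _] := adm_non A pT pr; apply: lx; first exact: ev_star_par.
by apply/eqP => /(ev_inj T_tree r_in vT vr pT pr) /esym /eqP; apply/negP; exact: par_neq.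
Qed.

Lemma clusterP Q c v : cluster Q c v -> [/\ v \in sv T, v != r, s v = c & x (ev v) < c].
Proof.
elim=> {v} [v vT vr _ sv xv|v vT vr sv _ [pT pr sp xp]]; split => //.
exact: lt_trans (x_child_lt vT vr pr) xp.
Qed.

Lemma cluster_inv Q c v : cluster Q c v -> Q v \/ cluster Q c (par v).
Proof. by case=> {}v; [left|right]. Qed.

Lemma cluster_par Q c w v : (forall u, Q u -> par u = w) -> cluster Q c v -> par v = w \/ cluster Q c (par v).
Proof. by move=> h; case=> {}v; [move=> _ _ /h; left|right]. Qed.

Lemma cluster_depth Q c w v : (forall u, Q u -> par u = w) -> cluster Q c v -> (depth T r w < depth T r v)%N.
Proof.
move=> h; elim=> {v} [v vT vr /h <- _ _|v vT vr _ _ IH]; rewrite (depth_par e0 T_tree r_in vT vr)//.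
exact: ltnW.
Qed.

Lemma cluster_deform Q c w : 0 < c -> (forall u, Q u -> par u = w) ->
  exists X : R -> gedge V -> R,
  [/\ forall t e, (forall v, cluster Q c v -> e != ev v) -> X t e = x e,
      forall e, X t e @[t --> c^'-] --> x e &
      exists2 q, q < c & forall t, q < t -> t < c ->
      [/\ 0 < t, forall e, e \in se T -> close e (X t e),
        forall e, e \in se T `|` F -> 0 < X t e <= x e,
        forall v, cluster Q c v -> [/\ vnon T F v (ev v) (X t) t, X t (ev v) < x (ev v)
          & ang (x (ev v)) c < ang (X t (ev v)) t] &
        forall u, u \in sv T -> u != r -> cluster Q c (par u) -> ~ cluster Q c u -> s u <= t]].
Proof.
move=> c0 hQ.
have [X [Xoff Xc Xnear]] := deform T_tree r_in F_frontier A c0 (@clusterP Q c)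
  (fun v vT vr p sv => cluster_step vT vr sv p).
exists X; split => //; apply: near_left_ex.
have cl : \forall t \near c^'-, forall e, e \in se T -> close e (X t e).
  apply: (near_fset (Q := fun e t => close e (X t e))) => e eT.
  exact: (Xc e _ (close_near eT)).
near=> t.
have [t0 tc h1 h2] : [/\ 0 < t, t < c,
       forall v, cluster Q c v -> [/\ vnon T F v (ev v) (X t) t, X t (ev v) < x (ev v)
         & ang (x (ev v)) c < ang (X t (ev v)) t] &
       forall u, u \in sv T -> u != r -> cluster Q c (par u) -> ~ cluster Q c u -> s u <= t] by near: t.
split => //; first by near: t.
move=> e eT; have [[v Sv ->]|h] := pselect (exists2 v, cluster Q c v & e = ev v).
  by have [[_ -> _ _ _] /ltW] := h1 v Sv.
rewrite Xoff; first by rewrite (adm_gt0 A) ?lexx.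
by move=> v Sv; apply/eqP => E; apply: h; exists v.
Unshelve. all: by end_near. Qed.

End clusters.

Lemma ang_sum_IVT_decr (R : realType) (I : Type) (t : seq I) (P : pred I) (x : I -> R) (a b l : R) : 0 < a -> a <= b ->
  \sum_(i <- t | P i) ang (x i) b <= l <= \sum_(i <- t | P i) ang (x i) a ->
  exists2 m, a <= m <= b & \sum_(i <- t | P i) ang (x i) m = l.
Proof.
have a0 m : ang 0 m = 0 :> R by rewrite /ang mul0r asc0.
move=> a_gt0 ab h; have [|m mI mE] := @ang_sum_IVT _ _ t P x 0 a b l a_gt0 ab.
  by left; rewrite !a0 !subr0.
by exists m => //; move: mE; rewrite a0 subr0.
Qed.

Lemma between_max (R : realType) (q1 q2 c : R) : q1 < c -> q2 < c ->
  exists t, [/\ q1 < t, q2 < t & t < c].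
Proof.
move=> h1 h2; exists ((Num.max q1 q2 + c) / 2).
have : q1 <= Num.max q1 q2 by rewrite le_max lexx.
have : q2 <= Num.max q1 q2 by rewrite le_max lexx orbT.
have : Num.max q1 q2 < c by rewrite gt_max h1.
by move=> *; split; lra.
Qed.

(** * Moves that decrease the area *)

Section moves.
Local Open Scope fset_scope.
Local Open Scope ring_scope.
Variables (R : realType) (V : graph) (T : subgraph V) (r : gvert V) (F : {fset gedge V}) (e0 : gedge V).
Hypotheses (T_tree : is_tree T) (r_in : r \in sv T) (F_frontier : is_frontier T F).
Implicit Types (u v w : gvert V) (e f : gedge V).
Local Notation ev := (ev T r e0).
Local Notation par := (par T r).
Variables (x : gedge V -> R) (s : gvert V -> R) (close : gedge V -> R -> Prop).
Hypotheses (A : adm T r F e0 x s)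
  (close_near : forall e, e \in se T -> \forall y \near x e, close e y).
Hypothesis area_min : forall x' s', adm T r F e0 x' s' -> (forall f, f \in F -> x' f = x f) ->
  (forall e, e \in se T -> close e (x' e)) -> area T r F e0 x s <= area T r F e0 x' s'.
Local Notation cluster := (cluster T r e0 x s).

Lemma area_min_contra x' s' : adm T r F e0 x' s' -> (forall f, f \in F -> x' f = x f) ->
  (forall e, e \in se T -> close e (x' e) /\ x' e <= x e) -> s' r <= s r ->
  (forall v, v \in sv T -> v != r -> s v <= s' r \/ s v = s r) ->
  (exists v, [/\ v \in sv T, v != r & s' v != Num.min (s v) (s' r)]) -> False.
Proof.
move=> A' x'F cl s'r sc ex.
have x'le v : v \in sv T -> v != r -> x' (ev v) <= x (ev v).
  by move=> vT vr; case: (cl _ (ev_se e0 T_tree r_in vT vr)).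
have := area_decrease T_tree r_in F_frontier A A' x'F x'le s'r sc ex.
by rewrite ltNge area_min// => e /cl[].
Qed.

Lemma cluster_off_F Q c f : f \in F -> forall v, cluster Q c v -> f != ev v.
Proof.
move=> fF v /(clusterP T_tree r_in A)[vT vr _ _]; apply/eqP => E.
by move: (F_se F_frontier fF); rewrite E (ev_se e0 T_tree r_in vT vr).
Qed.

Lemma cluster_off_star Q c w v e : (forall u, Q u -> par u = w) -> v != w -> ~ cluster Q c v ->
  e \in star T F v -> forall u, cluster Q c u -> e != ev u.
Proof.
move=> hQ vw nSv es u Su; apply/eqP => E; have [uT ur _ _] := clusterP T_tree r_in A Su.
move: es; rewrite E => /(star_ev T_tree r_in uT ur)[vu|vp]; first by apply: nSv; rewrite vu.
by have [pw|Sp] := cluster_par hQ Su; [rewrite vp pw eqxx in vw|apply: nSv; rewrite vp].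
Qed.

Lemma root_not_cluster Q c : ~ cluster Q c r.
Proof. by move=> /(clusterP T_tree r_in A)[_]; rewrite eqxx. Qed.

Lemma base_not_cluster Q c w : (forall u, Q u -> par u = w) -> ~ cluster Q c w.
Proof. by move=> hQ /(cluster_depth T_tree r_in hQ); rewrite ltnn. Qed.

(* The radius at w has room below that of its parent, so the shrunken cluster
   below w is accommodated by enlarging the radius at w only. *)
Lemma move_inner w u0 : w \in sv T -> w != r -> s w < s (par w) ->
  u0 \in sv T -> u0 != r -> par u0 = w -> x (ev u0) < s u0 -> False.
Proof.
move=> wT wr sw u0T u0r u0w bad0.
have [u1 [u1T [u1r u1w bad1] u1max]] := @seq_argmax _ _ (sv T)
  (fun u => [/\ u != r, par u = w & x (ev u) < s u]) s u0 u0T (And3 u0r u0w bad0).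
pose c := s u1; pose Q u := par u = w.
have hQ u : Q u -> par u = w by [].
have c0 : 0 < c := adm_s_gt0 A u1T.
have cw : c <= s w by rewrite -u1w; exact: (adm_par A).
have [X [Xoff Xc [q1 q1c H1]]] := cluster_deform T_tree r_in F_frontier A close_near c0 hQ.
pose y1 := s (par w).
have [ws xw0 xws lx E] := adm_non A wT wr.
have xstar e : e \in star T F w -> 0 < x e by move=> es; apply: (adm_gt0 A); exact: star_sub es.
(* By [ang_cross] the other angles at w exceed that of the longest edge at the radius of the parent;
   being strict, this survives a small shortening of the cluster. *)
have big1 : \sum_(e <- star T F w | e != ev w) ang (x e) y1 - ang (x (ev w)) y1 > 0.
  rewrite subr_gt0 big_seq_cond; apply: (ang_cross xw0 xws sw).
    by move=> e /andP[es ne]; rewrite lx// andbT ltW// xstar.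
  by rewrite -[leLHS]E [leLHS]big_seq_cond.
have y10 : 0 < y1 by apply: lt_trans sw; exact: (adm_s_gt0 A).
have [q2 q2c H2] : exists2 q, q < c & forall t, q < t -> t < c ->
    0 < \sum_(e <- star T F w | e != ev w) ang (X t e) y1 - ang (x (ev w)) y1.
  apply: near_left_ex; apply: (cvgr_gt _ _ _ big1).
  by apply: cvgB; [apply: cvg_big_sum => e _ _; apply: cvg_ang => //; exact: cvg_cst|exact: cvg_cst].
have [t [q1t q2t tc]] := between_max q1c q2c.
have [t0 cl X0 XS Xpar] := H1 t q1t tc; have {H2} H2 := H2 t q2t tc.
have XF e : e \in star T F w -> 0 < X t e <= x e by move=> es; apply: X0; exact: star_sub es.
have nSw := @base_not_cluster Q c w hQ.
have Xev : X t (ev w) = x (ev w).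
  apply: Xoff => v Sv; apply/eqP => E1; have [vT vr _ _] := clusterP T_tree r_in A Sv.
  by apply: nSw; rewrite (ev_inj T_tree r_in wT wr vT vr E1).
(* At [s w] the shortened edges have at most the required angle sum, at [y1] more than required; the
   new radius of w lies between, hence below that of its parent. *)
have [y /andP[wy yy1] yE] : exists2 y, s w <= y <= y1 &
    \sum_(e <- star T F w | e != ev w) ang (X t e) y - ang (x (ev w)) y = 0.
  apply: ang_sum_IVT; [exact: (adm_s_gt0 A)|exact: ltW|right].
  rewrite (ltW H2) andbT subr_le0 -E; apply: ler_sum_mem => e es _; apply: ang_le.
    exact: (adm_s_gt0 A).
  by case/andP: (XF e es).
pose s' v := if `[< cluster Q c v >] then t else if v == w then y else s v.
have s'S v : cluster Q c v -> s' v = t by rewrite /s'; case: asboolP.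
have s'w : s' w = y by rewrite /s'; case: asboolP => //; rewrite eqxx.
have s'N v : ~ cluster Q c v -> v != w -> s' v = s v.
  by rewrite /s'; case: asboolP => // _ _ /negbTE ->.
have pw : par w != w by exact: par_neq.
have nSp : ~ cluster Q c (par w).
  by move=> /(cluster_depth T_tree r_in hQ); rewrite (depth_par e0 T_tree r_in wT wr) ltnNge leqnSn.
have wr' : r != w by rewrite eq_sym.
have s'r : s' r = s r by apply: s'N => //; exact: root_not_cluster.
have A' : adm T r F e0 (X t) s'.
  split.
  - by move=> e /X0/andP[].
  - move=> v vT vr; have [Sv|nSv] := pselect (cluster Q c v).
      by rewrite s'S//; case: (XS v Sv).
    have [->|vw] := eqVneq v w.
      rewrite s'w; split; rewrite ?Xev//; first exact: le_trans wy.
        move=> e es ne; apply: le_lt_trans (lx e es ne); by case/andP: (XF e es).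
      by apply/eqP; rewrite -subr_eq0 yE.
    rewrite s'N//; apply: vnon_ext (adm_non A vT vr) => e es; apply: Xoff.
    exact: cluster_off_star hQ vw nSv es.
  - rewrite s'r; apply: vcen_ext (adm_cen A) => e es; apply: Xoff.
    by apply: cluster_off_star hQ wr' _ es; exact: root_not_cluster.
  - move=> v vT vr; have [Sv|nSv] := pselect (cluster Q c v).
      rewrite (s'S v)//; have [->|Sp] := cluster_par hQ Sv; last by rewrite s'S.
      by rewrite s'w; exact/ltW/(lt_le_trans tc)/(le_trans cw).
    have [->|vw] := eqVneq v w; first by rewrite s'w s'N.
    rewrite (s'N v)//; have [Sp|nSp'] := pselect (cluster Q c (par v)).
      by rewrite s'S// Xpar.
    have [pvw|pvw] := eqVneq (par v) w; last by rewrite s'N// (adm_par A).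
    by rewrite pvw s'w; apply: le_trans wy; rewrite -pvw (adm_par A).
apply: (area_min_contra A').
- by move=> f fF; apply: Xoff; exact: cluster_off_F.
- by move=> e eT; split; [exact: cl|by have /andP[] : 0 < X t e <= x e by apply: X0; rewrite inE eT].
- by rewrite s'r.
- by move=> v vT vr; left; rewrite s'r (adm_le_root T_tree r_in A).
- exists u1; split => //; rewrite s'r min_l ?(adm_le_root T_tree r_in A)//.
  rewrite s'S; first by rewrite lt_eqF.
  exact: cluster_top.
Qed.

(** A root radius lowered to a value above q passes none of the smaller radii, which is how
    [s_cases] of the area comparison is met. *)
Lemma radii_gap : exists2 q, q < s r & forall v, v \in sv T -> s v < s r -> s v < q.
Proof.
have h : \forall q \near (s r)^'-, forall v, v \in sv T -> s v < s r -> s v < q.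
  apply: (near_fset (Q := fun v q => s v < s r -> s v < q)) => v vT.
  have [sv|sv] := ltP (s v) (s r); last by apply: nearW.
  by apply: (filterS _ (nbhs_left_gt sv)).
have [q1 q1s H] := near_left_ex h.
by exists ((q1 + s r) / 2); [lra|move=> v vT sv; apply: H => //; lra].
Qed.

(* The root radius has room above the root edges, so it shrinks with the cluster. *)
Lemma move_root u0 : (forall e, e \in star T F r -> x e < s r) ->
  u0 \in sv T -> u0 != r -> par u0 = r -> x (ev u0) < s u0 -> False.
Proof.
move=> xr u0T u0r u0w bad0.
(* The largest radius is chosen so that a child of radius [s r], which would exceed the lowered root
   radius, belongs to the cluster. *)
have [u1 [u1T [u1r u1w bad1] u1max]] := @seq_argmax _ _ (sv T)
  (fun u => [/\ u != r, par u = r & x (ev u) < s u]) s u0 u0T (And3 u0r u0w bad0).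
pose c := s u1; pose Q u := par u = r.
have hQ u : Q u -> par u = r by [].
have c0 : 0 < c := adm_s_gt0 A u1T.
have cr : c <= s r := adm_le_root T_tree r_in A u1T.
have [s0 lx E] := adm_cen A.
have xstar e : e \in star T F r -> 0 < x e by move=> es; apply: (adm_gt0 A); exact: star_sub es.
have [X [Xoff Xc [q1 q1c H1]]] := cluster_deform T_tree r_in F_frontier A close_near c0 hQ.
have Su1 : cluster Q c u1 by exact: cluster_top.
have u1s : ev u1 \in star T F r by have := ev_star_par F e0 T_tree r_in u1T u1r; rewrite u1w.
have [q [qs [q0 qx qr]]] : exists q, q < s r /\ [/\ 0 < q, forall e, e \in star T F r -> x e < q &
    forall v, v \in sv T -> s v < s r -> s v < q].
  have [q3 q3s H3] := radii_gap.
  have h4 : \forall q \near (s r)^'-, forall e, e \in star T F r -> x e < q.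
    by apply: (near_fset (Q := fun e q => x e < q)) => e es; apply: nbhs_left_gt; exact: xr.
  have [q4 q4s H4] := near_left_ex h4.
  have [q [q3q q4q qs]] := between_max q3s q4s; exists q; split => //; split.
  - by apply: (lt_trans (xstar _ u1s)); exact: H4.
  - by move=> e es; apply: H4.
  - by move=> v vT sv; apply: (lt_trans (H3 v vT sv)).
have sumq : pi < \sum_(e <- star T F r) ang (x e) q.
  rewrite -E; apply: (@ltr_sum_mem _ _ _ _ _ _ (ev u1)) => // [e es _|]; last first.
    by apply: ang_anti_lt => //; [exact: xstar|apply/ltW/qx].
  by apply: ang_anti => //; [exact/ltW/xstar|exact: ltW].
have [q2 q2c H2] : exists2 q2, q2 < c & forall t, q2 < t -> t < c ->
    pi < \sum_(e <- star T F r) ang (X t e) q.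
  apply: near_left_ex; apply: (cvgr_gt _ _ _ sumq).
  by apply: cvg_big_sum => e _ _; apply: cvg_ang => //; exact: cvg_cst.
have [t [q1t q2t tc]] := between_max q1c q2c.
have [t0 cl X0 XS Xpar] := H1 t q1t tc; have {H2} H2 := H2 t q2t tc.
have XF e : e \in star T F r -> 0 < X t e <= x e by move=> es; apply: X0; exact: star_sub es.
have nSr := @root_not_cluster Q c.
have XvS e : (exists2 v, cluster Q c v & e = ev v) \/ X t e = x e.
  have [h|h] := pselect (exists2 v, cluster Q c v & e = ev v); [by left|right].
  by apply: Xoff => v Sv; apply/eqP => Ee; apply: h; exists v.
(* The new root radius must stay above q, and above the new radius t of the cluster. *)
pose L := Num.max q t.
have L0 : 0 < L by rewrite lt_max q0.
have qL : q <= L by rewrite le_max lexx.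
have tL : t <= L by rewrite le_max lexx orbT.
have Ls : L <= s r by rewrite ge_max (ltW qs) (le_trans (ltW tc)).
have sumL : pi < \sum_(e <- star T F r) ang (X t e) L.
  (* If t exceeds q then c = [s r], since q dominates all smaller radii. At radius t every root edge
     then has a larger angle than before, deformed or not. *)
  rewrite /L; have [//|qt] := leP t q.
  have cs : c = s r.
    apply/eqP; rewrite eq_le cr/= leNgt; apply/negP => /(qr _ u1T) /(lt_trans tc).
    by rewrite ltNge ltW.
  have lt_e e : e \in star T F r -> ang (x e) c < ang (X t e) t.
    move=> es; have [[v Sv ->]|->] := XvS e; first by case: (XS v Sv).
    by apply: ang_anti_lt => //; [exact: xstar|exact/ltW/(lt_trans (qx _ es))].
  rewrite -E -cs; apply: (@ltr_sum_mem _ _ _ _ _ _ (ev u1)) => // [e es _|]; last exact: lt_e.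
  exact/ltW/lt_e.
have [y /andP[Ly ys] yE] : exists2 y, L <= y <= s r & \sum_(e <- star T F r) ang (X t e) y = pi.
  apply: ang_sum_IVT_decr => //; rewrite (ltW sumL) andbT -E; apply: ler_sum_mem => e es _.
  by apply: ang_le => //; case/andP: (XF e es).
have Ly' : L < y.
  by rewrite lt_neqAle Ly andbT; apply/eqP => Ey; move: sumL; rewrite Ey yE ltxx.
pose s' v := if `[< cluster Q c v >] then t else if v == r then y else s v.
have s'S v : cluster Q c v -> s' v = t by rewrite /s'; case: asboolP.
have s'r : s' r = y by rewrite /s'; case: asboolP => //; rewrite eqxx.
have s'N v : ~ cluster Q c v -> v != r -> s' v = s v.
  by rewrite /s'; case: asboolP => // _ _ /negbTE ->.
have y0 : 0 < y by exact: lt_le_trans Ly.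
have s_y v : v \in sv T -> s v < s r -> s v <= y.
  by move=> vT /(qr _ vT)/ltW h; exact/(le_trans h)/(le_trans qL).
have A' : adm T r F e0 (X t) s'.
  split.
  - by move=> e /X0/andP[].
  - move=> v vT vr; have [Sv|nSv] := pselect (cluster Q c v).
      by rewrite s'S//; case: (XS v Sv).
    rewrite s'N//; apply: vnon_ext (adm_non A vT vr) => e es; apply: Xoff.
    exact: cluster_off_star hQ vr nSv es.
  - rewrite s'r; split => // e es; apply: (le_trans _ Ly); apply: (le_trans _ qL).
    by have /andP[_ h] := XF e es; exact: (le_trans h (ltW (qx e es))).
  - move=> v vT vr; have [Sv|nSv] := pselect (cluster Q c v).
      rewrite (s'S v)//; have [->|Sp] := cluster_par hQ Sv; last by rewrite s'S.
      by rewrite s'r; exact: le_trans tL Ly.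
    rewrite (s'N v)//; have [Sp|nSp'] := pselect (cluster Q c (par v)).
      by rewrite s'S// Xpar.
    have [pvw|pvw] := eqVneq (par v) r; last by rewrite s'N// (adm_par A).
    rewrite pvw s'r; have [/s_y ->//|rs] := ltP (s v) (s r).
    have sr : s v = s r by apply/le_anti; rewrite rs (adm_le_root T_tree r_in A).
    have bad : x (ev v) < s v by rewrite sr xr//; have := ev_star_par F e0 T_tree r_in vT vr; rewrite pvw.
    have vc : s v = c by apply/le_anti; rewrite u1max//= sr.
    by exfalso; apply: nSv; apply: cluster_top; rewrite // -vc.
apply: (area_min_contra A').
- by move=> f fF; apply: Xoff; exact: cluster_off_F.
- by move=> e eT; split; [exact: cl|by have /andP[] : 0 < X t e <= x e by apply: X0; rewrite inE eT].
- by rewrite s'r.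
- move=> v vT vr; rewrite s'r; have [/s_y h|rs] := ltP (s v) (s r); first by left; exact: h.
  by right; apply/le_anti; rewrite rs (adm_le_root T_tree r_in A).
(* The radius t at u1 lies below both its old radius and the new root radius, so it is not a
   truncation. *)
- exists u1; split => //; rewrite s'r s'S// lt_eqF// lt_min tc/=.
  exact: le_lt_trans Ly'.
Qed.

(** An edge with parameter [s r] has half-angle pi/2; two of them would leave no angle for a third
    root edge. *)
Lemma root_longest_gt w : (3 <= valence T F r)%N -> w \in sv T -> w != r -> par w = r -> x (ev w) = s r ->
  forall e, e \in star T F r -> e != ev w -> x e < s r.
Proof.
move=> r3 wT wr wp xw e es ew; have [s0 lx E] := adm_cen A.
have ws : ev w \in star T F r by have := ev_star_par F e0 T_tree r_in wT wr; rewrite wp.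
have xstar f : f \in star T F r -> 0 < x f by move=> fs; apply: (adm_gt0 A); exact: star_sub fs.
have /fset0Pn[g gin] : star T F r `\ ev w `\ e != fset0.
  by rewrite -cardfs_gt0; move: r3; rewrite (cardfsD1 (ev w)) ws (cardfsD1 e) !in_fsetD1 ew es !add1n.
move: gin; rewrite in_fsetD1 => /andP[ge]; rewrite in_fsetD1 => /andP[gw gs].
rewrite lt_neqAle lx// andbT; apply/eqP => xe.
move: E; rewrite (bigD1_seq (ev w)) ?fset_uniq//= xw angxx// big_mkcond/= (bigD1_seq e) ?fset_uniq//= ew xe angxx//.
suff : 0 < \sum_(i <- star T F r | i != e) (if i != ev w then ang (x i) (s r) else 0).
  by move=> + h; lra.
rewrite [ltLHS](_ : 0 = \sum_(i <- star T F r | i != e) (0 : R)); last by rewrite big1.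
apply: (@ltr_sum_mem _ _ _ _ _ _ g) => // [i si _|]; last by rewrite gw ang_gt0// xstar.
by case: ifP => // _; rewrite ang_ge0// ltW// xstar.
Qed.

(* The cluster below w shrinks, w is kept semicyclic with the smaller radius m,
   which shortens the longest root edge; the other children of the root with the
   radius of the root are then shrunk to m as a second cluster. *)
Lemma move_longest w u0 : (3 <= valence T F r)%N -> w \in sv T -> w != r -> par w = r -> x (ev w) = s r ->
  u0 \in sv T -> u0 != r -> par u0 = w -> x (ev u0) < s u0 -> False.
Proof.
move=> r3 wT wr wp xw u0T u0r u0w bad0.
have xothers := root_longest_gt r3 wT wr wp xw.
have [u1 [u1T [u1r u1w bad1] u1max]] := @seq_argmax _ _ (sv T)
  (fun u => [/\ u != r, par u = w & x (ev u) < s u]) s u0 u0T (And3 u0r u0w bad0).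
(* [Q2] collects the root children other than w; those of radius [s r] might exceed the new root
   radius. Their edges are strictly shorter than [s r], so they form a cluster. *)
pose c := s u1; pose Q1 u := par u = w; pose Q2 u := par u = r /\ u != w.
have hQ1 u : Q1 u -> par u = w by [].
have hQ2 u : Q2 u -> par u = r by case.
have c0 : 0 < c := adm_s_gt0 A u1T.
have cr : c <= s r := adm_le_root T_tree r_in A u1T.
have [s0 lx E] := adm_cen A.
have [wws xw0 xws lxw Ew] := adm_non A wT wr.
have sw : s w = s r by apply/le_anti; rewrite (adm_le_root T_tree r_in A)//= -xw.
have xstar v e : e \in star T F v -> 0 < x e by move=> es; apply: (adm_gt0 A); exact: star_sub es.
have wrs : ev w \in star T F r by have := ev_star_par F e0 T_tree r_in wT wr; rewrite wp.
have wrE : r != w by rewrite eq_sym.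
pose S1 := cluster Q1 c; pose S2 := cluster Q2 (s r).
have S1P v : S1 v -> [/\ v \in sv T, v != r, s v = c & x (ev v) < c] := clusterP T_tree r_in A (v := v).
have S2P v : S2 v -> [/\ v \in sv T, v != r, s v = s r & x (ev v) < s r] := clusterP T_tree r_in A (v := v).
have S1par v : S1 v -> par v = w \/ S1 (par v) by exact: cluster_par.
have S2par v : S2 v -> par v = r \/ S2 (par v) by exact: cluster_par.
have nS1w : ~ S1 w by exact: base_not_cluster.
have nS1r : ~ S1 r by exact: root_not_cluster.
have nS2r : ~ S2 r by exact: root_not_cluster.
have nS2w : ~ S2 w by move=> /cluster_inv[[_ /eqP//]|]; rewrite wp.
have S12 v : S1 v -> ~ S2 v.
  elim=> {v} [v vT vr vw _ _|v vT vr _ Sp IH] /cluster_inv[[pr _]|].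
  - by move: wr; rewrite -vw pr eqxx.
  - by move=> S2p; apply: nS2w; rewrite -vw.
  - by apply: nS1r; rewrite -pr.
  - exact: IH.
have [X1 [X1off X1c [q1 q1c H1]]] := cluster_deform T_tree r_in F_frontier A close_near c0 hQ1.
have [X2 [X2off X2c [q2 q2s H2]]] := cluster_deform T_tree r_in F_frontier A close_near s0 hQ2.
have Su1 : S1 u1 by exact: cluster_top.
have u1s : ev u1 \in star T F w by have := ev_star_par F e0 T_tree r_in u1T u1r; rewrite u1w.
have u1E : ev u1 != ev w.
  by apply/eqP => /(ev_inj T_tree r_in u1T u1r wT wr) E1; apply: nS1w; rewrite -E1.
(* q dominates the short edges at the root and at w, all radii below [s r], and the threshold of the
   second deformation; every m between q and [s r] is an allowed new value at [ev w]. *)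
have [q qs [[q2q q0 qx qw] [qr clw]]] : exists2 q, q < s r & [/\ q2 < q, 0 < q,
    forall e, e \in star T F r -> e != ev w -> x e < q & forall e, e \in star T F w -> e != ev w -> x e < q] /\
    (forall v, v \in sv T -> s v < s r -> s v < q) /\ (forall m, q < m -> m < s r -> close (ev w) m).
  have [q3 q3s H3] := radii_gap.
  have h4 : \forall q \near (s r)^'-, forall e, e \in star T F r -> e != ev w -> x e < q.
    apply: (near_fset (Q := fun e q => e != ev w -> x e < q)) => e es.
    have [ew|ew] := boolP (e != ev w); last by apply: nearW.
    by apply: (filterS _ (nbhs_left_gt (xothers e es ew))).
  have h5 : \forall q \near (s r)^'-, forall e, e \in star T F w -> e != ev w -> x e < q.
    apply: (near_fset (Q := fun e q => e != ev w -> x e < q)) => e es.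
    have [ew|ew] := boolP (e != ev w); last by apply: nearW.
    have xe : x e < s r by rewrite -xw lxw.
    by apply: (filterS _ (nbhs_left_gt xe)).
  have h6 : \forall m \near (s r)^'-, close (ev w) m.
    have := close_near (ev_se e0 T_tree r_in wT wr); rewrite xw.
    by have : z @[z --> (s r)^'-] --> s r by [apply: cvg_at_left_filter; exact: cvg_id]; apply.
  have [q4 q4s H4] := near_left_ex h4.
  have [q5 q5s H5] := near_left_ex h5.
  have [q6 q6s H6] := near_left_ex h6.
  have [q7 [q3q7 q4q7 q7s]] := between_max q3s q4s.
  have [q8 [q5q8 q6q8 q8s]] := between_max q5s q6s.
  have [q9 [q7q9 q8q9 q9s]] := between_max q7s q8s.
  have [q [q9q q2q qs]] := between_max q9s q2s.
  have q4q : q4 < q := lt_trans q4q7 (lt_trans q7q9 q9q).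
  have q5q : q5 < q := lt_trans q5q8 (lt_trans q8q9 q9q).
  have q6q : q6 < q := lt_trans q6q8 (lt_trans q8q9 q9q).
  have q3q : q3 < q := lt_trans q3q7 (lt_trans q7q9 q9q).
  exists q => //; split; [split => //|split].
  - by apply: (lt_trans (xstar _ _ u1s)); exact: H5.
  - by move=> e es ew; apply: H4.
  - by move=> e es ew; apply: H5.
  - by move=> v vT sv; apply: (lt_trans (H3 v vT sv)).
  - by move=> m qm ms; apply: H6 => //; exact: lt_trans qm.
have angw : ang (x (ev w)) (s w) = pi / 2 by rewrite sw xw angxx.
have sumq : pi / 2 < \sum_(e <- star T F w | e != ev w) ang (x e) q.
  rewrite -angw -Ew; apply: (@ltr_sum_mem _ _ _ _ _ _ (ev u1)) => // [e es ew|]; rewrite sw.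
    by apply: ang_anti => //; [exact/ltW/(xstar _ _ es)|exact: ltW].
  by apply: ang_anti_lt => //; [exact: xstar u1s|apply/ltW/qw].
have [p pc Hp] : exists2 p, p < c & forall t, p < t -> t < c ->
    pi / 2 < \sum_(e <- star T F w | e != ev w) ang (X1 t e) q.
  apply: near_left_ex; apply: (cvgr_gt _ _ _ sumq).
  by apply: cvg_big_sum => e _ _; apply: cvg_ang => //; exact: cvg_cst.
have [t [q1t pt tc]] := between_max q1c pc.
have [t0 cl1 X10 X1S X1par] := H1 t q1t tc; have {Hp} Hp := Hp t pt tc.
have X1F e v : e \in star T F v -> 0 < X1 t e <= x e by move=> es; apply: X10; exact: star_sub es.
have X1v e : (exists2 v, S1 v & e = ev v) \/ (forall m, X1 m e = x e) /\ (forall v, S1 v -> e != ev v).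
  have [h|h] := pselect (exists2 v, S1 v & e = ev v); [by left|right].
  have off v : S1 v -> e != ev v by move=> Sv; apply/eqP => Ee; apply: h; exists v.
  by split => // m; apply: X1off.
have X2v e : (exists2 v, S2 v & e = ev v) \/ (forall m, X2 m e = x e) /\ (forall v, S2 v -> e != ev v).
  have [h|h] := pselect (exists2 v, S2 v & e = ev v); [by left|right].
  have off v : S2 v -> e != ev v by move=> Sv; apply/eqP => Ee; apply: h; exists v.
  by split => // m; apply: X2off.
pose L := Num.max q t.
have L0 : 0 < L by rewrite lt_max q0.
have qL : q <= L by rewrite le_max lexx.
have tL : t <= L by rewrite le_max lexx orbT.
have Ls : L <= s r by rewrite ge_max (ltW qs) (le_trans (ltW tc)).
have sumL : pi / 2 < \sum_(e <- star T F w | e != ev w) ang (X1 t e) L.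
  rewrite /L; have [//|qt] := leP t q.
  have cs : c = s r.
    apply/eqP; rewrite eq_le cr/= leNgt; apply/negP => /(qr _ u1T) /(lt_trans tc).
    by rewrite ltNge ltW.
  have lt_e e : e \in star T F w -> e != ev w -> ang (x e) (s w) < ang (X1 t e) t.
    move=> es ew; rewrite sw -cs; have [[v Sv ->]|[-> _]] := X1v e; first by case: (X1S v Sv).
    by apply: ang_anti_lt => //; [exact: xstar es|exact/ltW/(lt_trans (qw _ es ew))].
  rewrite -angw -Ew; apply: (@ltr_sum_mem _ _ _ _ _ _ (ev u1)) => // [e es ew|]; last exact: lt_e.
  exact/ltW/lt_e.
(* [m] is the radius at which the other angles at w add up to pi/2, so giving [ev w] the value m
   keeps w semicyclic. *)
have [m /andP[Lm ms] mE] : exists2 m, L <= m <= s r &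
    \sum_(e <- star T F w | e != ev w) ang (X1 t e) m = pi / 2.
  apply: ang_sum_IVT_decr => //; rewrite (ltW sumL) andbT -angw -Ew sw; apply: ler_sum_mem => e es _.
  by apply: ang_le => //; case/andP: (X1F e _ es).
have Lm' : L < m by rewrite lt_neqAle Lm andbT; apply/eqP => Em; move: sumL; rewrite Em mE ltxx.
(* Strict because the edge [ev u1] has become strictly shorter. *)
have ms' : m < s r.
  rewrite lt_neqAle ms andbT; apply/eqP => Em.
  suff : \sum_(e <- star T F w | e != ev w) ang (X1 t e) m <
      \sum_(e <- star T F w | e != ev w) ang (x e) (s w) by rewrite mE Ew angw ltxx.
  rewrite Em sw; apply: (@ltr_sum_mem _ _ _ _ _ _ (ev u1)) => // [e es ew|].
    by apply: ang_le => //; case/andP: (X1F e _ es).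
  have [_ Xu _] := X1S u1 Su1; have /andP[X0 _] := X1F _ _ u1s.
  have xu : x (ev u1) < s r by rewrite (lt_le_trans bad1).
  by rewrite ang_lt// ?ltW ?(lt_trans Xu xu) ?(xstar _ _ u1s).
have qm : q < m := le_lt_trans qL Lm'.
have m0 : 0 < m := lt_trans q0 qm.
have tm : t < m := le_lt_trans tL Lm'.
have [_ cl2 X20 X2S X2par] := H2 m (lt_trans q2q qm) ms'.
pose x' e := if e == ev w then m else if `[< exists2 v, S1 v & e = ev v >] then X1 t e else X2 m e.
have x'w : x' (ev w) = m by rewrite /x' eqxx.
have x'1 v : S1 v -> x' (ev v) = X1 t (ev v).
  move=> Sv; rewrite /x'; have [vT vr _ _] := S1P v Sv; case: eqP => [/(ev_inj T_tree r_in vT vr wT wr) vw|_].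
    by case: nS1w; rewrite -vw.
  by case: asboolP => // -[]; exists v.
have x'2 e : e != ev w -> (forall v, S1 v -> e != ev v) -> x' e = X2 m e.
  by move=> /negbTE ew h; rewrite /x' ew; case: asboolP => // -[v /h/eqP].
have x'_off e : e != ev w -> (forall v, S1 v -> e != ev v) -> (forall v, S2 v -> e != ev v) -> x' e = x e.
  by move=> h1 h2 h3; rewrite x'2// X2off.
have x'F e : e \in se T `|` F -> 0 < x' e <= x e.
  move=> eT; have [->|ew] := eqVneq e (ev w); first by rewrite x'w m0 xw.
  have [[v Sv ->]|[_ h]] := X1v e; last by rewrite x'2// X20.
  have [vT vr _ _] := S1P v Sv; rewrite x'1//; apply: X10.
  by rewrite inE ev_se.
(* At radius m the edge [ev w] again contributes pi/2 and every other root edge at least its old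
   angle, so the sum is at least pi. At [s r] it is at most pi, since no edge has grown. *)
have [y /andP[my ys] yE] : exists2 y, m <= y <= s r & \sum_(e <- star T F r) ang (x' e) y = pi.
  apply: ang_sum_IVT_decr => //; rewrite -E; apply/andP; split.
    by apply: ler_sum_mem => e es _; apply: ang_le => //; case/andP: (x'F e (star_sub es)).
  apply: ler_sum_mem => e es _; have [->|ew] := eqVneq e (ev w).
    by rewrite x'w xw !angxx.
  have e1 v : S1 v -> e != ev v by exact: cluster_off_star hQ1 wrE nS1r es v.
  rewrite x'2//; have [[v Sv ->]|[-> _]] := X2v e; first by apply/ltW; case: (X2S v Sv).
  by apply: ang_anti => //; exact/ltW/(xstar _ _ es).
pose s' v := if `[< S1 v >] then t else if `[< S2 v >] || (v == w) then m else if v == r then y else s v.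
have s'1 v : S1 v -> s' v = t by rewrite /s'; case: asboolP.
have s'2 v : S2 v -> s' v = m.
  by rewrite /s' => Sv; case: asboolP => [/S12//|_]; rewrite asboolT.
have s'w : s' w = m by rewrite /s'; case: asboolP => //; rewrite eqxx orbT.
have s'r : s' r = y by rewrite /s'; case: asboolP => //; rewrite asboolF//= (negbTE wrE) eqxx.
have s'N v : ~ S1 v -> ~ S2 v -> v != w -> v != r -> s' v = s v.
  by rewrite /s' => h1 h2 /negbTE -> /negbTE ->; rewrite !asboolF.
have y0 : 0 < y by exact: lt_le_trans my.
have s_m v : v \in sv T -> s v < s r -> s v <= m.
  by move=> vT /(qr _ vT)/ltW h; exact/(le_trans h)/ltW.
have ev_off v e : v != w -> v != r -> e \in star T F v -> e != ev w.
  move=> vw vr es; apply/eqP => Ee; move: es; rewrite Ee => /(star_ev T_tree r_in wT wr)[] vE.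
    by rewrite vE eqxx in vw.
  by rewrite vE wp eqxx in vr.
have A' : adm T r F e0 x' s'.
  split.
  - by move=> e /x'F/andP[].
  - move=> v vT vr; have [S1v|nS1v] := pselect (S1 v).
      rewrite s'1//; have [N _ _] := X1S v S1v; apply: vnon_ext N => e es.
      have vw : v != w by apply/eqP => vw; apply: nS1w; rewrite -vw.
      have ew := ev_off v e vw vr es.
      have [[u Su ->]|[-> h]] := X1v e; first exact: x'1.
      apply: x'_off => //; apply: cluster_off_star hQ2 vr _ es; exact: S12.
    have [S2v|nS2v] := pselect (S2 v).
      rewrite s'2//; have [N _ _] := X2S v S2v; apply: vnon_ext N => e es.
      have vw : v != w by apply/eqP => vw; apply: nS2w; rewrite -vw.
      by apply: x'2; [exact: ev_off vw vr es|apply: cluster_off_star hQ1 vw nS1v es].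
    have [->|vw] := eqVneq v w.
      have x'e e : e \in star T F w -> e != ev w -> x' e = X1 t e.
        move=> es ew; have [[u Su ->]|[-> h]] := X1v e; first exact: x'1.
        by apply: x'_off => //; apply: cluster_off_star hQ2 wr nS2w es.
      rewrite s'w; split; rewrite ?x'w//.
        move=> e es ew; rewrite x'e//; apply: lt_trans qm; apply: le_lt_trans (qw e es ew).
        by case/andP: (X1F e _ es).
      rewrite angxx// -mE big_seq_cond [RHS]big_seq_cond; apply: eq_bigr => e /andP[es ew].
      by rewrite x'e.
    rewrite s'N//; apply: vnon_ext (adm_non A vT vr) => e es; apply: x'_off.
    + exact: ev_off es.
    + exact: cluster_off_star hQ1 vw nS1v es.
    + exact: cluster_off_star hQ2 vr nS2v es.
  - rewrite s'r; split => // e es; have [->|ew] := eqVneq e (ev w); first by rewrite x'w.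
    apply: (le_trans _ my); have /andP[_ h] := x'F e (star_sub es).
    exact: (le_trans h (ltW (lt_trans (qx e es ew) qm))).
  - move=> v vT vr; have [S1v|nS1v] := pselect (S1 v).
      rewrite (s'1 v)//; have [->|Sp] := S1par v S1v; last by rewrite s'1.
      by rewrite s'w ltW.
    have [S2v|nS2v] := pselect (S2 v).
      by rewrite (s'2 v)//; have [->|Sp] := S2par v S2v; [rewrite s'r|rewrite s'2].
    have [->|vw] := eqVneq v w; first by rewrite s'w wp s'r.
    rewrite (s'N v)//; have [Sp|nS1p] := pselect (S1 (par v)); first by rewrite s'1// X1par.
    have [Sp|nS2p] := pselect (S2 (par v)); first by rewrite s'2// X2par.
    have [pw|pw] := eqVneq (par v) w.
      rewrite pw s'w; have [/s_m ->//|rs] := ltP (s v) (s r).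
      (* A child of w whose radius exceeds m has radius [s r]; by the maximal choice of c this is c,
         so the child lies in the first cluster. *)
      have sr : s v = s r by apply/le_anti; rewrite rs (adm_le_root T_tree r_in A).
      have bad : x (ev v) < s v.
        by have := x_child_lt T_tree r_in A vT vr; rewrite pw => /(_ wr); rewrite xw sr.
      have vc : s v = c by apply/le_anti; rewrite u1max//= sr.
      by exfalso; apply: nS1v; apply: cluster_top; rewrite // -vc.
    have [pr|pr] := eqVneq (par v) r; last by rewrite s'N// (adm_par A).
    rewrite pr s'r; have [/s_m h|rs] := ltP (s v) (s r); first exact: le_trans (h vT) my.
    have sr : s v = s r by apply/le_anti; rewrite rs (adm_le_root T_tree r_in A).
    have bad : x (ev v) < s r.
      apply: xothers; first by have := ev_star_par F e0 T_tree r_in vT vr; rewrite pr.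
      by apply/eqP => /(ev_inj T_tree r_in vT vr wT wr)/eqP; apply/negP.
    by exfalso; apply: nS2v; apply: cluster_top.
apply: (area_min_contra A').
- move=> f fF; apply: x'_off; [|exact: cluster_off_F|exact: cluster_off_F].
  by apply/eqP => Ef; move: (F_se F_frontier fF); rewrite Ef ev_se.
- move=> e eT; split; last by have /andP[] : 0 < x' e <= x e by apply: x'F; rewrite inE eT.
  have [->|ew] := eqVneq e (ev w); first by rewrite x'w; exact: clw.
  have [[v Sv Ee]|[_ h]] := X1v e; last by rewrite x'2//; exact: cl2.
  by rewrite Ee x'1// -Ee; exact: cl1.
- by rewrite s'r.
- move=> v vT vr; rewrite s'r; have [/s_m h|rs] := ltP (s v) (s r); first by left; exact: le_trans (h vT) my.
  by right; apply/le_anti; rewrite rs (adm_le_root T_tree r_in A).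
- exists u1; split => //; rewrite s'r s'1// lt_eqF// lt_min tc/=.
  exact: lt_le_trans my.
Qed.

End moves.

(** * Local minima *)

Section minimum.
Local Open Scope fset_scope.
Local Open Scope ring_scope.
Variables (R : realType) (V : graph) (T : subgraph V) (r : gvert V) (F : {fset gedge V}) (e0 : gedge V).
Hypotheses (T_tree : is_tree T) (r_in : r \in sv T) (F_frontier : is_frontier T F).
Hypothesis T_valence : forall v, v \in sv T -> (3 <= valence T F v)%N.
Implicit Types (u v w : gvert V) (e f : gedge V).
Local Notation ev := (ev T r e0).
Local Notation par := (par T r).
Variables (dF d : gedge V -> R) (s : gvert V -> R).
Hypothesis (d_min : is_local_min T r F dF d).
Local Notation x := (half_length d).
Hypothesis A : adm T r F e0 x s.

(** Continuity of [arsh] turns closeness of lengths into the abstract neighbourhoods [close] in the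
    sinh coordinates. *)
Lemma local_min_area : exists close : gedge V -> R -> Prop,
  (forall e, e \in se T -> \forall y \near x e, close e y) /\
  forall x' s', adm T r F e0 x' s' -> (forall f, f \in F -> x' f = x f) ->
    (forall e, e \in se T -> close e (x' e)) -> area T r F e0 x s <= area T r F e0 x' s'.
Proof.
have [dAd [eps eps0 dmin]] := d_min.
exists (fun e y => `|2 * arsh y - d e| < eps); split => [e eT|x' s' A' x'F cl].
  have C : (2 * arsh y - d e) @[y --> x e] --> (2 * arsh (x e) - d e).
    apply: cvgB; last exact: cvg_cst.
    by apply: cvgM; [exact: cvg_cst|exact: continuous_arsh].
  have E : 2 * arsh (x e) - d e = 0 by rewrite /half_length shK; lra.
  rewrite E in C.
  by apply: (filterS _ (cvgr_distC_lt _ _ C _ eps0)) => y; rewrite subr0.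
pose d' e := 2 * arsh (x' e).
have d'E : half_length d' = x'.
  by apply/funext => e; rewrite /half_length /d' mulrC mulKf ?arshK.
have A'' : adm T r F e0 (half_length d') s' by rewrite d'E.
have Ad' : Ad T r F dF d'.
  apply: (adm_Ad T_tree r_in T_valence _ A'') => f fF; rewrite /d' x'F// /half_length shK.
  by have [[_ <-//] _ _ _] := dAd; lra.
have := dmin d' Ad' cl; rewrite (adm_area r_in T_valence A) (adm_area r_in T_valence A'') d'E.
by rewrite ler_pM2l.
Qed.

Let no_inner w u : w \in sv T -> w != r -> s w < s (par w) -> u \in sv T -> u != r -> par u = w ->
  ~ x (ev u) < s u.
Proof.
have [close [c1 c2]] := local_min_area.
by move=> wT wr sw uT ur uw b; exact: (move_inner T_tree r_in F_frontier A c1 c2 wT wr sw uT ur uw b).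
Qed.

Let no_root u : (forall e, e \in star T F r -> x e < s r) -> u \in sv T -> u != r -> par u = r ->
  ~ x (ev u) < s u.
Proof.
have [close [c1 c2]] := local_min_area.
by move=> h uT ur uw b; exact: (move_root T_tree r_in F_frontier A c1 c2 h uT ur uw b).
Qed.

Let no_longest w u : w \in sv T -> w != r -> par w = r -> x (ev w) = s r ->
  u \in sv T -> u != r -> par u = w -> ~ x (ev u) < s u.
Proof.
have [close [c1 c2]] := local_min_area.
move=> wT wr wp xw uT ur uw b.
exact: (move_longest T_tree r_in F_frontier A c1 c2 (T_valence r_in) wT wr wp xw uT ur uw b).
Qed.

Let x_le v : v \in sv T -> v != r -> x (ev v) <= s v.
Proof. by move=> vT vr; case: (adm_non A vT vr). Qed.

Let nBC v : v \in sv T -> v != r -> ~ BC (Pv T F d v) <-> x (ev v) < s v.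
Proof.
move=> vT vr; rewrite (adm_BC T_valence A vT vr) lt_neqAle x_le// andbT.
by split => [/eqP|/eqP].
Qed.

(** If the root is centered, [move_root] makes its children semicyclic. The radius of a semicyclic
    vertex is the parameter of its longest edge, hence below the radius of its parent, so
    [move_inner] carries semicyclicity down the tree. *)
Lemma bad_root_BC v : v \in sv T -> v != r -> ~ BC (Pv T F d v) -> BC (Pv T F d r).
Proof.
move=> vT vr /(nBC vT vr) bad; apply: contrapT; rewrite (adm_BC_root r_in T_valence A) => h.
have xr e : e \in star T F r -> x e < s r.
  move=> es; have [_ lx _] := adm_cen A; rewrite lt_neqAle lx// andbT.
  by apply/eqP => xe; apply: h; exists e.
suff : v = r \/ x (ev v) = s v by case => [vE|]; [rewrite vE eqxx in vr|move/eqP; rewrite lt_eqF].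
move: v {vr bad} vT; apply: (tree_ind e0 T_tree r_in); first by left.
move=> v vT vr IH; right; apply/le_anti; rewrite x_le//= leNgt; apply/negP.
have pT := par_in e0 T_tree r_in vT vr.
have [pr|pr] := eqVneq (par v) r; first exact: no_root.
apply: (no_inner pT pr) => //.
case: IH => [pE|<-]; first by rewrite pE eqxx in pr.
have [ppr|ppr] := eqVneq (par (par v)) r.
  by rewrite ppr xr//; have := ev_star_par F e0 T_tree r_in pT pr; rewrite ppr.
apply: (lt_le_trans (x_child_lt T_tree r_in A pT pr ppr)); apply: x_le => //.
exact: par_in.
Qed.

(** The vertices all of whose ancestors, themselves included, have the root radius: the vertex set
    of T_0. *)
Inductive equal_radius : gvert V -> Prop :=
| equal_radius_root : equal_radius r
| equal_radius_step v of v \in sv T & v != r & s v = s r & equal_radius (par v) : equal_radius v.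

Lemma equal_radiusP v : equal_radius v -> v \in sv T /\ s v = s r.
Proof. by case. Qed.

(** By [move_inner] the parent p of v has the same radius as its own parent. If p is nonsemicyclic
    the claim passes up from p. If p is semicyclic and its parent is not the root, the longest edge
    at that parent would exceed the radius there. *)
Lemma bad_par_equal_radius v : v \in sv T -> v != r -> x (ev v) < s v -> equal_radius (par v).
Proof.
move=> vT; move: (v) (vT); apply: (tree_ind e0 T_tree r_in) => [|{vT}v vT vr IH _ bad]; first by rewrite eqxx.
have [->|pr] := eqVneq (par v) r; first exact: equal_radius_root.
have pT := par_in e0 T_tree r_in vT vr.
have sp : s (par v) = s (par (par v)).
  apply/le_anti; rewrite (adm_par A)//= leNgt; apply/negP => sp.
  exact: (no_inner pT pr sp vT vr erefl bad).
suff pp : equal_radius (par (par v)).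
  by apply: equal_radius_step => //; have [_ <-] := equal_radiusP pp.
have [xp|xp] := ltP (x (ev (par v))) (s (par v)); first exact: IH.
have [->|ppr] := eqVneq (par (par v)) r; first exact: equal_radius_root.
have := lt_le_trans (x_child_lt T_tree r_in A pT pr ppr) (x_le (par_in e0 T_tree r_in pT pr) ppr).
by rewrite -sp ltNge xp.
Qed.

Definition radius_edge e := exists2 v, equal_radius v & v != r /\ e = ev v.
Definition radius_sv := [fset v in sv T | `[< equal_radius v >]].
Definition radius_se := [fset e in se T | `[< radius_edge e >]].

Lemma radius_svP v : v \in radius_sv <-> equal_radius v.
Proof.
rewrite !inE; split => [/andP[_ /asboolP]//|h].
by have [-> _] := equal_radiusP h; apply/asboolP.
Qed.

Lemma radius_seP e : e \in radius_se <-> radius_edge e.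
Proof.
rewrite !inE; split => [/andP[_ /asboolP]//|[v h [vr ->]]].
have [vT _] := equal_radiusP h; rewrite ev_se//=.
by apply/asboolP; exists v.
Qed.

Lemma equal_radius_par v : equal_radius v -> v != r -> equal_radius (par v).
Proof. by case => //; rewrite eqxx. Qed.

Lemma radius_se_ends e : e \in radius_se -> ends e `<=` radius_sv.
Proof.
move=> /radius_seP[v h [vr ->]]; have [vT _] := equal_radiusP h.
apply/fsubsetP => u; rewrite ends_ev// in_fset2 => /orP[]/eqP -> //; apply/radius_svP => //.
exact: equal_radius_par.
Qed.

Definition radius_subtree := Subgraph radius_se_ends.

Lemma radius_subtree_le : subgraph_le radius_subtree T.
Proof. by split; apply/fsubsetP => z; rewrite !inE => /andP[]. Qed.

Lemma radius_walk v : equal_radius v -> exists t, walk radius_subtree v t r.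
Proof.
elim=> {v} [|v vT vr sv h [t tP]]; first by exists [::].
exists ((ev v, par v) :: t); split => //; last exact: ends_ev.
by apply/radius_seP; exists v => //; exact: equal_radius_step.
Qed.

(** Arcs inside the subtree go through the root, and their uniqueness is inherited from T. In a
    competitor H the arc to the root is the one of T, so all ancestors lie in H and have the root
    radius. *)
Lemma radius_subtree_maximal : maximal_equiradial_subtree T r F d radius_subtree.
Proof.
have rS : r \in sv radius_subtree by apply/radius_svP; exact: equal_radius_root.
split.
  split => //; first last.
  - move=> v /radius_svP/equal_radiusP[vT sv].
    by rewrite !(adm_radius r_in T_valence A)// sv.
  - exact: radius_subtree_le.
  split; first by apply/fset0Pn; exists r.
  move=> v w vS wS.
  have [t1 W1] := radius_walk (iffLR (radius_svP v) vS).
  have [t2 W2] := radius_walk (iffLR (radius_svP w) wS).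
  have [t3 W3] := walk_rev W2.
  have [t a] := walk_arc vS (walk_cat W1 W3).
  exists t; split => // t' a'.
  have [vT wT] : v \in sv T /\ w \in sv T.
    by move/radius_svP: vS => /equal_radiusP[-> _]; move/radius_svP: wS => /equal_radiusP[-> _].
  have [t0 [_ u0]] := T_tree.2 v w vT wT.
  by rewrite -(u0 _ (arc_le radius_subtree_le a)) -(u0 _ (arc_le radius_subtree_le a')).
move=> H [H_tree HT rH Hrad].
have Hs v : v \in sv H -> s v = s r.
  move=> vH; have vT : v \in sv T by have [/fsubsetP + _] := HT; apply.
  have := Hrad v vH; rewrite !(adm_radius r_in T_valence A)// => E.
  by rewrite -[LHS]arshK E arshK.
have arcH t v : Defs.arc H v t r -> equal_radius v.
  elim: t v => [|[e u] t IH] v a; first by have [_ /= -> _] := a; exact: equal_radius_root.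
  have [vH [eH eE W] U] := a.
  have uH : u \in sv H by apply: (edge_end_in eH); rewrite eE !inE eqxx orbT.
  have vT : v \in sv T by have [/fsubsetP + _] := HT; apply.
  have aE := arc_of_unique T_tree r_in (arc_le HT a).
  apply: equal_radius_step => //; last 2 first.
  - exact: Hs.
  - have -> : par v = u by rewrite /par -aE.
    apply: IH; split => //; by case/andP: U.
  by apply/eqP => vr; move: aE; rewrite vr (arc_of_root T_tree r_in).
have HS v : v \in sv H -> equal_radius v.
  by move=> vH; have [t [a _]] := H_tree.2 v r vH rH; exact: arcH a.
split; first by apply/fsubsetP => v /HS/radius_svP.
apply/fsubsetP => e eH.
have eT : e \in se T by have [_ /fsubsetP] := HT; apply.
have [v [vT vr eE]] := ev_surj e0 T_tree r_in eT.
apply/radius_seP; exists v => //; apply: HS; apply: (edge_end_in eH).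
by rewrite eE ends_ev// !inE eqxx.
Qed.

Lemma longest_root_edge eT : BC (Pv T F d r) -> is_longest_root_edge T r F d eT ->
  eT \in F \/ exists w, [/\ w \in sv T, w != r, par w = r, eT = ev w & x (ev w) = s r].
Proof.
move=> /(adm_BC_root r_in T_valence A)[e es xe] [eTs emax].
have xT : x eT = s r.
  apply/le_anti; have [_ lx _] := adm_cen A; rewrite lx//= -xe sh_le.
  have := emax e es; lra.
have [fF|[_ _]|[w [wT wr wp wE]]] := star_cases e0 T_tree r_in eTs; [by left|by rewrite eqxx|right].
by exists w; rewrite -wE.
Qed.

(** A second edge of T_0 at w would lead to a child with the root radius and an edge shorter than
    [ev w], that is, a nonsemicyclic child, excluded by [move_longest]. *)
Lemma longest_valence w : w \in sv T -> w != r -> par w = r -> x (ev w) = s r ->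
  ev w \in se radius_subtree /\ valence_in radius_subtree w = 1%N.
Proof.
move=> wT wr wp xw.
have sw : s w = s r by apply/le_anti; rewrite (adm_le_root T_tree r_in A)//= -xw x_le.
have wS : equal_radius w by apply: equal_radius_step => //; rewrite wp; exact: equal_radius_root.
have eS : ev w \in radius_se by apply/radius_seP; exists w.
split => //; rewrite /valence_in (_ : [fset e in _ | _] = [fset ev w]) ?cardfs1//.
apply/fsetP => e; rewrite in_fset1; apply/idP/eqP => [|->]; last first.
  by rewrite in_fset inE/= eS ends_ev// in_fset2 eqxx.
rewrite in_fset inE/= => /andP[/radius_seP[u uS [ur ->]]].
have [uT su] := equal_radiusP uS; rewrite ends_ev// in_fset2 => /orP[/eqP -> //|/eqP wu].
exfalso; apply: (no_longest wT wr wp xw uT ur (esym wu)); rewrite su -xw wu.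
by apply: (x_child_lt T_tree r_in A uT ur); rewrite -wu.
Qed.

Lemma local_min_structure v0 : v0 \in sv T -> v0 != r -> ~ BC (Pv T F d v0) ->
  [/\ BC (Pv T F d r) &
      exists T0 : subgraph V,
        [/\ maximal_equiradial_subtree T r F d T0,
            forall eT, is_longest_root_edge T r F d eT ->
              eT \in F \/
              (eT \in se T0 /\
               exists2 vT', other_end eT r vT' & valence_in T0 vT' = 1%N),
            forall v, v \in sv T -> ~ BC (Pv T F d v) ->
              exists e w,
                [/\ init_edge T r v e, other_end e v w & w \in sv T0] &
            forall eT, is_longest_root_edge T r F d eT -> eT \in se T ->
              forall vT', other_end eT r vT' ->
                ~ exists2 v, child T r vT' v & ~ BC (Pv T F d v)]].
Proof.
move=> v0T v0r v0bad; have rBC := bad_root_BC v0T v0r v0bad; split => //.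
exists radius_subtree; split.
- exact: radius_subtree_maximal.
- move=> eT /(longest_root_edge rBC)[|[w [wT wr wp -> xw]]]; [by left|right].
  have [eS val1] := longest_valence wT wr wp xw; split => //; exists w => //.
  by rewrite /other_end ends_ev// wp fsetUC.
- move=> v vT vbad; have vr : v != r by apply/eqP => vr; apply: vbad; rewrite vr.
  exists (ev v), (par v); split.
  + exact/(init_edgeP e0 T_tree r_in _ vT).
  + exact: ends_ev.
  + by apply/radius_svP; apply: bad_par_equal_radius => //; apply/nBC.
- move=> eT /(longest_root_edge rBC)[/(F_se F_frontier)/negP //|[w [wT wr wp -> xw]]] _ w' we.
  have ww : w' = w.
    have : w \in ends (ev w) by rewrite ends_ev// !inE eqxx.
    by rewrite we !inE (negbTE wr) => /eqP.
  rewrite ww => -[v /(childP e0 T_tree r_in)[vT vr vw] /(nBC vT vr)].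
  exact: no_longest xw vT vr vw.
Qed.

End minimum.

Local Open Scope fset_scope.
Local Open Scope ring_scope.
Unset Implicit Arguments.

Theorem corollary2p7 (R : realType) (V : graph) (T : subgraph V)
    (vT : gvert V) (F : {fset gedge V}) (dF d : gedge V -> R)
    (T_tree : is_tree T) (vT_in : vT \in sv T)
    (F_frontier : is_frontier T F)
    (T_valence : forall v, v \in sv T -> (3 <= valence T F v)%N)
    (dF_gt0 : forall f, f \in F -> 0 < dF f)
    (Ad_neq0 : exists d0, Ad T vT F dF d0)
    (d_min : is_local_min T vT F dF d) :
  (forall v, v \in sv T -> v != vT -> BC (Pv T F d v)) \/
  [/\ BC (Pv T F d vT) &
      exists T0 : subgraph V,
        [/\ maximal_equiradial_subtree T vT F d T0,
            forall eT, is_longest_root_edge T vT F d eT ->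
              eT \in F \/
              (eT \in se T0 /\
               exists2 vT', other_end eT vT vT' & valence_in T0 vT' = 1%N),
            forall v, v \in sv T -> ~ BC (Pv T F d v) ->
              exists e w,
                [/\ init_edge T vT v e, other_end e v w & w \in sv T0] &
            forall eT, is_longest_root_edge T vT F d eT -> eT \in se T ->
              forall vT', other_end eT vT vT' ->
                ~ exists2 v, child T vT vT' v & ~ BC (Pv T F d v)]].
Proof.
have [h|h] := pselect (forall v, v \in sv T -> v != vT -> BC (Pv T F d v)); [by left|right].
have [v [v_in vr vbad]] : exists v, [/\ v \in sv T, v != vT & ~ BC (Pv T F d v)].
  apply: contrapT => hn; apply: h => v v_in vr; apply: contrapT => vbad.
  by apply: hn; exists v.
(* Any edge serves as the default value of [ev] at the root. *)
have /fset0Pn[e0 _] : star T F v != fset0 by rewrite -cardfs_gt0 (leq_trans _ (T_valence _ v_in)).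
have [s A] := Ad_adm e0 T_tree vT_in dF_gt0 d_min.1.
exact: (local_min_structure T_tree vT_in F_frontier T_valence d_min A v_in vr vbad).
Qed.
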